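(* Let $X$ be a compact Hausdorff space with a free interval $J$ and let $\Phi$ be an action of an abelian semigroup $S$ on $X$. Assume that $M\subseteq X$ is a minimal set for $\Phi$ which intersects $J$. Then $M$ is contained in a closed metrizable locally connected subspace of $X$ and exactly one of the following conditions holds: (1) $M$ is finite; (2) $M$ is a disjoint union of finitely many circles; (3) $M$ is nowhere dense in $X$, $A=\overline{\mathrm{conv}(M\cap J)}$ is an arc or a circle, and $M\cap A$ is a Cantor set.
   Context: A free interval $J$ in a topological space $X$ is an open subset of $X$ homeomorphic to the open interval $(0,1)$. For a subset $B$ of a free interval $J$, $\mathrm{conv}(B)$ is the convex hull of $B$ in $J$, where $J$ is identified with an open interval of the real line via a homeomorphism; the bar denotes closure in $X$. Semigroups are nonempty and carry the discrete topology. An action of an abelian semigroup $S$ on $X$ is a continuous map $\Phi\colon S\times X\to X$ with $\Phi(s,\Phi(t,x))=\Phi(s+t,x)$ for all $s,t\in S$, $x\in X$; its acting maps are $\varphi_s=\Phi(s,\cdot)$. A minimal set of $\Phi$ is a nonempty closed subset $M\subseteq X$ with $\varphi_s(M)\subseteq M$ for every $s\in S$, having no proper subset with these three properties (nonempty, closed, invariant). An arc is a space homeomorphic to $[0,1]$, a circle is a space homeomorphic to $\mathbb S^1$, and a Cantor set is a space homeomorphic to the standard Cantor set. ''$M$ is a disjoint union of finitely many circles'' means that $M$, with the subspace topology, is homeomorphic to the topological disjoint union of finitely many circles. *)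

(* Defs.v *)
From HB Require Import structures.
From mathcomp Require Import all_boot all_order all_algebra.
From mathcomp Require Import all_classical all_reals all_analysis.

Set Implicit Arguments.
Unset Strict Implicit.
Unset Printing Implicit Defensive.

Import Order.TTheory GRing.Theory Num.Theory.
Import numFieldNormedType.Exports.

Local Open Scope classical_set_scope.
Local Open Scope ring_scope.

(* Subspaces are the sigma types [set_type A] with the initial topology of the
   inclusion; the alias [subspace A] would add isolated points outside [A]. *)

Section Homeomorphisms.
Context {T U : topologicalType}.

Definition homeomorphism (f : T -> U) : Prop :=
  continuous f /\
  exists g : U -> T, [/\ continuous g, cancel f g & cancel g f].

Definition homeomorphic : Prop := exists f : T -> U, homeomorphism f.

End Homeomorphisms.
Arguments homeomorphic : clear implicits.

Definition metrizable (R : realType) (T : topologicalType) : Prop :=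
  exists N : metricType R, homeomorphic T N.

Definition locally_connected (T : topologicalType) : Prop :=
  forall (x : T) (U : set T), nbhs x U ->
    exists V : set T, [/\ open V, connected V, V x & V `<=` U].

Definition nowhere_dense (T : topologicalType) (A : set T) : Prop :=
  interior (closure A) = set0.

Definition open_unit_interval (R : realType) : set R := `]0, 1[%classic.

Definition closed_unit_interval (R : realType) : set R := `[0, 1]%classic.

Definition unit_circle (R : realType) : set (R * R) :=
  [set p | p.1 ^+ 2 + p.2 ^+ 2 = 1].

Arguments open_unit_interval : clear implicits.
Arguments closed_unit_interval : clear implicits.
Arguments unit_circle : clear implicits.

Section Subsets.
Context (R : realType) {X : topologicalType}.
Implicit Types A B J M : set X.

Definition free_interval J : Prop :=
  open J /\ homeomorphic (set_type J) (set_type (open_unit_interval R)).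

(* The convex hull of [B `&` J] in [J], with [J] identified with the open unit
   interval through the chart [h]. *)
Definition conv_in J (h : set_type J -> set_type (open_unit_interval R)) B
    : set X :=
  set_val @` [set x : set_type J |
    set_val (h x) \in Rhull ((set_val \o h) @` (set_val @^-1` B))].

Definition is_arc A : Prop :=
  homeomorphic (set_type A) (set_type (closed_unit_interval R)).

Definition is_circle A : Prop :=
  homeomorphic (set_type A) (set_type (unit_circle R)).

Definition is_cantor A : Prop := homeomorphic (set_type A) cantor_space.

Definition is_finite_union_of_circles A : Prop :=
  exists n : nat,
    homeomorphic (set_type A) {i : 'I_n & set_type (unit_circle R)}.

End Subsets.
Arguments free_interval R {X} J.

Section Actions.
Context {S : addSemigroupType} {X : topologicalType}.

Definition is_action (Phi : S * X -> X) : Prop :=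
  continuous (Phi : discrete_topology S * X -> X) /\
  forall (s t : S) (x : X), Phi (s, Phi (t, x)) = Phi (s + t, x).

Definition acting_map (Phi : S * X -> X) (s : S) : X -> X :=
  fun x => Phi (s, x).

Definition closed_invariant (Phi : S * X -> X) (M : set X) : Prop :=
  [/\ M !=set0, closed M & forall s : S, acting_map Phi s @` M `<=` M].

Definition minimal_set (Phi : S * X -> X) (M : set X) : Prop :=
  closed_invariant Phi M /\
  forall N : set X, closed_invariant Phi N -> N `<=` M -> N = M.

End Actions.

Definition exactly_one_of3 (P Q W : Prop) : Prop :=
  [\/ [/\ P, ~ Q & ~ W], [/\ ~ P, Q & ~ W] | [/\ ~ P, ~ Q & W]].

(* Main.v *)
(* Let [M] be infinite. If [M] contains an open subinterval of [J], the acting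
   maps are injective on [M]: if one of them identified two points of the
   interval, comparing their backward orbits would produce acting maps that
   stretch tiny arcs over large ones; the intermediate value theorem would give
   such a map a fixed point, and by commutativity it would be the identity on
   [M]. Under a return map the interval then sweeps out an arc which either
   closes up to a circle, open in [M], or spirals to a limit fixed by that map,
   which is excluded. Finitely many images of the circle cover [M].

   If [M] contains no open subinterval of [J], it is nowhere dense, because every
   point of [M] is sent into [J] by some acting map and no open subset of [M] is
   collapsed to a point. The set [M] is covered by the images of an arc of [J]
   under finitely many acting maps. The union of these images is the Peano
   subspace containing [M]; moreover, if [M] accumulates at an end of [J], the
   covering forces [J] to converge there to a point of [M], so that the closed
   hull is an arc or a circle. As [M] has no isolated points, its trace on the
   hull is a Cantor set. *)

(* The acting maps need not be invertible and [S] need not have a neutral element, so nothing can be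
   pulled back directly. The substitute is a common multiple: when finitely many [s] suffice to send
   every point of [M] into an open set [U], some [r] has the form [q + s] for each of them, with
   finitely many [q]; as [f r] maps [M] onto itself, every point of [M] is [f q w] with one of these
   [q] and [w] in [U]. Backward orbits can thus be read off in a fixed compact arc of [J]. The same
   covering shows that an open piece of [M] cannot be squeezed into arbitrarily small sets, which is
   what drives the injectivity argument. That property is available at first only at points of [J];
   finiteness of fibres carries it to the rest of [M]. Since [X] is not assumed metrizable, limits
   are taken along ultrafilters. Order arguments in [J] rest on one fact: a connected set that meets
   an open arc of [J] and avoids its two ends stays inside that arc. *)
From HB Require Import structures.
Require Import Defs.
From mathcomp Require Import all_boot all_order all_algebra.
From mathcomp Require Import all_classical all_reals all_analysis.
From mathcomp Require Import ring lra.

Set Implicit Arguments.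
Unset Strict Implicit.
Unset Printing Implicit Defensive.

Import Order.TTheory GRing.Theory Num.Theory.
Import numFieldNormedType.Exports.
Local Open Scope classical_set_scope.

(** * Charts of free intervals *)

(* [lra] fails or becomes slow on hypotheses that are not order facts. *)
Ltac keep_bool := repeat match goal with
  | H : ?T |- _ =>
    lazymatch T with
    | is_true _ => fail
    | @eq _ _ _ => fail
    | _ => lazymatch type of T with Prop => clear H | _ => fail end
    end
  end.

Ltac rlra := try keep_bool; lra.

Section Paths.
Context {R : realType} {X : topologicalType}.
Local Open Scope ring_scope.
Implicit Types (g : R -> X) (a b : R).

Lemma image_segment_connected g a b :
  (forall t : R, a <= t <= b -> {for t, continuous g}) -> connected (g @` `[a, b]).
Proof.
move=> gc; apply: connected_continuous_connected; first exact: segment_connected.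
by apply: continuous_in_subspaceT => t; rewrite inE/= in_itv/=; exact: gc.
Qed.

Lemma image_segment_compact g a b :
  (forall t : R, a <= t <= b -> {for t, continuous g}) -> compact (g @` `[a, b]).
Proof.
move=> gc; apply: continuous_compact; last exact: segment_compact.
by apply: continuous_in_subspaceT => t; rewrite inE/= in_itv/=; exact: gc.
Qed.

Lemma nbhs_distP (t : R) (U : set R) : nbhs t U ->
  exists2 e : R, 0 < e & forall s : R, `|s - t| < e -> U s.
Proof.
move=> /nbhs_ballP[e /= e0 eU]; exists e => // s st; apply: eU.
by rewrite /ball/= distrC.
Qed.

Lemma interval_nbhs (a b t : R) : a < t < b -> nbhs t [set s | a < s < b].
Proof.
move=> tab; apply: (@open_in_nearW _ _ `]a, b[%classic).
- exact: interval_open.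
- by move=> s; rewrite inE/= in_itv.
- by rewrite inE/= in_itv.
Qed.

End Paths.

Lemma hausdorff_open (X : topologicalType) (x y : X) : hausdorff_space X ->
  x <> y -> exists U V, [/\ U x, V y, open U, open V & forall z, U z -> ~ V z].
Proof.
rewrite open_hausdorff => hX /eqP/hX[[U V] [/= /set_mem Ux /set_mem Vy]].
move=> [Uo Vo /eqP UV]; exists U, V; split=> // z Uz Vz.
by have : (U `&` V) z by []; rewrite UV.
Qed.

Lemma closed_equalizer (Y X : topologicalType) (g h : Y -> X) :
  hausdorff_space X -> continuous g -> continuous h ->
  closed [set y | g y = h y].
Proof.
move=> hX gc hc y cly; apply: hX => U V gU hV.
have gUy : nbhs y (g @^-1` U) := gc y U gU.
have hVy : nbhs y (h @^-1` V) := hc y V hV.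
have [z [/= ghz [Uz Vz]]] := cly _ (filterI gUy hVy).
by exists (g z); split=> //; rewrite ghz.
Qed.

Section Charts.
Context {R : realType} {X : topologicalType}.
Local Open Scope ring_scope.
Implicit Types (J C : set X) (j : R -> X) (c : X -> R) (a b p q s t : R).

(** Total maps replace a homeomorphism of subtypes: [j] and [c] are constrained only on []0, 1[] and
    on [J], so subarcs and reversals are plain reparametrizations. *)
Definition chart J j c : Prop :=
  [/\ open J, forall t : R, 0 < t < 1 -> J (j t) /\ c (j t) = t,
      forall x, J x -> 0 < c x < 1 /\ j (c x) = x,
      forall t : R, 0 < t < 1 -> {for t, continuous j} &
      forall x, J x -> {for x, continuous c}].

Lemma chart_inj J j c t s : chart J j c -> 0 < t < 1 -> 0 < s < 1 ->
  j t = j s -> t = s.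
Proof. by move=> [_ jc _ _ _] /jc[_ {2}<-] /jc[_ {2}<-] ->. Qed.

Lemma chart_nbhs J j c x p q : chart J j c -> J x -> p < c x < q ->
  nbhs x [set y | J y /\ p < c y < q].
Proof.
move=> [Jo _ _ _ cc] Jx pq; apply: filterI; first exact: open_nbhs_nbhs.
exact: (cc _ Jx _ (interval_nbhs pq)).
Qed.

Lemma chart_open J j c p q : chart J j c ->
  open [set y | J y /\ p < c y < q].
Proof.
by move=> Jc; rewrite openE => x [Jx xpq]; exact: (chart_nbhs Jc).
Qed.

(** The open arc cuts out of [C] a relatively open set. It is also relatively closed: as [C] avoids
    both ends, the open arc may be replaced by the compact one over [[p, q]], which is closed
    because [X] is Hausdorff. *)
Lemma chart_trap J j c C p t q : hausdorff_space X -> chart J j c ->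
  connected C -> 0 < p -> q < 1 -> p < t < q -> C (j t) -> ~ C (j p) ->
  ~ C (j q) -> C `<=` [set y | J y /\ p < c y < q].
Proof.
move=> hX Jc Cconn p0 q1 /andP[pt tq] Ct Cp Cq.
have [Jo jc cj jcont ccont] := Jc.
set O := [set y | _ /\ _].
suff -> : C = C `&` O by move=> y [].
apply/esym/Cconn.
- exists (j t); split=> //; have [Jt ct] : J (j t) /\ c (j t) = t by apply: jc; lra.
  by split; rewrite // ct; lra.
- by exists O => //; exact: chart_open Jc.
- exists (j @` `[p, q]).
    apply: compact_closed => //; apply: image_segment_compact => s spq.
    by apply: jcont; lra.
  apply/seteqP; split=> y [Cy].
    move=> [Jy ypq]; split=> //; exists (c y); last by have [] := cj _ Jy.
    by rewrite /= in_itv/=; lra.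
  move=> [s]; rewrite /= in_itv/= => spq sy; split=> //.
  have [Js cs] : J (j s) /\ c (j s) = s by apply: jc; lra.
  rewrite /O/= -sy; split=> //; rewrite cs; apply/andP; split.
    rewrite lt_neqAle; apply/andP; split; last lra.
    by apply/eqP => ps; apply: Cp; rewrite ps sy.
  rewrite lt_neqAle; apply/andP; split; last lra.
  by apply/eqP => sq; apply: Cq; rewrite -sq sy.
Qed.

Lemma chart_rev J j c : chart J j c ->
  chart J (fun t => j (1 - t)) (fun x => 1 - c x).
Proof.
move=> [Jo jc cj jcont ccont]; split=> //.
- by move=> t t01; have [|Jt ct] := jc (1 - t); [lra|split=> //; rewrite ct; lra].
- move=> x Jx; have [cx jx] := cj _ Jx; split; first lra.
  by rewrite -[RHS]jx; congr j; lra.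
- move=> t t01; apply: (@continuous_comp _ _ _ (fun t : R => 1 - t) j).
    by apply: cvgB; [exact: cvg_cst|exact: cvg_id].
  by apply: jcont; lra.
- by move=> x Jx; apply: cvgB; [exact: cvg_cst|exact: ccont].
Qed.

Lemma chart_sub J j c a b : chart J j c -> 0 <= a -> a < b -> b <= 1 ->
  chart [set y | J y /\ a < c y < b]
    (fun t => j (a + (b - a) * t)) (fun x => (c x - a) / (b - a)).
Proof.
move=> Jc a0 ab b1; have [Jo jc cj jcont ccont] := Jc.
have ba0 : 0 < b - a by lra.
have aff t : 0 < t < 1 -> a < a + (b - a) * t < b by move=> t01; nra.
split; first exact: chart_open Jc.
- move=> t t01; have ? := aff _ t01.
  have [|Jt ct] := jc (a + (b - a) * t); first lra.
  by split; [split=> //; rewrite ct; lra|rewrite ct addrC addKr mulrC mulKf//; lra].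
- move=> x [Jx xab]; have [cx jx] := cj _ Jx; split.
    by rewrite divr_gt0 ?ltr_pdivrMr//=; lra.
  by rewrite -[RHS]jx; congr j; rewrite mulrC divfK ?lt0r_neq0//; lra.
- move=> t t01; apply: (@continuous_comp _ _ _ (fun t : R => a + (b - a) * t) j).
    apply: cvgD; first exact: cvg_cst.
    by apply: cvgM; [exact: cvg_cst|exact: cvg_id].
  by apply: jcont; have := aff _ t01; lra.
- move=> x [Jx xab]; apply: cvgM; last exact: cvg_cst.
  by apply: cvgB; [exact: ccont|exact: cvg_cst].
Qed.

End Charts.

(** * Minimal systems *)

(** [ms_dense] is minimality in the form in which it is used: forward orbits are dense in [M]. The
    orbit consists of the images under [S], so the point itself need not belong to it. *)
Record minimal_system {S : addSemigroupType} {X : topologicalType}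
    (f : S -> X -> X) (M : set X) : Prop := MinimalSystem {
  ms_compact : compact [set: X];
  ms_hausdorff : hausdorff_space X;
  ms_continuous : forall s, continuous (f s);
  ms_add : forall s t x, f (s + t)%R x = f s (f t x);
  ms_closed : closed M;
  ms_invariant : forall s x, M x -> M (f s x);
  ms_dense : forall x U, M x -> open U -> U `&` M !=set0 ->
    exists s, U (f s x)
}.

(** The near-covering form of compactness, applied to the filter of finite lists ordered by
    inclusion, yields the list of indices directly. *)
Lemma compact_finite_cover (X : topologicalType) (I : eqType) (K : set X)
    (U : I -> set X) : compact K ->
  (forall x, K x -> exists2 i, nbhs x (U i) & True) ->
  exists l : seq I, forall x, K x -> exists2 i, i \in l & U i x.
Proof.
move=> /compact_near_coveringP Kc KU.
pose F : set_system (seq I) :=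
  filter_from setT (fun l0 : seq I => [set l : seq I | {subset l0 <= l}]).
have FF : Filter F.
  apply: filter_from_filter; first by exists [::].
  move=> l1 l2 _ _; exists (l1 ++ l2) => // l l12.
  by split=> i il; apply: l12; rewrite mem_cat il ?orbT.
have [] := Kc _ F (fun l x => exists2 i, i \in l & U i x) FF.
  move=> x /KU[i xUi _].
  exists (U i, [set l : seq I | i \in l]); first split=> //=.
    by exists [:: i] => // l /(_ i); rewrite /= mem_head; exact.
  by move=> [y l] [/= Uy il]; exists i.
by move=> l _ /(_ l (fun _ => id)) lK; exists l.
Qed.

Section MinimalSystem.
Context {S : addSemigroupType} {X : topologicalType}.
Context {f : S -> X -> X} {M : set X}.
Hypothesis A : minimal_system f M.

Let fD := ms_add A.
Let fc := ms_continuous A.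
Let Minv := ms_invariant A.
Let hX := ms_hausdorff A.

Lemma fC s t x : f s (f t x) = f t (f s x).
Proof. by rewrite -!fD Algebra.addrC. Qed.

Lemma minimal_compact : compact M.
Proof. exact: subclosed_compact (ms_closed A) (ms_compact A) _. Qed.

(** Otherwise the orbit of [x], which stays in [N], would enter the open complement of [N].
    Invariance is asked only at points of [M]. *)
Lemma closed_invariant_eq (N : set X) x : M x -> N x -> closed N ->
  (forall s y, M y -> N y -> N (f s y)) -> M `<=` N.
Proof.
move=> Mx Nx Ncl Ninv y My; apply: contrapT => Ny.
have [s] := ms_dense A Mx (closed_openC Ncl) (ex_intro _ y (conj Ny My)).
by apply; exact: Ninv.
Qed.

(** The image of [M] is compact, hence closed, and commutativity makes it invariant. *)
Lemma minimal_surj s y : M y -> exists2 x, M x & f s x = y.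
Proof.
move=> My; have : M `<=` f s @` M.
  apply: (@closed_invariant_eq _ (f s y)); first exact: Minv.
  - by exists y.
  - apply: compact_closed => //; apply: continuous_compact minimal_compact.
    exact/continuous_subspaceT/fc.
  - by move=> t ? _ [z Mz <-]; exists (f t z); [exact: Minv|exact: fC].
by move=> /(_ _ My).
Qed.

(** By commutativity the fixed points of [f e] form an invariant set, closed since [X] is
    Hausdorff. *)
Lemma fixed_point_id e x : M x -> f e x = x -> forall y, M y -> f e y = y.
Proof.
move=> Mx ex; apply: (@closed_invariant_eq [set y | f e y = y] x) => //.
  by apply: closed_equalizer => //; move=> ?; exact: cvg_id.
by move=> s y My ey /=; rewrite fC ey.
Qed.

Lemma forward_cover U : open U -> U `&` M !=set0 ->
  exists l : seq S, forall x, M x -> exists2 s, s \in l & U (f s x).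
Proof.
move=> Uo UM; apply: (compact_finite_cover minimal_compact) => x Mx.
have [s Us] := ms_dense A Mx Uo UM.
by exists s => //; apply: fc; exact: open_nbhs_nbhs.
Qed.

(** [r] is the sum of [s0] and all terms of [l], and each [q] is that sum with one term left out. In
    the absence of a neutral element, [s0] keeps these sums from being empty. *)
Lemma common_multiple (l : seq S) (s0 : S) : exists r, exists ql : seq S,
  forall s, s \in l -> exists2 q, q \in ql & r = (q + s)%R.
Proof.
elim: l => [|s l [r [ql rq]]]; first by exists s0, [::].
exists (r + s)%R, (r :: [seq (q + s)%R | q <- ql]) => t.
rewrite inE => /predU1P[->|/rq[q qql ->]]; first by exists r; rewrite ?mem_head.
exists (q + s)%R; last by rewrite -!Algebra.addrA (Algebra.addrC t).
by rewrite inE; apply/orP; right; exact: map_f.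
Qed.

(** With [z = f r x] and [f s x] in [U], the decomposition [r = q + s] exhibits [z] as the image of
    [f s x] under [f q]. *)
Lemma backward_cover U : open U -> U `&` M !=set0 ->
  exists l : seq S, forall z, M z ->
    exists2 q, q \in l & exists2 w, (U `&` M) w & f q w = z.
Proof.
move=> Uo UM; have [l lU] := forward_cover Uo UM.
case: (UM) => u [Uu Mu]; have [s0 s0l _] := lU _ Mu.
have [r [ql rq]] := common_multiple l s0.
exists ql => z Mz; have [x Mx xz] := minimal_surj r Mz.
have [s /rq[q qql rE] Us] := lU _ Mx.
exists q => //; exists (f s x); first by split=> //; exact: Minv.
by rewrite -fD -rE.
Qed.

Lemma identity_of_isolated U x : open U -> U `&` M = [set x] ->
  forall s, exists t, forall y, M y -> f (t + s)%R y = y.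
Proof.
move=> Uo Ux s; have [Uxx Mx] : (U `&` M) x by rewrite Ux.
have [t Ut] := ms_dense A (Minv s Mx) Uo (ex_intro _ x (conj Uxx Mx)).
exists t; apply: (fixed_point_id Mx).
have : (U `&` M) (f (t + s)%R x) by split; [rewrite fD|exact: Minv].
by rewrite Ux.
Qed.

(** Every point is carried to [x] by one of finitely many maps, and each of these is undone on [M]
    by another acting map; so [M] consists of finitely many images of [x]. *)
Lemma isolated_finite U x : open U -> U `&` M = [set x] -> finite_set M.
Proof.
move=> Uo Ux; have id_ := identity_of_isolated Uo Ux.
have [Uxx Mx] : (U `&` M) x by rewrite Ux.
have [l lU] := forward_cover Uo (ex_intro _ x (conj Uxx Mx)).
pose t s := xget s [set t | forall y, M y -> f (t + s)%R y = y].
have tP s y : M y -> f (t s) (f s y) = y.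
  rewrite -fD; move: y; rewrite /t; have [u hu] := id_ s.
  exact: (@xgetPex _ s [set t | forall y, M y -> f (t + s)%R y = y] (ex_intro _ u hu)).
apply: (@sub_finite_set _ _ [set` [seq f (t s) x | s <- l]]) => [y My|].
  have [s sl Us] := lU _ My; apply/mapP; exists s => //.
  have : (U `&` M) (f s y) by split=> //; exact: Minv.
  by rewrite Ux => /= <-; rewrite tP.
exact: finite_seq.
Qed.

(** Every orbit passes through [U], where [f s] has the single value [z]. Writing a point of [M] as
    an image under [s + r], commutativity turns it into [f q z] for one of finitely many [q]. *)
Lemma collapse_finite U s z : open U -> U `&` M !=set0 ->
  (forall x, U x -> M x -> f s x = z) -> finite_set M.
Proof.
move=> Uo UM fz; have [l lU] := forward_cover Uo UM.
have [r [ql rq]] := common_multiple l s.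
apply: (@sub_finite_set _ _ [set` [seq f q z | q <- ql]]) => [y My|].
  have [x Mx <-] := minimal_surj (s + r)%R My.
  have [t /rq[q qql ->] Ut] := lU _ Mx.
  apply/mapP; exists q => //.
  by rewrite -(fz _ Ut (Minv t Mx)) 2!fD; exact: fC.
exact: finite_seq.
Qed.

(** Let [q] run over a backward cover by [U], choose [m] in [M] different from all [f q p], and let
    [W] be the set of points that no [f q] sends to [m]. By surjectivity and commutativity, every
    image of the trace of [U] on [M] contains a point that some [f q] does send to [m]. *)
Lemma nonshrinking U p : infinite_set M -> open U -> U `&` M !=set0 -> M p ->
  exists W, [/\ open W, W p & forall t, ~ f t @` (U `&` M) `<=` W].
Proof.
move=> Minf Uo UM Mp; have [l lU] := backward_cover Uo UM.
have [m [Mm mp]] : exists m, M m /\ forall q, q \in l -> f q p != m.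
  apply: contrapT => h; apply: Minf.
  apply: (@sub_finite_set _ _ [set` [seq f q p | q <- l]]) => [y My|].
    apply: contrapT => hy; apply: h; exists y; split=> // q ql.
    by apply/eqP => qp; apply: hy; apply/mapP; exists q.
  exact: finite_seq.
exists (\bigcap_(q in [set` l]) (f q @^-1` ~` [set m]))%classic; split.
- rewrite bigcap_seq; elim: (l) => [|q l' IH].
    by rewrite big_nil; exact: openT.
  rewrite big_cons; apply: openI => //.
  apply: open_comp; first by move=> ? _; exact: fc.
  by apply: closed_openC; exact/accessible_closed_set1/hausdorff_accessible.
- by move=> q ql /eqP; apply/negP; exact: mp.
- move=> t UW; have [m' Mm' mE] := minimal_surj t Mm.
  have [q ql [w UMw wE]] := lU _ Mm'.
  have /(_ q ql) : (\bigcap_(q in [set` l]) (f q @^-1` ~` [set m])) (f t w).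
    by apply: UW; exists w.
  by apply; rewrite /= fC wE.
Qed.

End MinimalSystem.

(** * Limits at the ends of a chart *)

Lemma ultra_cvg (T : Type) (Y : topologicalType) (G : set_system T)
    (g : T -> Y) (K : set Y) : UltraFilter G -> compact K -> G (g @^-1` K) ->
  exists2 p, K p & forall V, nbhs p V -> G (g @^-1` V).
Proof.
move=> GU Kc GK; have [p [Kp gp]] := Kc (g @ G) _ GK.
exists p => // V pV; have [//|GV] := in_ultra_setVsetC (g @^-1` V) GU.
by have [y [nVy Vy]] := gp (~` V) V GV pV.
Qed.

Lemma ultra_seq_const (T : Type) (I : eqType) (G : set_system T) (g : T -> I)
    (l : seq I) : UltraFilter G -> G [set a | g a \in l] ->
  exists2 q, q \in l & G [set a | g a = q].
Proof.
move=> GU; elim: l => [|i l IH] Gl; first by have [] := filter_ex Gl.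
have [Gi|Gi] := in_ultra_setVsetC [set a | g a = i] GU.
  by exists i; rewrite ?mem_head.
have [|q ql Gq] := IH.
  apply: filterS (filterI Gl Gi) => a [/=]; rewrite inE.
  by move=> /predU1P[].
by exists q => //; rewrite inE ql orbT.
Qed.

Section EndConvergence.
Context {R : realType} {S : addSemigroupType} {X : topologicalType}.
Context {f : S -> X -> X} {M : set X}.
Hypothesis A : minimal_system f M.
Local Open Scope ring_scope.

(** Points of [M] near the end are images, under one fixed [f q], of points of a compact middle arc
    that approach some [w]; the limit is [z = f q (j w)]. A short arc at [w] is mapped to a
    connected set joining [z], which is outside [J], to some [j t]. It cannot be trapped between the
    midpoint of [J] and a later [j d], so it contains every such [j d]. *)
Lemma end_convergence J (j : R -> X) c : chart J j c ->
  (forall p : R, 0 < p < 1 -> exists t : R, p < t < 1 /\ M (j t)) ->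
  exists z, [/\ M z, ~ J z & forall V, nbhs z V ->
    exists2 p : R, 0 < p < 1 & forall t : R, p < t < 1 -> V (j t)].
Proof.
move=> Jc Macc; have [Jo jc cj jcont ccont] := Jc.
have hX := ms_hausdorff A.
have [t0 [t0h Mt0]] : exists t : R, 2^-1 < t < 1 /\ M (j t) by apply: Macc; lra.
(* The bounds of a compact arc of [J] around a point of [M]. *)
pose al := t0 / 2; pose be := (t0 + 1) / 2.
have [al0 be1 t0ab] : [/\ 0 < al, be < 1 & al < t0 < be].
  by rewrite /al /be; split; lra.
pose U := [set y | J y /\ al < c y < be].
have UM : U `&` M !=set0.
  exists (j t0); split=> //; have [|Jt ct] := jc t0; first lra.
  by split=> //; rewrite ct.
have [l lU] := backward_cover A (chart_open al be Jc) UM.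
pose F := filter_from [set p : R | 0 < p < 1]
  (fun p => [set t | p < t < 1 /\ M (j t)]).
have FF : ProperFilter F.
  apply: filter_from_proper; last by move=> p /Macc.
  apply: filter_from_filter; first by exists 2^-1 => /=; lra.
  move=> p q /= p01 q01; exists (Num.max p q).
    by rewrite /= lt_max gt_max; apply/andP; split; lra.
  by move=> t [/=]; rewrite gt_max => /andP[/andP[pt qt] t1] Mt; split; split=> //=; lra.
have [G [GU FG]] := ultraFilterLemma FF.
have Gtail p : 0 < p < 1 -> G [set t | p < t < 1 /\ M (j t)].
  by move=> p01; apply: FG; exists p.
have step t : exists qw : S * R, M (j t) -> [/\ qw.1 \in l, al < qw.2 < be,
    M (j qw.2) & f qw.1 (j qw.2) = j t].
  have [Mt|nMt] := pselect (M (j t)); last first.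
    (* An arbitrary pair, for parameters with [j t] outside [M]. *)
    by have [s _] := ms_dense A Mt0 openT (ex_intro _ _ (conj I Mt0)); exists (s, 0).
  have [q ql [w [[Jw wab] Mw] fw]] := lU _ Mt.
  exists (q, c w) => _; split=> //=.
    by have [_ ->] := cj _ Jw.
  by have [_ ->] := cj _ Jw.
have {step}[g gP] := choice step.
have G12 := Gtail 2^-1 ltac:(lra).
have [q ql Gq] : exists2 q, q \in l & G [set t | (g t).1 = q].
  apply: ultra_seq_const; apply: filterS G12 => t [_ /gP[]].
  by [].
have [w /= wab Gw] : exists2 w, `[al, be]%classic w &
    forall V, nbhs w V -> G [set t | V (g t).2].
  apply: ultra_cvg; first exact: segment_compact.
  apply: filterS G12 => t [_ /gP[_ tab _ _]].
  by rewrite /= in_itv/=; lra.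
rewrite in_itv/= in wab.
have approx V p : nbhs w V -> 0 < p < 1 -> exists w' t : R,
    [/\ V w', al < w' < be, M (j w'), p < t < 1 & f q (j w') = j t].
  move=> wV p01; have [t [[/= gtq Vt] [pt Mt]]] :=
    filter_ex (filterI (filterI Gq (Gw _ wV)) (Gtail _ p01)).
  have [_ tab Mg fg] := gP _ Mt.
  by exists (g t).2, t; split=> //; rewrite -gtq.
have w01 : 0 < w < 1 by lra.
have jw := jcont _ w01.
have fjw : {for w, continuous (f q \o j)}.
  by apply: continuous_comp => //; exact: (ms_continuous A).
have Mw : M (j w).
  apply: (ms_closed A) => V jV.
  by have [w' [_ [Vw' _ Mw' _ _]]] := approx _ 2^-1 (jw _ jV) ltac:(lra); exists (j w').
set z := f q (j w).
(* If [z] were in [J], the approximating points would have coordinates below [r], yet these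
   coordinates are the [t] tending to [1]. *)
have Jz : ~ J z.
  move=> Jz; have [cz jz] := cj _ Jz.
  pose r := (c z + 1) / 2.
  have czr : 0 < c z < r by rewrite /r; lra.
  have r01 : 0 < r < 1 by rewrite /r; lra.
  have [w' [t [Vw' _ _ rt fw']]] :=
    approx _ r (fjw _ (chart_nbhs Jc Jz czr)) r01.
  have [|_ ct] := jc t; first lra.
  by move: Vw' => [_ /=]; rewrite fw' ct; lra.
exists z; split=> //; first exact: (ms_invariant A).
move=> V zV.
(* The point [j 2^-1] is to be the lower wall in [chart_trap], so the short arc has to avoid it. *)
have [e e0 eV] : exists2 e : R, 0 < e & forall s : R, `|s - w| < e ->
    [/\ V (f q (j s)), f q (j s) <> j 2^-1 & 0 < s < 1].
  apply: nbhs_distP; near=> s; split; near: s.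
  - exact: (fjw _ zV).
  - apply: (fjw (~` [set j 2^-1])); apply: open_nbhs_nbhs; split.
      apply: closed_openC; exact/accessible_closed_set1/hausdorff_accessible.
    by move=> /= zj; apply: Jz; rewrite /z zj; have [|//] := jc 2^-1; lra.
  - exact: interval_nbhs.
have [w' [t [we _ _ t12 fw']]] := approx [set s | `|s - w| < e] 2^-1
  ltac:(by apply/nbhs_ballP; exists e => //= s; rewrite /ball/= distrC) ltac:(lra).
pose a := Num.min w w'; pose b := Num.max w w'.
have abe s : a <= s <= b -> `|s - w| < e.
  rewrite /a /b => sab; move: we; rewrite /= !ltr_norml => /andP[? ?].
  by apply/andP; case: (lerP w w') sab => ? ?; lra.
pose C := (f q \o j) @` `[a, b].
have Cconn : connected C.
  apply: image_segment_connected => s /abe/eV[_ _ s01].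
  by apply: continuous_comp; [exact: jcont|exact: (ms_continuous A)].
have Cw : C z by exists w => //=; rewrite in_itv/= /a /b ge_min le_max !lexx.
have Ct : C (j t).
  by exists w' => //=; rewrite in_itv/= /a /b ge_min le_max !lexx !orbT.
have C12 : ~ C (j 2^-1).
  by move=> [s]; rewrite /= in_itv/= => /abe/eV[].
exists t; first lra.
move=> d td; have [Cd|Cd] := pselect (C (j d)).
  by move: Cd => [s]; rewrite /= in_itv/= => /abe/eV[? _ _] <-.
have p0 : (0 : R) < 2^-1 by lra.
have d1 : d < 1 by lra.
have ptd : 2^-1 < t < d by lra.
by have [] := chart_trap hX Jc Cconn p0 d1 ptd Ct C12 Cd Cw.
Unshelve. all: by end_near.
Qed.

End EndConvergence.

(** * Fixed points from first exits *)

Section RealLine.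
Context {R : realType}.
Local Open Scope ring_scope.
Implicit Types (a b t : R) (h : R -> R).

Definition clamp a b t : R := Num.max a (Num.min b t).

Lemma clamp_continuous a b : continuous (clamp a b).
Proof.
move=> t; apply: (@continuous_max R R (fun=> a) (fun t => Num.min b t)).
  exact: cvg_cst.
apply: (@continuous_min R R (fun=> b) id); first exact: cvg_cst.
exact: cvg_id.
Qed.

Lemma clamp_itv a b t : a <= b -> a <= clamp a b t <= b.
Proof.
by move=> ab; rewrite /clamp le_max lexx/= ge_max ab ge_min lexx.
Qed.

Lemma clamp_id a b t : a <= t <= b -> clamp a b t = t.
Proof. by move=> /andP[at_ tb]; rewrite /clamp min_r// max_r. Qed.

Lemma sign_change h a b : a <= b ->
  (forall t : R, a <= t <= b -> {for t, continuous h}) ->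
  (h a <= 0 <= h b) \/ (h b <= 0 <= h a) -> exists2 t : R, a <= t <= b & h t = 0.
Proof.
move=> ab hc h0; have hw : {within `[a, b], continuous h}.
  by apply: continuous_in_subspaceT => t; rewrite inE/= in_itv/=; exact: hc.
have [|t tab ht] := IVT ab hw (v := 0).
  by case: h0 => /andP[h1 h2]; rewrite ge_min le_max h1 h2 ?orbT.
by exists t; rewrite // in_itv/= in tab.
Qed.

Lemma affine_continuous a b : continuous (fun t => a + t * b).
Proof.
move=> t; apply: cvgD; first exact: cvg_cst.
by apply: cvgM; [exact: cvg_id|exact: cvg_cst].
Qed.

Lemma affine_between (a b k m t : R) : a < k < b -> a < m < b -> 0 <= t <= 1 ->
  a < k + t * (m - k) < b.
Proof.
move=> akb amb /andP[t0 t1].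
have [km|km] := lerP k m.
  have := mulr_ge0 t0 (_ : 0 <= m - k); have := ler_wpM2r (_ : 0 <= m - k) t1.
  by rewrite !subr_ge0 => /(_ km) ? /(_ km) ?; rlra.
have := mulr_ge0 t0 (_ : 0 <= k - m); have := ler_wpM2r (_ : 0 <= k - m) t1.
by rewrite !subr_ge0 => /(_ (ltW km)) ? /(_ (ltW km)) ?; rlra.
Qed.

End RealLine.

Section FirstExit.
Context {R : realType} {X : topologicalType}.
Local Open Scope ring_scope.
Implicit Types (J C : set X) (j : R -> X) (c : X -> R) (a b p q s t : R).

(** At the least time outside the open arc, [g] is a limit of points of the closed arc, which is
    compact and hence closed in [X]. So the path leaves through one of the two ends and cannot jump
    out of [J]. *)
Lemma first_exit J j c (g : R -> X) p q : hausdorff_space X -> chart J j c ->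
  0 < p -> q < 1 -> (forall t : R, 0 <= t <= 1 -> {for t, continuous g}) ->
  J (g 0) /\ p < c (g 0) < q -> ~ (J (g 1) /\ p < c (g 1) < q) ->
  exists t : R, [/\ 0 <= t <= 1, g t = j p \/ g t = j q &
    forall s : R, 0 <= s <= t -> J (g s) /\ p <= c (g s) <= q].
Proof.
move=> hX Jc p0 q1 gc g0 g1; have [Jo jc cj jcont ccont] := Jc.
set O := [set y | J y /\ p < c y < q].
have Oo : open O by exact: chart_open Jc.
set K := [set t : R | 0 <= t <= 1 /\ ~ O (g t)].
have Kcl : closed K.
  move=> t Kt; have t01 : 0 <= t <= 1.
    have /(_ t) : closed `[0 : R, 1]%classic by exact: itv_closed.
    rewrite /= in_itv/=; apply => V /Kt[s [[s01 _] Vs]].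
    by exists s; split=> //; rewrite /= in_itv.
  split=> // Ogt; have [s [[s01 nOs] Os]] := Kt _ (gc t t01 _ (open_nbhs_nbhs (conj Oo Ogt))).
  exact: nOs.
have Kcomp : compact K.
  apply: (subclosed_compact Kcl (@segment_compact _ 0 1)) => t [t01 _].
  by rewrite /= in_itv.
have K1 : K 1 by split; rewrite ?ler01 ?lexx.
have idc : {within K, continuous (id : R -> R)}.
  by apply: continuous_subspaceT => t; exact: cvg_id.
have [t] := @compact_EVT_min _ R id K (ex_intro _ 1 K1) Kcomp idc.
rewrite inE => -[t01 nOt] tmin.
have below (s : R) : 0 <= s < t -> O (g s).
  move=> st; apply: contrapT => nOs.
  have : s \in K by rewrite inE; split=> //; rlra.
  by move=> /tmin/=; rlra.
have t0 : 0 < t.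
  rewrite lt_neqAle; apply/andP; split; last rlra.
  by apply/eqP => t0; apply: nOt; rewrite -t0.
have [r rpq jr] : (j @` `[p, q]) (g t).
  have : closed (j @` `[p, q]).
    apply: compact_closed => //; apply: image_segment_compact => s spq.
    by apply: jcont; rlra.
  apply=> V gV; have /nbhs_distP[e e0 eV] := gc t t01 _ gV.
  pose s := Num.max 0 (t - e / 2).
  have st : 0 <= s < t by rewrite /s le_max lexx/= gt_max; rlra.
  exists (g s); split.
    by have [Js cs] := below _ st; exists (c (g s));
      [rewrite /= in_itv/=; rlra|have [] := cj _ Js].
  apply: eV; rewrite ltr_norml /s; case: (lerP 0 (t - e / 2)) => ?; rlra.
rewrite /= in_itv/= in rpq.
have [Jr cr] : J (j r) /\ c (j r) = r by apply: jc; rlra.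
exists t; split=> //.
  have [rp|rp] := eqVneq r p; first by left; rewrite -jr rp.
  have [rq|rq] := eqVneq r q; first by right; rewrite -jr rq.
  by case: nOt; rewrite -jr; split=> //; rewrite cr; apply/andP; split;
    rewrite lt_neqAle ?rq 1?eq_sym ?rp/=; rlra.
move=> s st; have [ts|ts] := ltP s t.
  by have [|? ?] := below s; [rlra|split=> //; rlra].
have -> : s = t by rlra.
by rewrite -jr; split=> //; rlra.
Qed.

(* In the mixed case the two arcs are carried across each other, and the
   intermediate value theorem is applied to [g2 \o g1], with [clamp] extending
   the second arc to all values taken by the first. *)
Lemma fixed_point_of_exits J j c (g1 g2 : X -> X) (u0 u1 v0 v1 k0 k1 m0 m1 : R) :
  hausdorff_space X -> chart J j c -> continuous g1 -> continuous g2 ->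
  0 < u0 -> u1 < v0 -> v1 < 1 ->
  u0 < k0 < u1 -> u0 < k1 < u1 -> v0 < m0 < v1 -> v0 < m1 < v1 ->
  J (g1 (j k0)) /\ u1 < c (g1 (j k0)) < v0 ->
  ~ (J (g1 (j k1)) /\ u0 < c (g1 (j k1)) < v1) ->
  J (g2 (j m0)) /\ u1 < c (g2 (j m0)) < v0 ->
  ~ (J (g2 (j m1)) /\ u0 < c (g2 (j m1)) < v1) ->
  exists k : R, 0 < k < 1 /\
    [\/ g1 (j k) = j k, g2 (j k) = j k | g2 (g1 (j k)) = j k].
Proof.
move=> hX Jc g1c g2c u00 u1v0 v11 k0u k1u m0v m1v g1k0 g1k1 g2m0 g2m1.
have [Jo jc cj jcont ccont] := Jc.
pose nu1 (t : R) := k0 + t * (k1 - k0); pose nu2 (t : R) := m0 + t * (m1 - m0).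
have nu1u (t : R) : 0 <= t <= 1 -> u0 < nu1 t < u1 by exact: affine_between.
have nu2v (t : R) : 0 <= t <= 1 -> v0 < nu2 t < v1 by exact: affine_between.
have nu1c : continuous nu1 by exact: affine_continuous.
have nu2c : continuous nu2 by exact: affine_continuous.
pose be1 (t : R) := g1 (j (nu1 t)); pose be2 (t : R) := g2 (j (nu2 t)).
have be1c (t : R) : 0 <= t <= 1 -> {for t, continuous be1}.
  move=> t01; apply: (@continuous_comp _ _ _ (j \o nu1) g1); last exact: g1c.
  apply: continuous_comp; first exact: nu1c.
  by apply: jcont; have := nu1u _ t01; rlra.
have be2c (t : R) : 0 <= t <= 1 -> {for t, continuous be2}.
  move=> t01; apply: (@continuous_comp _ _ _ (j \o nu2) g2); last exact: g2c.
  apply: continuous_comp; first exact: nu2c.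
  by apply: jcont; have := nu2v _ t01; rlra.
have nu10 : nu1 0 = k0 by rewrite /nu1 mul0r addr0.
have nu20 : nu2 0 = m0 by rewrite /nu2 mul0r addr0.
have nu11 : nu1 1 = k1 by rewrite /nu1; ring.
have nu21 : nu2 1 = m1 by rewrite /nu2; ring.
have be10 : J (be1 0) /\ u1 < c (be1 0) < v0 by rewrite /be1 nu10.
have be20 : J (be2 0) /\ u1 < c (be2 0) < v0 by rewrite /be2 nu20.
have [||t1 [t101 et1 bt1]] := first_exit hX Jc u00 v11 be1c.
- by case: be10 => ? ?; split=> //; rlra.
- by rewrite /be1 nu11.
have [||t2 [t201 et2 bt2]] := first_exit hX Jc u00 v11 be2c.
- by case: be20 => ? ?; split=> //; rlra.
- by rewrite /be2 nu21.
have cu0 : c (j u0) = u0 by have [|_ ->] := jc u0; rlra.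
have cv1 : c (j v1) = v1 by have [|_ ->] := jc v1; rlra.
pose b1 (t : R) := c (be1 t); pose b2 (t : R) := c (be2 t).
have b1c (t : R) : 0 <= t <= t1 -> {for t, continuous b1}.
  move=> tt1; apply: (@continuous_comp _ _ _ be1 c); first by apply: be1c; rlra.
  by apply: ccont; have [] := bt1 _ tt1.
have b2c (t : R) : 0 <= t <= t2 -> {for t, continuous b2}.
  move=> tt2; apply: (@continuous_comp _ _ _ be2 c); first by apply: be2c; rlra.
  by apply: ccont; have [] := bt2 _ tt2.
have jb1 (t : R) : 0 <= t <= t1 -> j (b1 t) = be1 t.
  by move=> /bt1[/cj[]].
have jb2 (t : R) : 0 <= t <= t2 -> j (b2 t) = be2 t.
  by move=> /bt2[/cj[]].
(* For an exit at [u0], [b1] starts above all values of [nu1] and ends below them. *)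
case: et1 => et1.
  have b1t1 : b1 t1 = u0 by rewrite /b1 et1.
  have [t tt1 tE] : exists2 t : R, 0 <= t <= t1 & b1 t - nu1 t = 0.
    apply: sign_change; first rlra.
      by move=> t tt1; apply: cvgB; [exact: b1c|exact: nu1c].
    right; rewrite b1t1 nu10; have := nu1u t1 t101; case: be10 => _.
    by rewrite -/(b1 0); rlra.
  exists (nu1 t); split; first by have := nu1u t ltac:(rlra); rlra.
  by apply: Or31; rewrite -[LHS]/(be1 t) -jb1//; congr j; rlra.
(* Symmetrically, for an exit at [v1], [b2] starts below all values of [nu2] and ends above them. *)
case: et2 => et2; last first.
  have b2t2 : b2 t2 = v1 by rewrite /b2 et2.
  have [t tt2 tE] : exists2 t : R, 0 <= t <= t2 & b2 t - nu2 t = 0.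
    apply: sign_change; first rlra.
      by move=> t tt2; apply: cvgB; [exact: b2c|exact: nu2c].
    left; rewrite b2t2 nu20; have := nu2v t2 t201; case: be20 => _.
    by rewrite -/(b2 0); rlra.
  exists (nu2 t); split; first by have := nu2v t ltac:(rlra); rlra.
  by apply: Or32; rewrite -[LHS]/(be2 t) -jb2//; congr j; rlra.
have b1t1 : b1 t1 = v1 by rewrite /b1 et1.
have b2t2 : b2 t2 = u0 by rewrite /b2 et2.
have m01 : m1 - m0 != 0.
  apply/eqP => m10; have mE : m1 = m0 by rlra.
  by apply: g2m1; rewrite mE; case: g2m0 => ? ?; split=> //; rlra.
(* The parameter at which the affine map [nu2] takes the value [b1 t]; it may fall outside
   [[0, t2]]. *)
pose q (t : R) := (b1 t - m0) / (m1 - m0).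
pose D (t : R) := b2 (clamp 0 t2 (q t)) - nu1 t.
have qE (t : R) : m0 + q t * (m1 - m0) = b1 t by rewrite /q divfK//; ring.
have b10 : u1 < b1 0 < v0 by case: be10.
have b20 : u1 < b2 0 < v0 by case: be20.
have t20 : 0 <= t2 by rlra.
have [t tt1 tE] : exists2 t : R, 0 <= t <= t1 & D t = 0.
  apply: sign_change; first rlra.
    move=> t tt1; apply: cvgB; last exact: nu1c.
    apply: (@continuous_comp _ _ _ (clamp 0 t2 \o q) b2).
      apply: continuous_comp; last exact: clamp_continuous.
      apply: cvgM; last exact: cvg_cst.
      by apply: cvgB; [exact: b1c|exact: cvg_cst].
    by apply: b2c; exact: clamp_itv.
  have q0E := qE 0; have q1E := qE t1.
  have m2v := nu2v _ t201; rewrite /nu2 in m2v.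
  rewrite b1t1 in q1E; rewrite /D nu10.
  have nu1t := nu1u _ t101.
  (* In either direction [D] is positive at the end where [q] is clamped to [0], since [b2 0]
     exceeds [u1], and negative at the end where it is clamped to [t2], since [b2 t2] is [u0]. *)
  have [m01p|m01n] := ltP m0 m1.
    have m10 : 0 < m1 - m0 by rlra.
    have q0 : q 0 < 0 by rewrite -(pmulr_llt0 _ m10); rlra.
    have q1 : t2 < q t1 by rewrite -(ltr_pM2r m10); rlra.
    rewrite [clamp _ _ (q 0)]/clamp min_r ?max_l ?(ltW q0)//; last rlra.
    rewrite [clamp _ _ (q t1)]/clamp min_l ?max_r ?(ltW q1)//; rlra.
  have m10 : m1 - m0 < 0 by rewrite lt_neqAle m01; rlra.
  have q0 : t2 < q 0 by rewrite -(ltr_nM2r m10); rlra.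
  have q1 : q t1 < 0 by rewrite -(nmulr_lgt0 _ m10); rlra.
  rewrite [clamp _ _ (q t1)]/clamp min_r ?max_l ?(ltW q1)//; last rlra.
  rewrite [clamp _ _ (q 0)]/clamp min_l ?max_r ?(ltW q0)//; rlra.
have nu1t : u0 < nu1 t < u1 by apply: nu1u; rlra.
(* [D] does not vanish where the clamp is active, by the same two comparisons. *)
have qt : 0 <= q t <= t2.
  move: tE; rewrite /D /clamp => tE.
  rewrite !leNgt; apply/andP; split; apply/negP => qlt.
    by move: tE; rewrite min_r ?max_l ?(ltW qlt)//; rlra.
  by move: tE; rewrite min_l ?max_r ?(ltW qlt)//; rlra.
exists (nu1 t); split; first rlra.
apply: Or33; move: tE; rewrite /D clamp_id// => tE.
have g1E : g1 (j (nu1 t)) = j (nu2 (q t)) by rewrite -[LHS]/(be1 t) -jb1// -qE.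
by rewrite g1E -[LHS]/(be2 (q t)) -jb2//; congr j; rlra.
Qed.

End FirstExit.

(** * Injectivity of the acting maps *)

Section Injectivity.
Context {R : realType} {S : addSemigroupType} {X : topologicalType}.
Context {f : S -> X -> X} {M : set X}.
Local Open Scope ring_scope.
Context {J : set X} {j : R -> X} {c : X -> R}.
Implicit Types (r : S) (x y : X) (w : R).

(** In the absence of a metric, the size of a connected set is measured by its passing through [x]
    and leaving [N]. *)
Definition nonshrinking_at (x : X) : Prop :=
  forall N p, nbhs x N -> M p -> exists W, [/\ open W, W p &
    forall C, connected C -> C `<=` M -> C x -> ~ C `<=` N ->
      forall t, ~ f t @` C `<=` W].

Lemma chart_meets (p q : R) : chart J j c -> J `<=` M -> 0 <= p -> p < q -> q <= 1 ->
  [set y | J y /\ p < c y < q] `&` M !=set0.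
Proof.
move=> Jc JM p0 pq q1; have [_ jc _ _ _] := Jc.
have [|Jt ct] := jc ((p + q) / 2); first rlra.
exists (j ((p + q) / 2)); split; last exact: JM.
by split; rewrite // ct; rlra.
Qed.

(** A connected set through [x] that leaves [N] is not trapped in the arc of radius [d] at [x], so
    it contains the whole half-arc on one side. [nonshrinking] is applied to both half-arcs. *)
Lemma nonshrinking_chart x : minimal_system f M -> infinite_set M ->
  chart J j c -> J `<=` M -> J x -> nonshrinking_at x.
Proof.
move=> A Minf Jc JM Jx N p xN Mp; have hX := ms_hausdorff A; have [Jo jc cj jcont ccont] := Jc.
have [cx jx] := cj _ Jx.
have [e e0 eN] : exists2 e : R, 0 < e &
    forall s : R, `|s - c x| < e -> N (j s) /\ 0 < s < 1.
  apply: nbhs_distP; apply: filterI; last exact: interval_nbhs.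
  by apply: (jcont _ cx); rewrite jx.
have eI (s : R) : c x - e < s < c x + e -> N (j s) /\ 0 < s < 1.
  by move=> se; apply: eN; rewrite ltr_norml; rlra.
pose d := e / 2.
have d0 : 0 < d by rewrite /d; rlra.
have [_ xd0] : N (j (c x - d)) /\ 0 < c x - d < 1 by apply: eI; rewrite /d; rlra.
have [_ xd1] : N (j (c x + d)) /\ 0 < c x + d < 1 by apply: eI; rewrite /d; rlra.
have [p1 p2 p3] : [/\ 0 <= c x - d, c x - d < c x & c x <= 1] by split; rlra.
have [W1 [W1o W1p W1f]] := nonshrinking A Minf (chart_open (c x - d) (c x) Jc)
  (chart_meets Jc JM p1 p2 p3) Mp.
have [q1 q2 q3] : [/\ 0 <= c x, c x < c x + d & c x + d <= 1] by split; rlra.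
have [W2 [W2o W2p W2f]] := nonshrinking A Minf (chart_open (c x) (c x + d) Jc)
  (chart_meets Jc JM q1 q2 q3) Mp.
exists (W1 `&` W2); split=> //; first exact: openI.
move=> C Cconn CM Cx CN t fCW.
have [C1|] := pselect ([set y | J y /\ c x - d < c y < c x] `<=` C).
  apply: (W1f t) => _ [y [/C1 Cy _] <-].
  by have [] : (W1 `&` W2) (f t y) by apply: fCW; exists y.
have [C2 _|] := pselect ([set y | J y /\ c x < c y < c x + d] `<=` C).
  apply: (W2f t) => _ [y [/C2 Cy _] <-].
  by have [] : (W1 `&` W2) (f t y) by apply: fCW; exists y.
move=> /existsNP[y2 /not_implyP[[Jy2 cy2] Cy2]].
move=> /existsNP[y1 /not_implyP[[Jy1 cy1] Cy1]].
have [cy10 jy1] := cj _ Jy1; have [cy20 jy2] := cj _ Jy2.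
apply: CN => y /(chart_trap hX Jc Cconn (p := c y1) (t := c x) (q := c y2)).
rewrite jy1 jy2 jx => /(_ _ _ _ Cx Cy1 Cy2)[|||Jy cy]; [rlra..|].
have [_ <-] := cj _ Jy; apply: (eI _ _).1; rewrite /d in cy1 cy2; rlra.
Qed.

(** The sum of [n + 1] copies of [r]: a semigroup need not contain an empty sum. *)
Fixpoint multiple (r : S) (n : nat) : S :=
  if n is n'.+1 then multiple r n' + r else r.

Lemma multipleE r n x : minimal_system f M -> 
  f (multiple r n) x = iter n.+1 (f r) x.
Proof.
by move=> A; elim: n x => // n IH x; rewrite /= (ms_add A) IH -iterSr.
Qed.

Lemma iter_fC s r n x : minimal_system f M -> 
  f s (iter n (f r) x) = iter n (f r) (f s x).
Proof. by move=> A; elim: n => //= n <-; rewrite (fC A). Qed.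

Lemma iter_surj r n x : minimal_system f M -> M x -> exists2 y, M y & iter n (f r) y = x.
Proof.
move=> A; elim: n x => [|n IH] x Mx; first by exists x.
have [y My <-] := minimal_surj A r Mx; have [z Mz <-] := IH _ My.
by exists z => //; rewrite iterS.
Qed.

(** For each [n], an [n]-th predecessor of [x] under [f r] has the form [f q (j v)] with [v] between
    [1/4] and [3/4]. Along the ultrafilter [q] becomes constant and [v] converges. *)
Lemma backward_orbit (G : set_system nat) r x :
  minimal_system f M -> chart J j c -> J `<=` M -> UltraFilter G -> M x ->
  exists q (w : R) (v : nat -> R), [/\ 0 < w < 1,
    forall V, nbhs w V -> G [set n | V (v n)] &
    G [set n | iter n (f r) (f q (j (v n))) = x]].
Proof.
move=> A Jc JM GU Mx; have [_ jc cj _ _] := Jc.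
have [p1 p2 p3] : [/\ 0 <= 4^-1 :> R, 4^-1 < 3 / 4 :> R & 3 / 4 <= 1 :> R].
  by split; lra.
have [l lU] := backward_cover A (chart_open 4^-1 (3 / 4) Jc)
  (chart_meets Jc JM p1 p2 p3).
have step n : exists qv : S * R, [/\ qv.1 \in l, 4^-1 < qv.2 < 3 / 4 &
    iter n (f r) (f qv.1 (j qv.2)) = x].
  have [a Ma ax] := iter_surj r n A Mx.
  have [q ql [w [[Jw cw] _] wa]] := lU _ Ma.
  by exists (q, c w); split=> //=; have [_ ->] := cj _ Jw; rewrite wa.
have {step}[g gP] := choice step.
have [q ql Gq] : exists2 q, q \in l & G [set n | (g n).1 = q].
  by apply: ultra_seq_const; apply: filterS filterT => n _; have [] := gP n.
have [w /= wab Gw] : exists2 w : R, `[4^-1, (3 / 4)]%classic w &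
    forall V, nbhs w V -> G [set n | V (g n).2].
  apply: ultra_cvg; first exact: segment_compact.
  apply: filterS filterT => n _ /=; have [_ gn _] := gP n.
  by rewrite in_itv/=; rlra.
exists q, w, (fun n => (g n).2); split=> //.
  by rewrite in_itv/= in wab; rlra.
by apply: filterS Gq => n /= <-; have [] := gP n.
Qed.

(* If [f r x = f r y], the [n]-th backward orbits of [x] and [y] under [f r]
   land on the same point [z] after [m > n] steps, whereas the [m]-th ones land
   on [x] and [y]; so one of the two sequences has close terms whose images are
   far apart. *)
Lemma sensitive_of_not_injective r x y :
  minimal_system f M -> chart J j c -> J `<=` M -> M x -> M y -> x <> y ->
  f r x = f r y -> exists z N (w : R) q, [/\ z = x \/ z = y, nbhs z N, 0 < w < 1 &
    forall e : R, 0 < e -> exists m (w1 w2 : R), [/\ `|w1 - w| < e, `|w2 - w| < e,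
      f (q + multiple r m) (j w1) = z & ~ N (f (q + multiple r m) (j w2))]].
Proof.
move=> A Jc JM Mx My xy rxy; have hX := ms_hausdorff A; have fD := ms_add A.
have [G [GU Ginf]] := ultraFilterLemma eventually_filter.
have [q1 [w1 [v1 [w101 Gv1 Gx]]]] := backward_orbit r A Jc JM GU Mx.
have [q2 [w2 [v2 [w201 Gv2 Gy]]]] := backward_orbit r A Jc JM GU My.
have [Nx [Ny [Nxx Nyy Nxo Nyo NN]]] := hausdorff_open hX xy.
pose good z N q (w e : R) := exists m (w1 w2 : R), [/\ `|w1 - w| < e, `|w2 - w| < e,
      f (q + multiple r m) (j w1) = z & ~ N (f (q + multiple r m) (j w2))].
(* Which of the two points works may depend on the scale. If [x] fails at [e0], it fails at all
   smaller scales, so [y] works there and hence at every scale. *)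
suff dich (e : R) : 0 < e -> good x Nx q1 w1 e \/ good y Ny q2 w2 e.
  have [xgood|/existsNP[e0 /not_implyP[e00 ne0]]] :=
      pselect (forall e : R, 0 < e -> good x Nx q1 w1 e).
    by exists x, Nx, w1, q1; split=> //; [left|exact: open_nbhs_nbhs].
  exists y, Ny, w2, q2; split=> //; [by right|exact: open_nbhs_nbhs|].
  move=> e e_gt0; have m0 : 0 < Num.min e e0 by rewrite lt_min e_gt0.
  have [[m [a [b []]]]|[m [a [b []]]]] := dich _ m0.
    rewrite !lt_min => /andP[_ ae] /andP[_ be] ax nb.
    by case: ne0; exists m, a, b.
  rewrite !lt_min => /andP[ae _] /andP[be _] ay nb.
  by exists m, a, b.
move=> e0.
have ballG (w : R) (v : nat -> R) : (forall V, nbhs w V -> G [set n | V (v n)]) ->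
    G [set n | `|v n - w| < e].
  move=> h; apply: (h [set s | `|s - w| < e]); apply/nbhs_ballP.
  by exists e => //= s; rewrite /ball/= distrC.
have GG : G (([set n | `|v1 n - w1| < e] `&` [set n | `|v2 n - w2| < e]) `&`
    ([set n | iter n (f r) (f q1 (j (v1 n))) = x] `&`
     [set n | iter n (f r) (f q2 (j (v2 n))) = y])).
  by apply: filterI; apply: filterI => //; exact: ballG.
have [n [[/= n1 n2] [nx ny]]] := filter_ex GG.
have Gn : G [set m | (n < m)%N] by apply: Ginf; exists n.+1.
have [m [[[/= m1 m2] [mx my]] nm]] := filter_ex (@filterI _ G _ _ _ GG Gn).
(* The predecessor compensates the shift in [multiple]; [n < m] makes [m] positive. *)
have fE q v : f (q + multiple r m.-1) (j v) = iter m (f r) (f q (j v)).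
  by rewrite fD (multipleE _ _ _ A) (iter_fC _ _ _ _ A) prednK//; apply: leq_ltn_trans nm.
have mE : m = ((m - n).-1.+1 + n)%N.
  by rewrite prednK ?subnK ?subn_gt0// ltnW.
(* As [m - n] is positive, the forward orbits of [x] and [y] have merged by this time. *)
pose z := iter (m - n).-1.+1 (f r) x.
have zE : iter (m - n).-1.+1 (f r) y = z by rewrite /z !iterSr rxy.
have [Nxz|Nxz] := pselect (Nx z).
  right; exists m.-1, (v2 m), (v2 n); split=> //; rewrite fE //.
  rewrite mE iterD ny zE => Nyz.
  exact: (NN z).
left; exists m.-1, (v1 m), (v1 n); split=> //; rewrite fE //.
by rewrite mE iterD nx.
Qed.

(** If [f r] identified [x] and [y], short arcs near [w] would be carried by some [f s] to connected
    sets [C] through [z] that leave [N], so that no further acting map fits [C] into [W]. Combined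
    with visits to the arcs []u0, u1[] and []v0, v1[], this produces the exits required by
    [fixed_point_of_exits]. The resulting identity on [M] would factor through [f r], which is
    absurd. *)
Lemma injective_of_nonshrinking r x y :
  minimal_system f M -> chart J j c -> J `<=` M -> M x -> M y ->
  nonshrinking_at x -> nonshrinking_at y -> f r x = f r y -> x = y.
Proof.
move=> A Jc JM Mx My Hx Hy rxy.
have hX := ms_hausdorff A; have fD := ms_add A.
have fc := ms_continuous A; have Minv := ms_invariant A.
 apply: contrapT => xy.
have [Jo jc cj jcont ccont] := Jc.
have [z [N [w [q [zxy zN w01 sens]]]]] := sensitive_of_not_injective A Jc JM Mx My xy rxy.
have Hz : nonshrinking_at z by case: zxy => ->.
have h01 : 0 < (2^-1 : R) < 1 by lra.
have [Jh ch] := jc _ h01.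
have [W [Wo Wh Wf]] := Hz N _ zN (JM _ Jh).
have [e e0 eW] : exists2 e : R, 0 < e &
    forall s : R, `|s - 2^-1| < e -> W (j s) /\ (0 : R) < s < 1.
  apply: nbhs_distP; apply: filterI; last by apply: interval_nbhs; rlra.
  by apply: (jcont 2^-1 h01); exact: open_nbhs_nbhs.
(* The arc from [u0] to [v1] lies in [W]. Its outer quarters contain the arcs on which the maps act,
   its middle half the points where the images start. *)
pose u0 := 2^-1 - e / 2; pose u1 := 2^-1 - e / 4.
pose v0 := 2^-1 + e / 4; pose v1 := 2^-1 + e / 2 : R.
have [_ u001] : W (j u0) /\ 0 < u0 < 1 by apply: eW; rewrite /u0 ltr_norml; rlra.
have [_ v101] : W (j v1) /\ 0 < v1 < 1 by apply: eW; rewrite /v1 ltr_norml; rlra.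
have [u0u1 u1v0 v0v1] : [/\ u0 < u1, u1 < v0 & v0 < v1].
  by rewrite /u0 /u1 /v0 /v1; split; rlra.
have OW y' : J y' /\ u0 < c y' < v1 -> W y'.
  move=> [Jy cy]; have [_ <-] := cj _ Jy; apply: (eW _ _).1.
  by rewrite ltr_norml; move: cy; rewrite /u0 /v1; rlra.
have [Jw cw] := jc _ w01.
have [u0ge u1ge v0ge] : [/\ 0 <= u0, 0 <= u1 & 0 <= v0] by split; rlra.
have [u1le v0le v1le] : [/\ u1 <= 1, v0 <= 1 & v1 <= 1] by split; rlra.
have [tU fU] := ms_dense A (JM _ Jw) (chart_open u0 u1 Jc)
  (chart_meets Jc JM u0ge u0u1 u1le).
have [tV fV] := ms_dense A (JM _ Jw) (chart_open v0 v1 Jc)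
  (chart_meets Jc JM v0ge v0v1 v1le).
have contj t (s : R) : 0 < s < 1 -> {for s, continuous (f t \o j)}.
  by move=> s01; apply: continuous_comp; [exact: jcont|exact: fc].
have [d d0 dUV] : exists2 d : R, 0 < d & forall s : R, `|s - w| < d ->
    [/\ 0 < s < 1, J (f tU (j s)) /\ u0 < c (f tU (j s)) < u1 &
      J (f tV (j s)) /\ v0 < c (f tV (j s)) < v1].
  apply: nbhs_distP; near=> s; split; near: s; first exact: interval_nbhs.
    exact: (contj tU _ w01 _ (open_nbhs_nbhs (conj (chart_open u0 u1 Jc) fU))).
  exact: (contj tV _ w01 _ (open_nbhs_nbhs (conj (chart_open v0 v1 Jc) fV))).
have [m [w1 [w2 [w1d w2d fw1 fw2]]]] := sens _ d0.
set s := q + multiple r m in fw1 fw2.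
pose a := Num.min w1 w2; pose b := Num.max w1 w2.
have abd (t : R) : a <= t <= b -> `|t - w| < d.
  rewrite /a /b => tab; move: w1d w2d; rewrite !ltr_norml => /andP[? ?] /andP[? ?].
  by apply/andP; case: (lerP w1 w2) tab => ? ?; rlra.
have w1ab : a <= w1 <= b by rewrite /a /b ge_min le_max !lexx.
have w2ab : a <= w2 <= b by rewrite /a /b ge_min le_max !lexx !orbT.
pose C := (f s \o j) @` `[a, b].
have Cconn : connected C.
  by apply: image_segment_connected => t /abd/dUV[t01 _ _]; exact: contj.
have CM : C `<=` M.
  move=> _ [t /= tab <-]; rewrite in_itv/= in tab.
  have [t01 _ _] := dUV _ (abd _ tab); apply: Minv; apply: JM.
  by have [] := jc _ t01.
have Cz : C z by exists w1; rewrite //= in_itv.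
have CN : ~ C `<=` N.
  by move=> CN; apply: fw2; apply: CN; exists w2; rewrite //= in_itv.
have CW := Wf C Cconn CM Cz CN.
(* [g] brings the image of one point of the short arc into the middle, while the size of [C] forces
   another image out of [W], hence out of the arc from [u0] to [v1]. *)
have land t (u v : R) : (forall p : R, a <= p <= b -> J (f t (j p)) /\ u < c (f t (j p)) < v) ->
    exists g (k0 k1 : R), [/\ u < k0 < v, u < k1 < v,
      J (f (g + s) (j k0)) /\ u1 < c (f (g + s) (j k0)) < v0 &
      ~ (J (f (g + s) (j k1)) /\ u0 < c (f (g + s) (j k1)) < v1)].
  move=> tuv; have [Jk k0uv] := tuv _ w1ab; set k0 := c _ in k0uv.
  have jk0 : j k0 = f t (j w1) by have [] := cj _ Jk.
  have Ms : M (f s (j k0)) by rewrite jk0; apply: Minv; exact: JM.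
  have [g fg] := ms_dense A Ms (chart_open u1 v0 Jc)
    (chart_meets Jc JM u1ge u1v0 v0le).
  have /existsNP[_ /not_implyP[[_ [p /= pab <-] <-] nW]] := CW (g + t).
  rewrite in_itv/= in pab; have [Jp puv] := tuv _ pab.
  exists g, k0, (c (f t (j p))); split=> //.
    by rewrite fD.
  have [_ ->] := cj _ Jp => /OW.
  by rewrite fD (fC A s t) -fD.
have [gU [k0 [k1 [k0u k1u gk0 gk1]]]] := land tU u0 u1
  (fun p pab => let: And3 _ h _ := dUV p (abd p pab) in h).
have [gV [m0 [m1 [m0v m1v gm0 gm1]]]] := land tV v0 v1
  (fun p pab => let: And3 _ _ h := dUV p (abd p pab) in h).
have noid g : ~ (forall y', M y' -> f (g + s) y' = y').
  move=> fid; apply: xy; rewrite -(fid x Mx) -(fid y My) /s.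
  suff h : f (multiple r m) x = f (multiple r m) y by rewrite !fD h.
  by rewrite !(multipleE _ _ _ A) !iterSr rxy.
have u0p : 0 < u0 by rlra.
have v1p : v1 < 1 by rlra.
have [k [k01 fix_]] := fixed_point_of_exits hX Jc (@fc (gU + s)) (@fc (gV + s))
  u0p u1v0 v1p k0u k1u m0v m1v gk0 gk1 gm0 gm1.
have [Jk _] := jc _ k01.
case: fix_ => [fk|fk|].
- exact: noid (fixed_point_id A (JM _ Jk) fk).
- exact: noid (fixed_point_id A (JM _ Jk) fk).
- rewrite -fD Algebra.addrA => fk.
  exact: noid (fixed_point_id A (JM _ Jk) fk).
Unshelve. all: by end_near.
Qed.

Lemma chart_injective r x y : minimal_system f M -> infinite_set M ->
  chart J j c -> J `<=` M -> J x -> J y -> f r x = f r y -> x = y.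
Proof.
move=> A Minf Jc JM Jx Jy.
by apply: (injective_of_nonshrinking A Jc JM (JM _ Jx) (JM _ Jy));
  apply: (nonshrinking_chart A Minf Jc JM).
Qed.

End Injectivity.

(** * Injectivity on the whole minimal set *)

Section GlobalInjectivity.
Context {R : realType} {S : addSemigroupType} {X : topologicalType}.
Context {f : S -> X -> X} {M : set X} {J : set X} {j : R -> X} {c : X -> R}.
Local Open Scope ring_scope.
Implicit Types (r s t : S) (x y : X).

(** [M] is covered by the images of [J] under finitely many [f q]. As [f (t + q)] is injective on
    [J], each of these images contributes at most one point. *)
Lemma finite_fiber t x : minimal_system f M -> infinite_set M ->
  chart J j c -> J `<=` M -> M x -> finite_set [set y | M y /\ f t y = f t x].
Proof.
move=> A Minf Jc JM Mx; have [Jo jc _ _ _] := Jc.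
have h01 : 0 < (2^-1 : R) < 1 by lra.
have [Jh _] := jc _ h01.
have [l lU] := backward_cover A Jo (ex_intro _ _ (conj Jh (JM _ Jh))).
pose w q := xget x [set w | J w /\ f t (f q w) = f t x].
apply: (@sub_finite_set _ _ [set` [seq f q (w q) | q <- l]]) => [y [My yx]|].
  have [q ql [v [Jv _] vy]] := lU _ My.
  apply/mapP; exists q => //; rewrite -vy; congr f.
  have Wv : J v /\ f t (f q v) = f t x by rewrite vy.
  have [Jw fw] := @xgetPex _ x [set w | J w /\ f t (f q w) = f t x] (ex_intro _ v Wv).
  apply: (chart_injective (r := t + q) A Minf Jc JM Jv Jw).
  by rewrite !(ms_add A) fw vy.
exact: finite_seq.
Qed.

(** Some [f t0] sends [x] into [J], where the property is known. The fibre of [f t0] through [x]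
    being finite, [N] can be shrunk to a neighbourhood [N0] whose boundary avoids that fibre. A
    connected set leaving [N] crosses this boundary, so its image leaves a neighbourhood of
    [f t0 x]; commutativity then transports [W] back. *)
Lemma nonshrinking_everywhere x : minimal_system f M -> infinite_set M ->
  chart J j c -> J `<=` M -> M x -> nonshrinking_at (f := f) (M := M) x.
Proof.
move=> A Minf Jc JM Mx N p xN Mp; have [Jo jc _ _ _] := Jc.
have hX := ms_hausdorff A.
have h01 : 0 < (2^-1 : R) < 1 by lra.
have [Jh _] := jc _ h01.
have [t0 Jt0] := ms_dense A Mx Jo (ex_intro _ _ (conj Jh (JM _ Jh))).
set F := [set y | M y /\ f t0 y = f t0 x].
have Ffin : finite_set F by exact: (finite_fiber t0 A Minf Jc JM).
have N1 : nbhs x (N `&` ~` (F `\ x)).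
  apply: filterI => //; apply: open_nbhs_nbhs; split; last by move=> [_ /=].
  apply: closed_openC.
  apply: (accessible_finite_set_closed.1 (hausdorff_accessible hX)).
  exact: finite_setD.
have [N0 N0x N0N] := compact_regular hX (ms_compact A) filterT N1.
pose K := (closure N0 `\` interior N0) `&` M.
have Kc : compact (f t0 @` K).
  apply: continuous_compact; first exact/continuous_subspaceT/(ms_continuous A).
  apply: (subclosed_compact _ (minimal_compact A)) => [|y []//].
  apply: closedI; last exact: (ms_closed A).
  apply: closedI; first exact: closed_closure.
  by apply: open_closedC; exact: open_interior.
have N'x : nbhs (f t0 x) (~` (f t0 @` K)).
  apply: open_nbhs_nbhs; split; first by apply: closed_openC; exact: compact_closed hX Kc.
  move=> [y [[clN0y N0y] My] yx].
  have [_] := N0N _ clN0y; apply; split=> // /= xy.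
  by apply: N0y; rewrite xy.
have [W [Wo Wp Wf]] := nonshrinking_chart A Minf Jc JM Jt0 N'x
  (ms_invariant A t0 Mp).
exists (f t0 @^-1` W); split=> //.
  by apply: open_comp => // ? _; exact: (ms_continuous A).
move=> C Cconn CM Cx CN t fCW.
apply: (Wf (f t0 @` C)) (t) _ => //.
- apply: connected_continuous_connected => //.
  exact/continuous_subspaceT/(ms_continuous A).
- by move=> _ [y Cy <-]; apply: (ms_invariant A); exact: CM.
- move=> CN'; apply: CN => y Cy; suff CE : C `&` interior N0 = C.
    have [_ N0y] : (C `&` interior N0) y by rewrite CE.
    by have [] := N0N _ (subset_closure (interior_subset N0y)).
  apply: Cconn; first by exists x.
    by exists (interior N0) => //; exact: open_interior.
  exists (closure N0); first exact: closed_closure.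
  apply/seteqP; split=> z [Cz zN0]; split=> //.
    exact: (subset_closure (interior_subset zN0)).
  apply: contrapT => nzN0; apply: (CN' (f t0 z)); first by exists z.
  by exists z => //; split=> //; exact: CM.
- move=> _ [_ [y Cy <-] <-]; rewrite (fC A).
  by apply: fCW; exists y.
Qed.

Lemma acting_map_injective r x y : minimal_system f M -> infinite_set M ->
  chart J j c -> J `<=` M -> M x -> M y -> f r x = f r y -> x = y.
Proof.
move=> A Minf Jc JM Mx My.
by apply: (injective_of_nonshrinking A Jc JM Mx My);
  apply: (nonshrinking_everywhere A Minf Jc JM).
Qed.

End GlobalInjectivity.

(** * Loops in a minimal set with nonempty interior in the chart *)

Section Orbits.
Context {R : realType} {S : addSemigroupType} {X : topologicalType}.
Context {f : S -> X -> X} {M : set X} {J : set X} {j : R -> X} {c : X -> R}.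
Local Open Scope ring_scope.
Implicit Types (e r s : S) (x y : X) (a d : R).

Lemma image_interval_connected (g : R -> X) (i : interval R) :
  (forall t, t \in i -> {for t, continuous g}) -> connected (g @` [set` i]).
Proof.
move=> gc; apply: connected_continuous_connected.
  by apply/connected_intervalP; exact: interval_is_interval.
by apply: continuous_in_subspaceT => t; rewrite inE; exact: gc.
Qed.

(** The intermediate value theorem for [c (be s) - s]. For [be = f e \o j] it produces a fixed
    point, so a map without fixed points cannot fall back behind the parameter. *)
Lemma no_turning_point (be : R -> X) a t : chart J j c -> 0 < a -> a < t -> t < 1 ->
  (forall s : R, a <= s <= t -> {for s, continuous be}) ->
  (forall s : R, a <= s <= t -> J (be s)) ->
  a <= c (be a) -> c (be t) <= t ->
  exists2 s : R, 0 < s < 1 & be s = j s.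
Proof.
move=> Jc a0 at_ t1 bec Jbe ca ct; have [Jo jc cj jcont ccont] := Jc.
have [s sat sE] : exists2 s, a <= s <= t & c (be s) - s = 0.
  apply: sign_change; first exact: ltW.
    move=> s sat; apply: cvgB; last exact: cvg_id.
    by apply: (@continuous_comp _ _ _ be c); [exact: bec|apply: ccont; exact: Jbe].
  by right; rlra.
exists s; first rlra.
by have [_ <-] := cj _ (Jbe _ sat); congr j; rlra.
Qed.

(** Otherwise points arbitrarily close to [a] on the right have images strictly between [j a] and
    [j d]. Injectivity keeps the image of an interval to the right of [a] off [j d], and off [j a]
    until the possible time [t2] at which [j a] is reached. The image is then trapped between them
    and ends behind its parameter, contrary to [no_turning_point]. *)
Lemma pushes_forward e a d : minimal_system f M -> chart J j c -> J `<=` M ->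
  (forall x y, M x -> M y -> f e x = f e y -> x = y) ->
  (forall x, M x -> f e x <> x) -> 0 < a -> a < d -> d < 1 ->
  f e (j a) = j d ->
  exists2 h : R, 0 < h & forall t : R, a < t < a + h ->
    J (f e (j t)) /\ d < c (f e (j t)).
Proof.
move=> A Jc JM inj nofix a0 ad d1 ead.
have [Jo jc cj jcont ccont] := Jc; have hX := ms_hausdorff A.
pose be := f e \o j.
have bec (t : R) : 0 < t < 1 -> {for t, continuous be}.
  by move=> t01; apply: continuous_comp; [exact: jcont|exact: (ms_continuous A)].
have jM (t : R) : 0 < t < 1 -> M (j t) by move=> /jc[/JM].
have beinj (s t : R) : 0 < s < 1 -> 0 < t < 1 -> be s = be t -> s = t.
  by move=> s01 t01 /(inj _ _ (jM _ s01) (jM _ t01)); exact: (chart_inj Jc).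
have a01 : 0 < a < 1 by rlra.
have d01 : 0 < d < 1 by rlra.
have [[Ja ca] [Jd cd]] := (jc _ a01, jc _ d01).
have bed : J (be a) /\ a < c (be a) < 1.
  by rewrite /be /= ead; split=> //; rewrite cd; rlra.
have [h h0 hbe] : exists2 h : R, 0 < h &
    forall t : R, `|t - a| < h -> J (be t) /\ a < c (be t) < 1.
  apply: nbhs_distP; case: bed => Jba cba.
  exact: (bec _ a01 _ (chart_nbhs Jc Jba cba)).
apply: contrapT => noh.
have bad (k : R) : 0 < k -> exists2 t : R, a < t < a + k & J (be t) /\ a < c (be t) < d.
  move=> k0; pose m := Num.min (Num.min h k) (1 - a).
  have m0 : 0 < m by rewrite !lt_min h0 k0 subr_gt0; rlra.
  have [mh mk ma] : [/\ m <= h, m <= k & m <= 1 - a].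
    by rewrite /m !ge_min !lexx !orbT.
  apply: contrapT => nk; apply: noh; exists m => // t tam.
  have [|Jt ct] := hbe t; first by rewrite ltr_norml; rlra.
  split=> //; rewrite ltNge; apply/negP => ctd; apply: nk; exists t; first rlra.
  split=> //; apply/andP; split; first rlra.
  rewrite lt_neqAle ctd andbT; apply/eqP => ctE.
  have bta : be t = be a by rewrite /be/= ead -ctE; have [_ ->] := cj _ Jt.
  by have := beinj _ _ _ a01 bta; rewrite -/be; lra.
have bea (t : R) : a < t < 1 -> be t <> j d.
  move=> ta1; rewrite -ead -[f e (j a)]/(be a) => bta.
  have t01 : 0 < t < 1 by rlra.
  by have := beinj _ _ t01 a01 bta; lra.
have notfix (s : R) : 0 < s < 1 -> be s <> j s by move=> s01; exact: nofix (jM _ s01).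
have [[t2 t2ad bt2]|nt2] := pselect (exists2 t2, a < t2 <= d & be t2 = j a).
  pose C := be @` `]a, t2[.
  have Cconn : connected C.
    by apply: image_interval_connected => t; rewrite in_itv/= => ?; apply: bec; rlra.
  have [t1 t1a [Jt1 ct1]] := bad (t2 - a) ltac:(rlra).
  have Ct1 : C (j (c (be t1))).
    by have [_ ->] := cj _ Jt1; exists t1 => //; rewrite /= in_itv/=; rlra.
  have Ca : ~ C (j a).
    move=> [t]; rewrite /= in_itv/= -bt2 => tat2 bt.
    have t01 : 0 < t < 1 by rlra.
    have t201 : 0 < t2 < 1 by rlra.
    by have := beinj _ _ t01 t201 bt; lra.
  have Cd : ~ C (j d).
    by move=> [t]; rewrite /= in_itv/= => tat2; apply: bea; rlra.
  have Csub := chart_trap hX Jc Cconn a0 d1 ct1 Ct1 Ca Cd.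
  suff [s s01] : exists2 s : R, 0 < s < 1 & be s = j s by exact: notfix.
  apply: (@no_turning_point be a t2 Jc a0); [rlra|rlra|..].
  - by move=> s sat2; apply: bec; rlra.
  - move=> s sat2; have [->|sa] := eqVneq s a; first by case: bed.
    have [->|st2] := eqVneq s t2; first by rewrite bt2.
    have [] // : J (be s) /\ a < c (be s) < d.
    apply: Csub; exists s; rewrite //= in_itv/= !lt_neqAle st2 eq_sym sa/=.
    by rlra.
  - by case: bed => _; rlra.
  - by rewrite bt2 ca; rlra.
pose C := be @` `]a, d].
have Cconn : connected C.
  by apply: image_interval_connected => t; rewrite in_itv/= => ?; apply: bec; rlra.
have [t1 t1a [Jt1 ct1]] := bad (d - a) ltac:(rlra).
have Ct1 : C (j (c (be t1))).
  by have [_ ->] := cj _ Jt1; exists t1 => //; rewrite /= in_itv/=; rlra.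
have Ca : ~ C (j a).
  by move=> [t]; rewrite /= in_itv/= => tad bt; apply: nt2; exists t.
have Cd : ~ C (j d).
  by move=> [t]; rewrite /= in_itv/= => tad; apply: bea; rlra.
have Csub := chart_trap hX Jc Cconn a0 d1 ct1 Ct1 Ca Cd.
have Csub' (s : R) : a < s <= d -> J (be s) /\ a < c (be s) < d.
  by move=> sad; apply: Csub; exists s; rewrite //= in_itv.
suff [s s01] : exists2 s : R, 0 < s < 1 & be s = j s by exact: notfix.
apply: (@no_turning_point be a d Jc a0 ad d1).
- by move=> s sat2; apply: bec; rlra.
- move=> s sat2; have [->|sa] := eqVneq s a; first by case: bed.
  have [] // : J (be s) /\ a < c (be s) < d.
  by apply: Csub'; rewrite lt_neqAle eq_sym sa/=; rlra.
- by case: bed => _; rlra.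
- by have [|_ ?] := Csub' d; rlra.
Qed.

End Orbits.

(** * Orbit arcs of an acting map *)

Section Spiral.
Context {R : realType} {S : addSemigroupType} {X : topologicalType}.
Context {f : S -> X -> X} {M : set X} {J : set X} {j : R -> X} {c : X -> R}.
Local Open Scope ring_scope.
Implicit Types (e r : S) (x y : X) (a d s t : R) (n m : nat).

(* The concatenation of the images of the arc [j @` `[a, d]] under the iterates
   of [f e], which fit together when [f e (j a) = j d]. *)
Definition spiral e a d t : X :=
  iter (Num.truncn t) (f e) (j (a + (t - (Num.truncn t)%:R) * (d - a))).

(** The right end [n.+1] is allowed as well, because consecutive pieces agree there. *)
Lemma spiralE e a d n t : f e (j a) = j d -> n%:R <= t <= n.+1%:R ->
  spiral e a d t = iter n (f e) (j (a + (t - n%:R) * (d - a))).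
Proof.
move=> ead /andP[nt tn]; rewrite /spiral.
have t0 : 0 <= t by rewrite (le_trans _ nt)// ler0n.
have [tn1|tn1] := ltP t n.+1%:R.
  by have /eqP -> : Num.truncn t == n by rewrite truncn_eq// nt.
have -> : t = n.+1%:R by apply/eqP; rewrite eq_le tn tn1.
have /eqP -> : Num.truncn (n.+1%:R : R) == n.+1.
  by rewrite truncn_eq// lexx ltr_nat ltnSn.
rewrite subrr mul0r addr0 iterSr ead; congr (iter _ _ (j _)).
by rewrite -natr1; ring.
Qed.

Lemma trunc_bounds t : 0 <= t ->
  exists2 n, n%:R <= t & t < n.+1%:R.
Proof. by move=> /truncn_itv/andP[? ?]; exists (Num.truncn t). Qed.

Lemma trunc_lower_bounds t : 0 < t -> exists2 n, n%:R < t & t <= n.+1%:R.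
Proof.
move=> t0; have [n nt tn] := trunc_bounds (ltW t0).
have [nt'|nt'] := ltP n%:R t; first by exists n => //; exact: ltW.
case: n nt nt' tn => [|n] nt nt' tn; first by lra.
by exists n => //; apply: lt_le_trans nt; rewrite ltr_nat.
Qed.

Lemma spiralS e a d t : f e (j a) = j d -> 0 <= t ->
  spiral e a d (t + 1) = f e (spiral e a d t).
Proof.
move=> ead t0; have [n nt tn] := trunc_bounds t0.
rewrite (spiralE (n := n) (t := t) ead) ?nt ?(ltW tn)//.
rewrite (spiralE (n := n.+1) (t := t + 1) ead); last first.
  by rewrite -[n.+2%:R]natr1 lerD2r (ltW tn) andbT -natr1 lerD2r.
by rewrite iterS; congr (f e (iter _ _ (j _))); rewrite -natr1; ring.
Qed.

Lemma spiral_addn e a d n t : f e (j a) = j d -> 0 <= t ->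
  spiral e a d (t + n%:R) = iter n (f e) (spiral e a d t).
Proof.
move=> ead t0; elim: n => [|n IH]; first by rewrite addr0.
by rewrite -natr1 addrA spiralS ?addr_ge0// IH.
Qed.

Lemma arc_between a d t : 0 < a -> a < d -> d < 1 -> 0 <= t <= 1 ->
  a <= a + t * (d - a) <= d.
Proof. by move=> a0 ad d1 t01; nra. Qed.

Lemma spiral_mem e a d t : minimal_system f M -> chart J j c -> J `<=` M ->
  0 < a -> a < d -> d < 1 -> f e (j a) = j d -> 0 <= t -> M (spiral e a d t).
Proof.
move=> A Jc JM a0 ad d1 ead t0; have [n nt tn] := trunc_bounds t0.
have [_ jc _ _ _] := Jc.
rewrite (spiralE (n := n) ead) ?nt ?(ltW tn)//.
have : M (j (a + (t - n%:R) * (d - a))).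
  apply: JM; apply: (jc _ _).1.
  have := @arc_between a d (t - n%:R) a0 ad d1.
  by rewrite -natr1 in tn => h; have {}h := h ltac:(rlra); rlra.
by move: (j _) => x Mx; elim: (n) => //= k; exact: (ms_invariant A).
Qed.

Lemma iter_continuous e n : minimal_system f M -> continuous (iter n (f e)).
Proof.
move=> A; elim: n => [|n IH] x; first exact: cvg_id.
by apply: (@continuous_comp _ _ _ (iter n (f e)) (f e)); [exact: IH|exact: ms_continuous A _ _].
Qed.

(** At an integer two pieces meet: piece [n] describes the spiral to the right of [t] and piece [m]
    to the left. Elsewhere the two coincide. *)
Lemma spiral_continuous e a d t : minimal_system f M -> chart J j c ->
  0 < a -> a < d -> d < 1 -> f e (j a) = j d -> 0 < t ->
  {for t, continuous (spiral e a d)}.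
Proof.
move=> A Jc a0 ad d1 ead t0; have [_ _ _ jcont _] := Jc.
have [n nt tn] := trunc_bounds (ltW t0).
have [m mt tm] := trunc_lower_bounds t0.
pose g n (s : R) := iter n (f e) (j (a + (s - n%:R) * (d - a))).
have gc k : k%:R <= t <= k.+1%:R -> {for t, continuous (g k)}.
  move=> kt; apply: (@continuous_comp _ _ _
    (fun s => j (a + (s - k%:R) * (d - a))) (iter k (f e))); last exact: iter_continuous A _.
  apply: (@continuous_comp _ _ _ (fun s : R => a + (s - k%:R) * (d - a)) j).
    apply: cvgD; first exact: cvg_cst.
    by apply: cvgM; [apply: cvgB; [exact: cvg_id|exact: cvg_cst]|exact: cvg_cst].
  apply: jcont; have := @arc_between a d (t - k%:R) a0 ad d1.
  by rewrite -natr1 in kt => h; have {}h := h ltac:(rlra); rlra.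
have nt' : n%:R <= t <= n.+1%:R by rewrite nt ltW.
have mt' : m%:R <= t <= m.+1%:R by rewrite tm ltW.
move=> V; rewrite (spiralE (n := n) ead nt') => gV.
have gV' : nbhs (g m t) V by rewrite /g -(spiralE ead mt') (spiralE (n := n) ead nt').
have mtn : m%:R < t < n.+1%:R by rewrite mt tn.
have near_t : nbhs t ((g n @^-1` V `&` g m @^-1` V) `&`
    [set s | m%:R < s < n.+1%:R]).
  apply: filterI; last exact: interval_nbhs.
  by apply: filterI; [exact: gc|exact: gc].
apply: filterS near_t => s [[/= gns gms] /andP[ms sn]].
have [ts|ts] := leP t s.
  by rewrite /= (spiralE (n := n) ead) ?(le_trans nt ts) ?(ltW sn).
by rewrite /= (spiralE (n := m) ead) ?(ltW ms)//= (le_trans (ltW ts) tm).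
Qed.

Lemma iter_injective e n x y : minimal_system f M ->
  (forall x y, M x -> M y -> f e x = f e y -> x = y) -> M x -> M y ->
  iter n (f e) x = iter n (f e) y -> x = y.
Proof.
move=> A inj; elim: n x y => // n IH x y Mx My; rewrite !iterSr => /IH h.
by apply: inj => //; apply: h; exact: (ms_invariant A).
Qed.

(** Injectivity of [f e] allows an integer shift that puts [s] in [[0, 1[], which makes [h] uniform.
    Within one piece the chart is injective; across the junction, [pushes_forward] puts the later
    point strictly beyond [j d], while the earlier one has coordinate at most [d]. *)
Lemma spiral_locally_injective e a d : minimal_system f M -> chart J j c ->
  J `<=` M -> (forall x y, M x -> M y -> f e x = f e y -> x = y) ->
  (forall x, M x -> f e x <> x) -> 0 < a -> a < d -> d < 1 ->
  f e (j a) = j d ->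
  exists2 h : R, 0 < h & forall s t : R, 0 <= s -> s < t -> t < s + h ->
    spiral e a d s <> spiral e a d t.
Proof.
move=> A Jc JM inj nofix a0 ad d1 ead; have [_ jc _ _ _] := Jc.
have [h0 h0_gt0 hP] := pushes_forward A Jc JM inj nofix a0 ad d1 ead.
have da0 : 0 < d - a by rlra.
(* The first bound keeps the overshoot past the junction below [h0], the second prevents [t] from
   reaching a third piece. *)
pose h := Num.min (h0 / (d - a)) 1.
have h_gt0 : 0 < h by rewrite lt_min ltr01 andbT divr_gt0.
have h1 : h <= 1 by rewrite ge_min lexx orbT.
have hd : h * (d - a) <= h0 by rewrite -ler_pdivlMr// ge_min lexx.
exists h => // s t s0 st tsh.
have [n ns sn] := trunc_bounds s0.
have nn : n.+1%:R = n%:R + 1 :> R by rewrite -natr1.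
have spM (u : R) : 0 <= u -> M (spiral e a d u) by exact: spiral_mem.
rewrite -[s](subrK n%:R) -[t](subrK n%:R) !spiral_addn ?subr_ge0//; last rlra.
move=> /(iter_injective A inj (spM _ _) (spM _ _)).
rewrite !subr_ge0 => /(_ ns ltac:(rlra)).
have u0 : 0 <= s - n%:R by rlra.
have u1 : s - n%:R < 1 by rlra.
have uv : s - n%:R < t - n%:R by rlra.
have vh : t - n%:R < s - n%:R + h by rlra.
move: (s - n%:R) (t - n%:R) u0 u1 uv vh => u v u0 u1 uv vh.
have arc (w : R) : 0 <= w <= 1 -> a <= a + w * (d - a) <= d by exact: arc_between.
have spE (w : R) : 0 <= w <= 1 -> spiral e a d w = j (a + w * (d - a)).
  by move=> w01; rewrite (spiralE (n := 0) ead)// subr0.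
have aru := arc u ltac:(rlra).
have [v1|v1] := leP v 1.
  rewrite !spE; [|rlra|rlra]; have arv := arc v ltac:(rlra).
  have ru : 0 < a + u * (d - a) < 1 by rlra.
  have rv : 0 < a + v * (d - a) < 1 by rlra.
  move=> /(chart_inj Jc ru rv)/addrI/(mulIf (lt0r_neq0 da0)) uvE.
  by rewrite uvE ltxx in uv.
have -> : v = (v - 1) + 1 by ring.
rewrite spiralS//; last rlra.
rewrite !spE; [|rlra|rlra] => E.
have v1h : (v - 1) * (d - a) < h0.
  by apply: lt_le_trans hd; rewrite ltr_pM2r//; rlra.
have v10 : 0 < (v - 1) * (d - a) by rewrite mulr_gt0//; rlra.
have [_] := hP (a + (v - 1) * (d - a)) ltac:(rlra).
rewrite -E; have [|_ ->] := jc (a + u * (d - a)); rlra.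
Qed.

(* An injective orbit arc would, by [chart_trap], converge to a point of [J],
   which [f e] would then fix. *)
Lemma spiral_not_injective e a d : minimal_system f M -> chart J j c ->
  J `<=` M -> (forall r x y, M x -> M y -> f r x = f r y -> x = y) ->
  (forall x, M x -> f e x <> x) -> 0 < a -> a < d -> d < 1 ->
  f e (j a) = j d ->
  exists s t : R, [/\ 1 <= s, s < t & spiral e a d s = spiral e a d t].
Proof.
move=> A Jc JM inj nofix a0 ad d1 ead; have [Jo jc cj jcont _] := Jc.
have hX := ms_hausdorff A.
have spM (u : R) : 0 <= u -> M (spiral e a d u) by exact: spiral_mem.
apply: contrapT => noloop.
have spinj (s t : R) : 1 <= s -> 1 <= t -> spiral e a d s = spiral e a d t -> s = t.
  move=> s1 t1 st; apply/eqP; apply: contrapT => /negP; rewrite neq_lt => /orP[h|h].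
    by apply: noloop; exists s, t.
  by apply: noloop; exists t, s.
have [G [GU Ginf]] := ultraFilterLemma eventually_filter.
(* An accumulation point of the spiral along integer times, which is then moved into [J] by some
   [f r]. *)
have [z Mz Gz] : exists2 z, M z & forall V, nbhs z V ->
    G [set n | V (spiral e a d n.+1%:R)].
  apply: ultra_cvg (minimal_compact A) _.
  by apply: filterS filterT => n _; exact: spM.
have h01 : 0 < (2^-1 : R) < 1 by lra.
have [Jh _] := jc _ h01.
have [r Jr] := ms_dense A Mz Jo (ex_intro _ _ (conj Jh (JM _ Jh))).
pose th (t : R) := f r (spiral e a d t).
have thinj (s t : R) : 1 <= s -> 1 <= t -> th s = th t -> s = t.
  by move=> s1 t1 /(inj _ _ _ (spM s ltac:(rlra)) (spM t ltac:(rlra))); exact: spinj.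
have thc (t : R) : 0 < t -> {for t, continuous th}.
  move=> t0; apply: (@continuous_comp _ _ _ (spiral e a d) (f r)).
    exact: spiral_continuous A Jc _ _ _ _ _.
  exact: ms_continuous A _ _.
set z' := f r z in Jr.
have Gz' V : nbhs z' V -> G [set n | V (th n.+1%:R)].
  by move=> z'V; apply: (Gz (f r @^-1` V)); exact: (ms_continuous A).
have [cz jz] := cj _ Jr.
have avoid (p : R) : 0 < p < 1 -> exists2 k : R, 1 <= k & forall t : R, k <= t -> th t <> j p.
  move=> p01; have [[k k1 kp]|nk] := pselect (exists2 k : R, 1 <= k & th k = j p).
    exists (k + 1); first rlra; move=> t kt; rewrite -kp => /thinj.
    by move=> /(_ ltac:(rlra) k1); rlra.
  by exists 1 => // t t1 tp; apply: nk; exists t.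
(* Once [j p] and [j q] are no longer visited, the connected tail meets the arc between them and is
   trapped there. *)
have tail (p q : R) : 0 < p -> q < 1 -> p < c z' < q ->
    exists k : R, forall t : R, k <= t -> J (th t) /\ p < c (th t) < q.
  move=> p0 q1 pzq.
  have [kp kp1 kpP] := avoid p ltac:(rlra); have [kq kq1 kqP] := avoid q ltac:(rlra).
  pose k := Num.max kp kq.
  have [kkp kkq] : kp <= k /\ kq <= k by rewrite /k !le_max !lexx orbT.
  pose C := th @` `[k, +oo[.
  have Cconn : connected C.
    apply: image_interval_connected => t; rewrite in_itv/= andbT => kt.
    by apply: thc; rlra.
  have Cp : ~ C (j p).
    by move=> [t]; rewrite /= in_itv/= andbT => kt; apply: kpP; rlra.
  have Cq : ~ C (j q).
    by move=> [t]; rewrite /= in_itv/= andbT => kt; apply: kqP; rlra.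
  have Gk : G [set n | k <= n.+1%:R].
    apply: Ginf; exists (Num.truncn k) => // n /= kn.
    have k0 : 0 <= k by rlra.
    have /andP[_ /ltW/le_trans] := truncn_itv k0; apply.
    by rewrite ler_nat ltnS.
  have [n [/= [Jn pcq] kn]] := filter_ex (filterI (Gz' _ (chart_nbhs Jc Jr pzq)) Gk).
  have Cn : C (j (c (th n.+1%:R))).
    by have [_ ->] := cj _ Jn; exists n.+1%:R; rewrite //= in_itv/= andbT.
  exists k => t kt; apply: (chart_trap hX Jc Cconn p0 q1 pcq Cn Cp Cq).
  by exists t; rewrite //= in_itv/= andbT.
have ez' : f e z' <> z' by apply: nofix; exact: (ms_invariant A).
have [U [V [Uz Vz Uo Vo UV]]] := hausdorff_open hX ez'.
have zVU : nbhs z' (V `&` f e @^-1` U).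
  apply: filterI; first exact: open_nbhs_nbhs.
  by apply: (ms_continuous A); exact: open_nbhs_nbhs.
have [h h0 hP] : exists2 h : R, 0 < h & forall s : R, `|s - c z'| < h ->
    (V `&` f e @^-1` U) (j s) /\ 0 < s < 1.
  apply: nbhs_distP; apply: filterI; last exact: interval_nbhs.
  by apply: (jcont _ cz); rewrite jz.
have hP' (s : R) : c z' - h < s < c z' + h -> (V `&` f e @^-1` U) (j s) /\ 0 < s < 1.
  by move=> sh; apply: hP; rewrite ltr_norml; rlra.
have [_ p01] := hP' (c z' - h / 2) ltac:(rlra).
have [_ q01] := hP' (c z' + h / 2) ltac:(rlra).
have [k kP] := tail (c z' - h / 2) (c z' + h / 2) ltac:(rlra) ltac:(rlra) ltac:(rlra).
pose t := Num.max k 0.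
have [kt t0] : k <= t /\ 0 <= t by rewrite /t !le_max !lexx orbT.
have VUt (s : R) : k <= s -> V (th s) /\ U (f e (th s)).
  move=> ks; have [Js cs] := kP _ ks; have [_ <-] := cj _ Js.
  by have [[? ?] _] := hP' (c (th s)) ltac:(rlra).
(* Advancing time by one is applying [f e], so the tail has a point in both [U] and [V]. *)
have [_] := VUt _ kt; have [+ _] := VUt (t + 1) ltac:(rlra).
rewrite /th spiralS// (fC A) => Vt Ut.
exact: UV Ut Vt.
Qed.

End Spiral.

(** * Simple loops meeting a free interval *)

Section Loops.
Context {R : realType} {X : topologicalType}.
Local Open Scope ring_scope.
Implicit Types (g : R -> X) (J : set X) (j : R -> X) (c : X -> R) (s t u v : R).

(** The map is given on the whole line, which keeps continuity unconditional; the closed curve is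
    the image of [[0, 1]]. *)
Definition simple_loop g : Prop :=
  [/\ continuous g, g 0 = g 1 & forall s t, 0 <= s < 1 -> 0 <= t < 1 ->
    g s = g t -> s = t].

(** Removing the base point leaves the image of an open interval; removing any other point leaves
    two half-open pieces joined at [g 0 = g 1]. *)
Lemma simple_loop_punctured g v : simple_loop g -> 0 <= v < 1 ->
  connected (g @` `[0, 1] `\ g v).
Proof.
move=> [gc g01 ginj] v01; have gct t : {for t, continuous g} by exact: gc.
have [v0|v0] := eqVneq v 0.
  suff -> : g @` `[0, 1] `\ g v = g @` `]0, 1[ by exact: image_interval_connected.
  rewrite v0; apply/seteqP; split=> [x [[t]]|_ [t + <-]]; rewrite /= in_itv/=.
    move=> t01 <- gt0; exists t => //; rewrite in_itv/=.
    have [t0|t0] := eqVneq t 0; first by rewrite t0 in gt0.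
    have [t1|t1] := eqVneq t 1; first by rewrite t1 -g01 in gt0.
    by rewrite !lt_neqAle t1 eq_sym t0.
  move=> t01; split; first by exists t => //; rewrite in_itv/= !ltW//; rlra.
  move=> /ginj E; have := E ltac:(rlra) ltac:(rlra); rlra.
have v0' : 0 < v by rewrite lt_neqAle eq_sym v0; rlra.
suff -> : g @` `[0, 1] `\ g v = g @` `[0, v[ `|` g @` `]v, 1].
  apply: connectedU; [|exact: image_interval_connected|exact: image_interval_connected].
  exists (g 0); split; first by exists 0 => //; rewrite /= in_itv/= lexx.
  by exists 1; rewrite //= in_itv/=; rlra.
apply/seteqP; split=> [x [[t]]|x [] [t + <-]]; rewrite /= in_itv/=.
- move=> t01 <- gtv; have [tv|tv] := ltP t v.
    by left; exists t => //; rewrite /= in_itv/=; rlra.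
  right; exists t; rewrite //= in_itv/= lt_neqAle tv andbT.
  by apply/andP; split; [apply/eqP => vt; apply: gtv; rewrite vt|rlra].
- move=> t01; split; first by exists t; rewrite //= in_itv/=; rlra.
  by move=> /ginj E; have := E ltac:(rlra) ltac:(rlra); rlra.
- move=> t01; split; first by exists t; rewrite //= in_itv/=; rlra.
  have [->|t1] := eqVneq t 1.
    by rewrite -g01 => /ginj E; have := E ltac:(rlra) ltac:(rlra); rlra.
  have t1' : t < 1 by rewrite lt_neqAle t1; rlra.
  by move=> /ginj E; have := E ltac:(rlra) ltac:(rlra); rlra.
Qed.

Lemma simple_loop_range g t : simple_loop g -> 0 <= t <= 1 ->
  exists2 v : R, 0 <= v < 1 & g v = g t.
Proof.
move=> [_ g01 _] t01; have [->|t1] := eqVneq t 1.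
  by exists 0 => //; rewrite lexx ltr01.
by exists t; rewrite // lt_neqAle t1; rlra.
Qed.

(** Suppose the loop has gaps arbitrarily close to [x] on the left. If it fills an interval on the
    right, removing a point [j r] of it leaves a connected set trapped between a left gap and [j r],
    although it contains [j r'] beyond. If there are gaps on both sides, the whole loop is trapped
    in every arc around [x], although it has a second point. *)
Lemma simple_loop_covers_left J j c g x : hausdorff_space X -> chart J j c ->
  simple_loop g -> J x -> (g @` `[0, 1]) x ->
  exists2 p : R, 0 < p < c x & forall s : R, p < s < c x -> (g @` `[0, 1]) (j s).
Proof.
move=> hX Jc gloop Jx gx; have [Jo jc cj jcont ccont] := Jc.
have [gc g01 ginj] := gloop.
have [cx jx] := cj _ Jx.
set Gm := g @` `[0, 1].
have Gconn : connected Gm by apply: image_interval_connected => t _; exact: gc.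
apply: contrapT => nleft.
have left_ (p : R) : 0 < p < c x -> exists2 s : R, p < s < c x & ~ Gm (j s).
  move=> pcx; apply: contrapT => h; apply: nleft; exists p => // s psx.
  by apply: contrapT => nGs; apply: h; exists s.
have [[q qcx qG]|nright] := pselect (exists2 q : R, c x < q < 1 &
    forall s : R, c x < s < q -> Gm (j s)).
  pose r := (c x + q) / 2; pose r' := (r + q) / 2.
  have [rb r'b] : c x < r < q /\ r < r' < q by rewrite /r' /r; split; rlra.
  have [Gr Gr'] : Gm (j r) /\ Gm (j r') by split; apply: qG; rlra.
  have [t] := Gr; rewrite /= in_itv/= => /(simple_loop_range gloop)[v v01 <-] gvr.
  have [p pcx nGp] := left_ (c x / 2) ltac:(rlra).
  have Cconn := simple_loop_punctured gloop v01; rewrite -/Gm gvr in Cconn.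
  have sub := chart_trap hX Jc Cconn (p := p) (t := c x) (q := r).
  have [] := sub _ _ _ _ _ _ (j r'); [rlra|rlra|rlra| | | | |].
  - by rewrite jx; split=> //= xr; have [|_] := jc r; [rlra|rewrite -xr; rlra].
  - by move=> [].
  - by move=> [_]; apply.
  - split=> //= rr'; have := chart_inj Jc (t := r') (s := r).
    by move=> /(_ ltac:(rlra) ltac:(rlra) rr'); rlra.
  - by move=> _; have [|_ ->] := jc r'; rlra.
have right_ (q : R) : c x < q < 1 -> exists2 s : R, c x < s < q & ~ Gm (j s).
  move=> cxq; apply: contrapT => h; apply: nright; exists q => // s psx.
  by apply: contrapT => nGs; apply: h; exists s.
have [y Gy yx] : exists2 y, Gm y & y <> x.
  have G0 : Gm (g 0) by exists 0; rewrite //= in_itv/= lexx ler01.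
  have Gh : Gm (g 2^-1) by exists 2^-1; rewrite //= in_itv/=; rlra.
  apply: contrapT => h; have all_x y : Gm y -> y = x.
    by move=> Gy; apply: contrapT => yx; apply: h; exists y.
  have : g 0 = g 2^-1 by rewrite (all_x _ G0) (all_x _ Gh).
  by move=> /ginj E; have := E ltac:(rlra) ltac:(rlra); rlra.
have Gx : Gm (j (c x)) by rewrite jx.
have trap (p0 q0 : R) : 0 < p0 < c x -> c x < q0 < 1 -> J y /\ p0 < c y < q0.
  move=> p0b q0b; have [p pb nGp] := left_ p0 p0b; have [q qb nGq] := right_ q0 q0b.
  have [p_gt0 q_lt1 pq] : [/\ 0 < p, q < 1 & p < c x < q] by split; rlra.
  have [Jy cy] := chart_trap hX Jc Gconn p_gt0 q_lt1 pq Gx nGp nGq Gy.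
  by split=> //; rlra.
have [lo hi] : 0 < c x / 2 < c x /\ c x < (c x + 1) / 2 < 1 by split; rlra.
have [Jy _] := trap _ _ lo hi; have [cy jy] := cj _ Jy.
have [h|h|h] := ltgtP (c y) (c x).
- by have [|_] := trap (c y) _ _ hi; rlra.
- by have [|_] := trap _ (c y) lo; rlra.
- by apply: yx; rewrite -jy h.
Qed.

Lemma simple_loop_covers J j c g x : hausdorff_space X -> chart J j c ->
  simple_loop g -> J x -> (g @` `[0, 1]) x -> nbhs x (g @` `[0, 1]).
Proof.
move=> hX Jc gloop Jx gx; have [Jo jc cj jcont ccont] := Jc.
have [cx jx] := cj _ Jx.
have [p pcx pG] := simple_loop_covers_left hX Jc gloop Jx gx.
have [q qcx qG] := simple_loop_covers_left hX (chart_rev Jc) gloop Jx gx.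
have pq : p < c x < 1 - q by rlra.
apply: filterS (chart_nbhs Jc Jx pq) => y [Jy pyq].
have [cy jy] := cj _ Jy; rewrite -jy.
have [h|h|->] := ltgtP (c y) (c x); last by rewrite jx.
  by apply: pG; rlra.
have -> : c y = 1 - (1 - c y) by ring.
by apply: qG; rlra.
Qed.

End Loops.

(** * Decomposition of the minimal set into loops *)

Section LoopsInMinimalSets.
Context {R : realType} {S : addSemigroupType} {X : topologicalType}.
Context {f : S -> X -> X} {M : set X} {J : set X} {j : R -> X} {c : X -> R}.
Local Open Scope ring_scope.

(** Among the pairs of times at which the spiral meets itself, one at least distance bounds a simple
    loop. The minimum exists because local injectivity keeps the distances above [h], so that the
    pairs to be considered form a compact set. *)
Lemma minimal_simple_loop : minimal_system f M -> infinite_set M ->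
  chart J j c -> J `<=` M ->
  exists2 g : R -> X, simple_loop g & forall t, M (g t).
Proof.
move=> A Minf Jc JM; have [Jo jc cj jcont ccont] := Jc.
have hX := ms_hausdorff A.
have inj r x y : M x -> M y -> f r x = f r y -> x = y.
  exact: (acting_map_injective A Minf Jc JM).
have a01 : 0 < (2^-1 : R) < 1 by lra.
have [Ja ca] := jc _ a01.
have [p0 pq q1] : [/\ 0 <= (2^-1 : R), (2^-1 : R) < 1 & (1 : R) <= 1] by split; lra.
have [e [Je ce]] := ms_dense A (JM _ Ja) (chart_open 2^-1 1 Jc)
  (chart_meets Jc JM p0 pq q1).
pose d := c (f e (j 2^-1)).
have ead : f e (j 2^-1) = j d by have [_ ->] := cj _ Je.
have nofix x : M x -> f e x <> x.
  move=> Mx ex; have := fixed_point_id A Mx ex (JM _ Ja).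
  by move=> ea; move: ce; rewrite ea ca; rlra.
have [a0 ad d1] : [/\ 0 < (2^-1 : R), 2^-1 < d & d < 1] by rewrite /d; split; rlra.
have [s0 [t0 [s01 st0 sE]]] :=
  spiral_not_injective A Jc JM inj nofix a0 ad d1 ead.
have [h h0 hP] := spiral_locally_injective A Jc JM (inj e) nofix a0 ad d1 ead.
pose sp := spiral (f := f) (j := j) e 2^-1 d.
(* The spiral is frozen before time [1], which makes it continuous on the whole line. *)
pose Th (t : R) := sp (Num.max 1 t).
have ThE (t : R) : 1 <= t -> Th t = sp t by move=> t1; rewrite /Th max_r.
have Thc : continuous Th.
  move=> t; apply: (@continuous_comp _ _ _ (fun t : R => Num.max 1 t) (sp)).
    by apply: (@continuous_max R R (fun=> 1) id); [exact: cvg_cst|exact: cvg_id].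
  apply: (spiral_continuous A Jc a0 ad d1 ead).
  by rewrite lt_max ltr01.
have ThM t : M (Th t).
  by apply: (spiral_mem A Jc JM a0 ad d1 ead); rewrite le_max ler01.
have apart (s t : R) : 1 <= s -> s < t -> Th s = Th t -> h <= t - s.
  move=> s1 st; rewrite !ThE//; last rlra.
  move=> stE; rewrite leNgt; apply/negP => tsh.
  by apply: (hP s t) stE => //; rlra.
pose K := [set p : R * R | [/\ 1 <= p.1, p.2 <= t0, h <= p.2 - p.1 & Th p.1 = Th p.2]].
have Kcl : closed K.
  have -> : K = [set p : R * R | 1 <= p.1] `&` [set p : R * R | p.2 <= t0] `&`
      ([set p : R * R | h <= p.2 - p.1] `&` [set p : R * R | Th p.1 = Th p.2]).
    by apply/seteqP; split=> p; [case=> *; split; split|case=> -[? ?] [? ?]; split].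
  have c1 : continuous (fst : R * R -> R) by move=> p; exact: cvg_fst.
  have c2 : continuous (snd : R * R -> R) by move=> p; exact: cvg_snd.
  apply: closedI; apply: closedI.
  - apply: (@preimage_closed _ _ (fst : R * R -> R) [set t : R | 1 <= t]) => //.
  - apply: (@preimage_closed _ _ (snd : R * R -> R) [set t : R | t <= t0]) => //.
  - apply: (@preimage_closed _ _ (fun p : R * R => p.2 - p.1) [set t : R | h <= t]) => //.
    by move=> p _; apply: cvgB; [exact: c2|exact: c1].
  - apply: closed_equalizer => // p.
      by apply: (@continuous_comp _ _ _ fst Th); [exact: c1|exact: Thc].
    by apply: (@continuous_comp _ _ _ snd Th); [exact: c2|exact: Thc].
have Kc : compact K.
  apply: (subclosed_compact Kcl (compact_setX (@segment_compact _ 1 t0)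
    (@segment_compact _ 1 t0))) => -[s t] [/= s1 tt0 hts _].
  by split; rewrite /= in_itv/=; rlra.
have K0 : K (s0, t0).
  have stE : Th s0 = Th t0 by rewrite !ThE//; rlra.
  by split=> //=; exact: apart.
have dc : {within K, continuous (fun p : R * R => p.2 - p.1 : R)}.
  apply: continuous_subspaceT => p; apply: cvgB; [exact: cvg_snd|exact: cvg_fst].
have [[s1 t1]] := @compact_EVT_min _ R _ K (ex_intro _ _ K0) Kc dc.
rewrite inE => -[/= s11 t1t0 hts stE] tmin.
pose l (u : R) := s1 + u * (t1 - s1).
have lc : continuous l by exact: affine_continuous.
exists (Th \o l); last by move=> t; exact: ThM.
(* A repeated value inside the loop would be a pair of times at a smaller distance. *)
have order (u v : R) : 0 <= u < 1 -> 0 <= v < 1 -> Th (l u) = Th (l v) -> ~ u < v.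
  move=> u01 v01 uvE uv.
  have ts0 : 0 < t1 - s1 by rlra.
  have lu : 1 <= l u.
    by rewrite (le_trans s11)// /l lerDl mulr_ge0 ?(ltW ts0)//; rlra.
  have lvu : l v - l u = (v - u) * (t1 - s1) by rewrite /l; ring.
  have luv : l u < l v by rewrite -subr_gt0 lvu mulr_gt0// subr_gt0.
  have lt1 : l v <= t0.
    rewrite (le_trans _ t1t0)// /l -lerBrDl -[leRHS]mul1r ler_wpM2r//; rlra.
  have : (l u, l v) \in K by rewrite inE; split=> //=; exact: apart.
  move=> /tmin /=; rewrite lvu -[leLHS]mul1r ler_pM2r//; rlra.
split.
- by move=> u; apply: (@continuous_comp _ _ _ l Th); [exact: lc|exact: Thc].
- by rewrite /= /l mul0r mul1r addr0 addrC subrK.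
- move=> u v u01 v01 /= uvE; apply/eqP; case: ltgtP => // uv.
    by have := order u v u01 v01 uvE uv.
  by have := order v u v01 u01 (esym uvE) uv.
Qed.

(** Some [f r] sends [x] into [J], where the image loop fills a neighbourhood; injectivity of [f r]
    on [M] pulls this back. *)
Lemma simple_loop_open (g : R -> X) x : minimal_system f M -> infinite_set M ->
  chart J j c -> J `<=` M -> simple_loop g -> (forall t, M (g t)) ->
  (g @` `[0, 1]) x -> exists2 O : set X, open O /\ O x & O `&` M `<=` g @` `[0, 1].
Proof.
move=> A Minf Jc JM gloop gM gx; have [Jo jc cj jcont ccont] := Jc.
have inj r y z : M y -> M z -> f r y = f r z -> y = z.
  exact: (acting_map_injective A Minf Jc JM).
have Mx : M x by case: gx => t _ <-.
have a01 : 0 < (2^-1 : R) < 1 by lra.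
have [Ja ca] := jc _ a01.
have [r Jr] := ms_dense A Mx Jo (ex_intro _ _ (conj Ja (JM _ Ja))).
have [gc g01 ginj] := gloop.
have fgloop : simple_loop (f r \o g).
  split=> [t||s t s01 t01 /= E].
  - by apply: continuous_comp; [exact: gc|exact: (ms_continuous A)].
  - by rewrite /= g01.
  - by apply: ginj => //; exact: inj E.
have fx : ((f r \o g) @` `[0, 1]) (f r x) by case: gx => t ? <-; exists t.
have := simple_loop_covers (ms_hausdorff A) Jc fgloop Jr fx.
rewrite nbhsE => -[V [Vo Vx] VG]; exists (f r @^-1` V).
  by split=> //; apply: open_comp => // ? _; exact: (ms_continuous A).
move=> y [/VG[t t01 /= fgt] My]; exists t => //.
exact: (inj r).
Qed.

(** The images of one loop are connected, compact and relatively open in [M], so two of them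
    coincide or are disjoint. A backward cover by an open set whose trace on [M] lies in the loop
    shows that finitely many exhaust [M]; [undup] discards repetitions. *)
Lemma minimal_circles : minimal_system f M -> infinite_set M ->
  chart J j c -> J `<=` M ->
  exists n (g : 'I_n -> R -> X), [/\ forall i, simple_loop (g i),
    M = \bigcup_i (g i @` `[0, 1]) &
    forall i k x, (g i @` `[0, 1]) x -> (g k @` `[0, 1]) x -> i = k].
Proof.
move=> A Minf Jc JM; have [Jo jc cj jcont ccont] := Jc.
have inj r y z : M y -> M z -> f r y = f r z -> y = z.
  exact: (acting_map_injective A Minf Jc JM).
have [g gloop gM] := minimal_simple_loop A Minf Jc JM.
have [gc g01 ginj] := gloop.
pose G q := (f q \o g) @` `[0, 1].
have Gloop q : simple_loop (f q \o g).
  split=> [t||s t s01 t01 /= E].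
  - by apply: continuous_comp; [exact: gc|exact: (ms_continuous A)].
  - by rewrite /= g01.
  - by apply: ginj => //; exact: inj E.
have GM q t : M ((f q \o g) t) by exact: (ms_invariant A).
have Gc q t : {for t, continuous (f q \o g)} by have [h _ _] := Gloop q; exact: h.
have sub q r x : G q x -> G r x -> G q `<=` G r.
  move=> qx rx.
  pose O := \bigcup_(U in [set U | open U /\ U `&` M `<=` G r]) U.
  have Oo : open O by apply: bigcup_open => U [].
  have OM : O `&` M `<=` G r by move=> y [[U [_ UG] Uy] My]; apply: UG.
  have GO : G r `<=` O.
    move=> y Gy; have [U [Uo Uy] UG] := simple_loop_open A Minf Jc JM (Gloop r) (GM r) Gy.
    by exists U.
  suff <- : G q `&` G r = G q by move=> y [].
  have qM y : G q y -> M y by move=> [t _ <-]; exact: GM.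
  have qE : G q `&` G r = G q `&` O.
    by apply/seteqP; split=> y [Gy ry]; split=> //; [exact: GO|apply: OM; split=> //; exact: qM].
  apply: (image_segment_connected (g := f q \o g) (a := 0) (b := 1)).
  - by move=> t _; exact: Gc.
  - by exists x.
  - by exists O.
  - exists (G r) => //; apply: compact_closed; first exact: (ms_hausdorff A).
    by apply: image_segment_compact => t _; exact: Gc.
have G0 q : G q (f q (g 0)) by exists 0; rewrite //= in_itv/= lexx ler01.
have Gg0 : (g @` `[0, 1]) (g 0) by exists 0; rewrite //= in_itv/= lexx ler01.
have [U [Uo U0] UG] := simple_loop_open A Minf Jc JM gloop gM Gg0.
have [l lU] := backward_cover A Uo (ex_intro _ _ (conj U0 (gM 0))).
pose L := undup [seq G q | q <- l].
have LP (i : 'I_(size L)) : exists q, nth set0 L i = G q.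
  have : nth set0 L i \in L by rewrite mem_nth.
  by rewrite mem_undup => /mapP[q _ ->]; exists q.
have [q qP] := choice LP.
exists (size L), (fun i => f (q i) \o g); split=> //.
  apply/seteqP; split=> [x Mx|x [i _ [t _ <-]]]; last exact: GM.
  have [r rl [w [Uw Mw] wx]] := lU _ Mx.
  have GL : G r \in L by rewrite mem_undup; apply/mapP; exists r.
  have iL : (index (G r) L < size L)%N by rewrite index_mem.
  exists (Ordinal iL) => //; rewrite -[_ @` _]/(G (q (Ordinal iL))) -qP/= nth_index//.
  by have [t t01 tw] := UG _ (conj Uw Mw); exists t => //=; rewrite tw.
move=> i k x ix kx; apply/val_inj/eqP.
rewrite -(nth_uniq set0 (ltn_ord i) (ltn_ord k) (undup_uniq _)) !qP; apply/eqP.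
by apply/seteqP; split; [exact: sub kx|exact: sub ix].
Qed.

End LoopsInMinimalSets.

(** * Arcs and circles as subspaces *)

Section Subtypes.

Lemma into_subtype_continuous (T X : topologicalType) (A : set X)
  (F : T -> set_type A) : continuous (set_val \o F) -> continuous F.
Proof.
move=> Fc; apply/continuousP => _ [V Vo <-].
by move/continuousP: Fc => /(_ V Vo).
Qed.

Lemma set_val_continuous (X : topologicalType) (A : set X) :
  continuous (set_val : set_type A -> X).
Proof. exact: initial_continuous. Qed.

Lemma set_type_val (X : Type) (A : set X) x : A x ->
  exists a : set_type A, set_val a = x.
Proof. by move=> Ax; exists (SigSub (mem_set Ax)). Qed.

Lemma set_val_mem (X : Type) (A : set X) (a : set_type A) : A (set_val a).
Proof. exact: set_valP. Qed.

Lemma set_val_injective (X : Type) (A : set X) (a b : set_type A) :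
  set_val a = set_val b -> a = b.
Proof. exact: val_inj. Qed.

Lemma subtype_compact (X : topologicalType) (A : set X) :
  compact A -> compact [set: set_type A].
Proof.
move=> Ac F FF _; have FA : (set_val @ F) A.
  by apply: nearW => a; exact: set_valP.
have [x [Ax xF]] := Ac _ _ FA; have [a ax] := set_type_val Ax.
exists a; split=> // U V FU /= aV.
have [_ [[W Wo <-] aW] WV] : exists2 B, open_nbhs a B & B `<=` V.
  by move: aV; rewrite nbhsE.
have [_ [[y Uy <-] Wy]] : (set_val @` U) `&` W !=set0.
  apply: xF; last by apply: open_nbhs_nbhs; split=> //; rewrite -ax.
  have UU : U `<=` set_val @^-1` (set_val @` U) by move=> y Uy; exists y.
  exact: (filterS UU FU).
by exists y; split=> //; exact: WV.
Qed.

Lemma homeomorphic_sym (T U : topologicalType) :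
  homeomorphic T U -> homeomorphic U T.
Proof.
by move=> [F [Fc [G [Gc FG GF]]]]; exists G; split=> //; exists F; split.
Qed.

Lemma embedding_homeomorphic (T X : topologicalType) (A : set X) (g : T -> X) :
  compact [set: T] -> hausdorff_space X -> continuous g -> injective g ->
  A = range g -> homeomorphic (set_type A) T.
Proof.
move=> Tc hX gc ginj AE.
have /choice[G GP] (a : set_type A) : exists t, g t = set_val a.
  by have := set_val_mem a; rewrite {1}AE => -[t _ <-]; exists t.
have /choice[F FP] t : exists a : set_type A, set_val a = g t.
  by apply: set_type_val; rewrite AE; exists t.
exists G; split; last first.
  exists F; split.
  - by apply: into_subtype_continuous; rewrite (_ : _ \o _ = g)//; apply/funext.
  - by move=> a; apply: set_val_injective; rewrite FP GP.
  - by move=> t; apply: ginj; rewrite GP FP.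
apply/continuous_closedP => D Dcl.
have -> : G @^-1` D = set_val @^-1` (g @` D).
  apply/seteqP; split=> a /=; first by move=> Da; exists (G a).
  by move=> [t Dt]; rewrite -GP => /ginj <-.
apply: preimage_closed; first by move=> a _; exact: set_val_continuous.
apply: compact_closed => //; apply: continuous_compact.
  exact: continuous_subspaceT.
exact: subclosed_compact Dcl Tc _.
Qed.

End Subtypes.

(** * A rational parametrization of the unit circle *)

Section Circle.
Context {R : realType}.
Local Open Scope ring_scope.
Implicit Types (s t : R).

(* Stereographic projection from [(1, 0)] sends [circle_path t] to
   [(2 t - 1) / (t (1 - t))]. *)
Definition circle_path t : R * R :=
  let n := 2 * t - 1 in let m := t * (1 - t) in
  ((n ^+ 2 - m ^+ 2) / (n ^+ 2 + m ^+ 2), 2 * n * m / (n ^+ 2 + m ^+ 2)).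

Lemma circle_path_den t : 0 < (2 * t - 1) ^+ 2 + (t * (1 - t)) ^+ 2.
Proof.
rewrite lt_neqAle addr_ge0 ?sqr_ge0// andbT eq_sym paddr_eq0 ?sqr_ge0//.
rewrite !expf_eq0/= mulf_eq0; apply/negP => /andP[/eqP t2 /orP[]/eqP t01]; lra.
Qed.

Lemma circle_path_mem t : unit_circle R (circle_path t).
Proof.
have := circle_path_den t; rewrite /unit_circle /circle_path /=.
move: (2 * t - 1) (t * (1 - t)) => n m nm.
by field; rewrite gt_eqF.
Qed.

Lemma circle_path0 : circle_path 0 = (1, 0).
Proof. by rewrite /circle_path; congr pair; field. Qed.

Lemma circle_path1 : circle_path 1 = (1, 0).
Proof. by rewrite /circle_path; congr pair; field. Qed.

Lemma circle_path_continuous : continuous circle_path.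
Proof.
move=> t; have den := circle_path_den t.
have idc : {for t, continuous (id : R -> R)} by exact: cvg_id.
have cc (k : R) : {for t, continuous (fun=> k)} by exact: cvg_cst.
have nc : {for t, continuous (fun t : R => 2 * t - 1)}.
  by apply: cvgB; [apply: cvgM; [exact: (cc 2)|exact: idc]|exact: (cc 1)].
have mc : {for t, continuous (fun t : R => t * (1 - t))}.
  by apply: cvgM; [exact: idc|apply: cvgB; [exact: (cc 1)|exact: idc]].
have n2 : {for t, continuous (fun t : R => (2 * t - 1) ^+ 2)}.
  by apply: cvgM; exact: nc.
have m2 : {for t, continuous (fun t : R => (t * (1 - t)) ^+ 2)}.
  by apply: cvgM; exact: mc.
have dc : {for t, continuous
    (fun t : R => ((2 * t - 1) ^+ 2 + (t * (1 - t)) ^+ 2)^-1)}.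
  by apply: cvgV; [rewrite gt_eqF|apply: cvgD; [exact: n2|exact: m2]].
have c1 : {for t, continuous (fun t => (circle_path t).1)}.
  by apply: cvgM; [apply: cvgB; [exact: n2|exact: m2]|exact: dc].
have c2 : {for t, continuous (fun t => (circle_path t).2)}.
  apply: cvgM; last exact: dc.
  by apply: cvgM; [apply: cvgM; [exact: (cc 2)|exact: nc]|exact: mc].
exact: (cvg_pair c1 c2).
Qed.

Lemma circle_path_inj s t : 0 <= s < 1 -> 0 <= t < 1 ->
  circle_path s = circle_path t -> s = t.
Proof.
have pos (u : R) : 0 < u < 1 -> 0 < u * (1 - u) by move=> u01; rewrite mulr_gt0; lra.
have first_lt1 (u : R) : 0 < u < 1 -> (circle_path u).1 < 1.
  move=> /pos u01; have := circle_path_den u; rewrite /circle_path/=.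
  move: (2 * u - 1) (u * (1 - u)) u01 => n m m0 nm.
  by rewrite ltr_pdivrMr// mul1r -subr_gt0 (_ : _ - _ = m ^+ 2 *+ 2);
    [rewrite pmulrn_lgt0// exprn_gt0|ring].
(* The formula for the stereographic coordinate [y / (1 - x)], cleared of denominators. *)
have slope (u : R) : 0 < u < 1 -> (circle_path u).2 * (u * (1 - u)) =
    (1 - (circle_path u).1) * (2 * u - 1).
  move=> _; have := circle_path_den u; rewrite /circle_path/=.
  move: (2 * u - 1) (u * (1 - u)) => n m nm; field.
  by rewrite gt_eqF.
move=> s01 t01 E.
have [s0|s0] := eqVneq s 0.
  have [t0|t0] := eqVneq t 0; first by rewrite s0 t0.
  have : 0 < t < 1 by rewrite lt_neqAle eq_sym t0; lra.
  by move=> /first_lt1; rewrite -E s0 circle_path0 ltxx.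
have s_gt0 : 0 < s < 1 by rewrite lt_neqAle eq_sym s0; lra.
have [t0|t0] := eqVneq t 0.
  by have := first_lt1 s s_gt0; rewrite E t0 circle_path0 ltxx.
have t_gt0 : 0 < t < 1 by rewrite lt_neqAle eq_sym t0; lra.
have := slope s s_gt0; have := slope t t_gt0; rewrite E.
have := first_lt1 t t_gt0.
move: (circle_path t).1 (circle_path t).2 => x y x1 yt ys.
(* Equality of the two stereographic coordinates, factored; all factors but [s - t] are positive. *)
have : (1 - x) * ((s - t) * (s * t + (1 - s) * (1 - t))) = 0.
  have -> : (1 - x) * ((s - t) * (s * t + (1 - s) * (1 - t))) =
    (1 - x) * (2 * s - 1) * (t * (1 - t)) - (1 - x) * (2 * t - 1) * (s * (1 - s)).
    by ring.
  by rewrite -ys -yt; ring.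
move/eqP; rewrite !mulf_eq0 subr_eq0 gt_eqF//= subr_eq0 => /orP[/eqP//|].
by rewrite gt_eqF// addr_gt0// mulr_gt0//; lra.
Qed.

Lemma circle_path_surj p : unit_circle R p ->
  exists2 t : R, 0 <= t < 1 & circle_path t = p.
Proof.
case: p => x y; rewrite /unit_circle/= => xy.
have [x1|x1] := eqVneq x 1.
  exists 0; first by rewrite lexx ltr01.
  rewrite circle_path0 x1; congr pair; apply/esym/eqP.
  by rewrite -sqrf_eq0; apply/eqP; move: xy; rewrite x1; lra.
pose k := y / (1 - x).
have x10 : 1 - x != 0 by rewrite subr_eq0 eq_sym.
(* The expression runs from [-1] at [0] to [1] at [1]; a zero is a parameter with stereographic
   coordinate [k]. *)
have [t t01 ht] : exists2 t : R, 0 <= t <= 1 & 2 * t - 1 - k * (t * (1 - t)) = 0.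
  apply: sign_change => [|t _|]; first exact: ler01.
    have idc : {for t, continuous (id : R -> R)} by exact: cvg_id.
    have cc (a : R) : {for t, continuous (fun=> a)} by exact: cvg_cst.
    apply: cvgB; first by apply: cvgB; [apply: cvgM; [exact: (cc 2)|exact: idc]|exact: (cc 1)].
    apply: cvgM; first exact: (cc k).
    by apply: cvgM; [exact: idc|apply: cvgB; [exact: (cc 1)|exact: idc]].
  by left; rewrite !(mul0r, mulr0, subrr, mulr1); lra.
have t0 : t != 0.
  by apply/eqP => t0; move: ht; rewrite t0 mul0r mulr0; lra.
have t1 : t != 1.
  by apply/eqP => t1; move: ht; rewrite t1 subrr !mulr0; lra.
exists t; first by rewrite lt_neqAle t1; lra.
have m0 : t * (1 - t) != 0 by rewrite mulf_neq0// subr_eq0 eq_sym.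
have nE : 2 * t - 1 = k * (t * (1 - t)) by lra.
rewrite /circle_path nE; move: (t * (1 - t)) m0 => m m0.
have y2 : y ^+ 2 = (1 - x) * (1 + x) by rewrite -[RHS]subr0; move: xy; nra.
have d0 : y ^+ 2 + (1 - x) ^+ 2 != 0.
  rewrite y2; have -> : (1 - x) * (1 + x) + (1 - x) ^+ 2 = 2 * (1 - x) by ring.
  by rewrite mulf_neq0// pnatr_eq0.
have dk0 : (k * m) ^+ 2 + m ^+ 2 != 0.
  have -> : (k * m) ^+ 2 + m ^+ 2 = (y ^+ 2 + (1 - x) ^+ 2) * m ^+ 2 / (1 - x) ^+ 2.
    by rewrite /k; field.
  by rewrite !mulf_neq0// ?invr_eq0 ?expf_neq0.
congr pair; apply: (mulIf dk0); rewrite divfK//.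
  apply/eqP; rewrite -subr_eq0; apply/eqP.
  have -> : (k * m) ^+ 2 - m ^+ 2 - x * ((k * m) ^+ 2 + m ^+ 2) =
    ((1 - x) * y ^+ 2 - (1 + x) * (1 - x) ^+ 2) * m ^+ 2 / (1 - x) ^+ 2.
    by rewrite /k; field.
  rewrite y2; have -> : (1 - x) * ((1 - x) * (1 + x)) - (1 + x) * (1 - x) ^+ 2 = 0.
    by ring.
  by rewrite !mul0r.
apply/eqP; rewrite -subr_eq0; apply/eqP.
have -> : 2 * (k * m) * m - y * ((k * m) ^+ 2 + m ^+ 2) =
  y * (2 * (1 - x) - (y ^+ 2 + (1 - x) ^+ 2)) * m ^+ 2 / (1 - x) ^+ 2.
  by rewrite /k; field.
rewrite y2.
have -> : 2 * (1 - x) - ((1 - x) * (1 + x) + (1 - x) ^+ 2) = 0 by ring.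
by rewrite mulr0 !mul0r.
Qed.

End Circle.

Section ArcsAndCircles.
Context {R : realType} {X : topologicalType}.
Local Open Scope ring_scope.
Implicit Types (g : R -> X) (s t : R).

Lemma circle_compact : compact [set: set_type (unit_circle R)].
Proof.
apply: subtype_compact.
have -> : unit_circle R = @circle_path R @` `[0, 1].
  apply/seteqP; split=> [p /circle_path_surj[t t01 <-]|_ [t _ <-]].
    by exists t => //; rewrite /= in_itv/=; lra.
  exact: circle_path_mem.
by apply: image_segment_compact => t _; exact: circle_path_continuous.
Qed.

(** [G] is [g] after a choice [T] of parameters. [T] itself jumps at [(1, 0)], but closed sets pull
    back under [g \o T] to images by [circle_path] of compact sets of parameters, because
    [g 0 = g 1]. *)
Lemma simple_loop_circle g : hausdorff_space X -> simple_loop g ->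
  exists G : set_type (unit_circle R) -> X,
    [/\ continuous G, injective G & range G = g @` `[0, 1]].
Proof.
move=> hX [gc g01 ginj].
have /choice[T TP] (p : set_type (unit_circle R)) :
    exists t : R, 0 <= t < 1 /\ circle_path t = set_val p.
  by have [t t01 tp] := circle_path_surj (set_val_mem p); exists t.
exists (g \o T); split.
- apply/continuous_closedP => D Dcl.
  have -> : (g \o T) @^-1` D =
      set_val @^-1` (@circle_path R @` (g @^-1` D `&` `[0, 1])).
    apply/seteqP; split=> p /=; have [Tp01 Tp] := TP p.
      by move=> Dp; exists (T p) => //; split; rewrite // in_itv/=; lra.
    move=> [t [Dt]]; rewrite in_itv/= => t01; rewrite -Tp.
    have [t1|t1] := eqVneq t 1.
      rewrite t1 circle_path1 -circle_path0 => /circle_path_inj.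
      by rewrite lexx ltr01 => /(_ isT Tp01) <-; rewrite g01 -t1.
    have t1' : 0 <= t < 1 by rewrite lt_neqAle t1; lra.
    by move=> /(circle_path_inj t1' Tp01) <-.
  apply: preimage_closed; first by move=> a _; exact: set_val_continuous.
  apply: compact_closed; first exact: norm_hausdorff.
  apply: continuous_compact.
    exact/continuous_subspaceT/circle_path_continuous.
  rewrite setIC; apply: compact_closedI; first exact: segment_compact.
  by apply: preimage_closed => // t _; exact: gc.
- move=> p q /= pq; apply: set_val_injective.
  have [p01 <-] := TP p; have [q01 <-] := TP q.
  by rewrite (ginj _ _ p01 q01 pq).
- apply/seteqP; split=> [_ [p _ <-]|_ [t + <-]].
    by have [p01 _] := TP p; exists (T p) => //; rewrite /= in_itv/=; lra.
  rewrite /= in_itv/= => /(simple_loop_range (And3 gc g01 ginj))[v v01 <-].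
  have [p pv] := set_type_val (circle_path_mem v).
  have [p01 pT] := TP p; exists p => //=; congr g.
  by apply: circle_path_inj => //; rewrite pT.
Qed.

Lemma simple_loop_is_circle g : hausdorff_space X -> simple_loop g ->
  is_circle R (g @` `[0, 1]).
Proof.
move=> hX /(simple_loop_circle hX)[G [Gc Ginj GE]].
exact: embedding_homeomorphic circle_compact hX Gc Ginj (esym GE).
Qed.

Lemma injective_path_is_arc g : hausdorff_space X -> continuous g ->
  (forall s t, 0 <= s <= 1 -> 0 <= t <= 1 -> g s = g t -> s = t) ->
  is_arc R (g @` `[0, 1]).
Proof.
move=> hX gc ginj; apply: (@embedding_homeomorphic _ _ _
    (g \o (set_val : set_type (closed_unit_interval R) -> R))) => //.
- exact/subtype_compact/segment_compact.
- move=> a; apply: continuous_comp; [exact: set_val_continuous|exact: gc].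
- move=> a b /= ab; apply: set_val_injective; apply: ginj ab.
    by have := set_val_mem a; rewrite /closed_unit_interval/= in_itv.
  by have := set_val_mem b; rewrite /closed_unit_interval/= in_itv.
- apply/seteqP; split=> [_ [t t01 <-]|_ [a _ <-]]; last first.
    by exists (set_val a) => //; exact: set_val_mem.
  by have [a <-] := set_type_val t01; exists a.
Qed.

Lemma disjoint_loops_circles n (g : 'I_n -> R -> X) : hausdorff_space X ->
  (forall i, simple_loop (g i)) ->
  (forall i k x, (g i @` `[0, 1]) x -> (g k @` `[0, 1]) x -> i = k) ->
  is_finite_union_of_circles R (\bigcup_i (g i @` `[0, 1])).
Proof.
move=> hX gloop gdisj; exists n.
have /choice[G GP] i : exists G : set_type (unit_circle R) -> X,
    [/\ continuous G, injective G & range G = g i @` `[0, 1]].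
  exact: simple_loop_circle.
pose F (p : {i : 'I_n & set_type (unit_circle R)}) := G (projT1 p) (projT2 p).
have FE i p : (g i @` `[0, 1]) (G i p) by have [_ _ <-] := GP i; exists p.
apply: (@embedding_homeomorphic _ _ _ F) => //.
- apply: sigT_compact => [|_]; last exact: circle_compact.
  apply: (@sub_finite_set _ _ [set` enum 'I_n]) => [i _|]; last exact: finite_seq.
  by rewrite /= mem_enum.
- have := @sigT_continuous _ _ X (fun i : 'I_n => G i).
  by apply=> i; have [] := GP i.
- move=> [i p] [k q]; rewrite /F/= => pq.
  have ik : i = k by apply: (gdisj _ _ (G i p)); rewrite // pq.
  by rewrite -ik in q pq *; have [_ Ginj _] := GP i; rewrite (Ginj _ _ pq).
- apply/seteqP; split=> [x [i _]|_ [[i p] _ <-]]; last by exists i => //; exact: FE.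
  by have [_ _ <-] := GP i => -[p _ <-]; exists (existT _ i p).
Qed.

End ArcsAndCircles.

(** * Finite unions of paths *)

Section MetricFromDistance.
Local Open Scope ring_scope.
Context {R : realType} {T : choiceType} (d : T -> T -> R).
Hypothesis dxx : forall x, d x x = 0.
Hypothesis d_eq0 : forall x y, d x y = 0 -> x = y.
Hypothesis dC : forall x y, d x y = d y x.
Hypothesis d_triangle : forall y x z, d x z <= d x y + d y z.

(** The dummy [let] makes the alias depend on the distance axioms, so that the metric instance can
    be recovered from the type. *)
Definition metric_of : Type :=
  let _ := (dxx, d_eq0, dC, d_triangle) in T.

HB.instance Definition _ := Choice.on metric_of.
HB.instance Definition _ :=
  @isMetric.Build R metric_of d dxx d_eq0 dC d_triangle.

End MetricFromDistance.

Section Metrizability.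
Local Open Scope ring_scope.
Context {R : realType}.

Lemma compact_bijection_homeomorphic (T U : topologicalType) (F : T -> U) :
  compact [set: T] -> hausdorff_space U -> continuous F -> injective F ->
  (forall u, exists t, F t = u) -> homeomorphic T U.
Proof.
move=> Tc hU Fc Finj /choice[G FG]; exists F; split=> //; exists G; split=> //.
- apply/continuous_closedP => D Dcl.
  have -> : G @^-1` D = F @` D.
    apply/seteqP; split=> u /=; first by move=> Du; exists (G u).
    by move=> [t Dt tu]; rewrite (Finj (G u) t)// FG.
  apply: compact_closed => //; apply: continuous_compact.
    exact: continuous_subspaceT.
  exact: subclosed_compact Dcl Tc _.
- by move=> t; apply: Finj.
Qed.

Section SupDistance.
Context {T : topologicalType} (g : nat -> T -> R).
Hypothesis gc : forall k, continuous (g k).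
Hypothesis g01 : forall k x, 0 <= g k x <= 1.
Hypothesis gsep : forall x y, x <> y -> exists k, g k x <> g k y.

(** The weights bound the terms of large index uniformly, so that only finitely many [g k] have to
    be controlled near a point. *)
Definition sup_dist (x y : T) : R :=
  sup (range (fun k => `|g k x - g k y| / k.+1%:R)).

Lemma sup_dist_term_le k x y : `|g k x - g k y| / k.+1%:R <= k.+1%:R^-1.
Proof.
rewrite ler_piMl ?invr_ge0 ?ler0n// ler_norml.
by have /andP[? ?] := g01 k x; have /andP[? ?] := g01 k y; lra.
Qed.

Lemma sup_dist_has_sup x y :
  has_sup (range (fun k => `|g k x - g k y| / k.+1%:R)).
Proof.
split; first by exists (`|g 0%N x - g 0%N y| / 1%:R), 0%N.
exists 1 => _ [k _ <-]; apply: (le_trans (sup_dist_term_le k x y)).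
by rewrite invf_le1 ?ltr0n// ler1n.
Qed.

Lemma sup_dist_ge k x y : `|g k x - g k y| / k.+1%:R <= sup_dist x y.
Proof.
by apply: ub_le_sup; [have [] := sup_dist_has_sup x y|exists k].
Qed.

Lemma sup_dist_le x y (e : R) :
  (forall k, `|g k x - g k y| / k.+1%:R <= e) -> sup_dist x y <= e.
Proof.
move=> h; apply: ge_sup; first by have [] := sup_dist_has_sup x y.
by move=> _ [k _ <-].
Qed.

Lemma sup_distxx x : sup_dist x x = 0.
Proof.
apply/eqP; rewrite eq_le; apply/andP; split.
  by apply: sup_dist_le => k; rewrite subrr normr0 mul0r.
by apply: le_trans (sup_dist_ge 0 x x); rewrite mulr_ge0.
Qed.

Lemma sup_dist_eq0 x y : sup_dist x y = 0 -> x = y.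
Proof.
move=> xy0; apply: contrapT => /gsep[k]; apply; apply/eqP.
have := sup_dist_ge k x y; rewrite xy0 pmulr_lle0 ?invr_gt0 ?ltr0n//.
by rewrite normr_le0 subr_eq0.
Qed.

Lemma sup_distC x y : sup_dist x y = sup_dist y x.
Proof.
rewrite /sup_dist.
by have -> : (fun k => `|g k x - g k y| / k.+1%:R) =
  (fun k => `|g k y - g k x| / k.+1%:R) by apply/funext => k; rewrite distrC.
Qed.

Lemma sup_dist_triangle y x z : sup_dist x z <= sup_dist x y + sup_dist y z.
Proof.
apply: sup_dist_le => k.
apply: le_trans (lerD (sup_dist_ge k x y) (sup_dist_ge k y z)).
by rewrite -mulrDl ler_pM2r ?invr_gt0 ?ltr0n// ler_distD.
Qed.

Lemma sup_dist_near x (e : R) : 0 < e -> \forall y \near x, sup_dist x y < e.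
Proof.
(* Terms of index above [N] are at most [e / 2] because of the weights; the others are handled by
   continuity. *)
move=> e0; pose N := Num.truncn (2 / e).
have N0 : 0 <= 2 / e by rewrite divr_ge0// ltW.
have hN : 2 / e < N.+1%:R by have /andP[] := truncn_itv N0.
have near_lt n : \forall y \near x, forall k, (k < n)%N -> `|g k x - g k y| < e / 2.
  elim: n => [|n IH]; first by near=> y.
  have gn : nbhs x [set y | `|g n x - g n y| < e / 2].
    have e2 : 0 < e / 2 by rewrite divr_gt0.
    exact: (@gc n x _ (nbhsx_ballx (g n x) (e / 2) e2)).
  apply: filterS (filterI IH gn) => y [/= IHy gny] k.
  by rewrite ltnS leq_eqVlt => /predU1P[->|/IHy].
apply: filterS (near_lt N.+1) => y near_y.
apply: (@le_lt_trans _ _ (e / 2)); last by rewrite ltr_pdivrMr// ltr_pMr// ltr1n.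
apply: sup_dist_le => k; have [kN|Nk] := ltnP k N.+1.
  apply: le_trans (ltW (near_y k kN)).
  by rewrite ler_piMr// invf_le1 ?ltr0n// ler1n.
apply: (le_trans (sup_dist_term_le k x y)).
rewrite -[leRHS]invrK lef_pV2 ?posrE ?invr_gt0 ?divr_gt0 ?ltr0n//.
rewrite invf_div (le_trans (ltW hN))// ler_nat.
exact: leq_trans Nk _.
Unshelve. all: by end_near.
Qed.

(** The identity is a continuous bijection from the compact topology to the Hausdorff topology of
    the distance. *)
Lemma sup_dist_metrizable : compact [set: T] -> metrizable R T.
Proof.
move=> Tc.
pose N := metric_of sup_distxx sup_dist_eq0 sup_distC sup_dist_triangle.
exists N; apply: (@compact_bijection_homeomorphic T N (fun x => x : N)) => //.
- exact: (@metric_hausdorff R N).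
- move=> x V /nbhs_ballP[e /= e0 eV].
  apply: filterS (sup_dist_near x e0) => y xy.
  by apply: eV; rewrite ballEmdist.
- by move=> u; exists u.
Qed.

End SupDistance.

(** One Urysohn function per pair of members makes a countable family of continuous functions, and
    the disjoint pairs suffice to separate the points of [A]. *)
Lemma closed_family_metrizable (X : topologicalType) (A : set X)
    (F : nat -> set X) :
  compact [set: X] -> hausdorff_space X -> closed A ->
  (forall k, closed (F k)) ->
  (forall x y, A x -> A y -> x <> y ->
    exists k l, [/\ F k x, F l y & F k `&` F l = set0]) ->
  metrizable R (set_type A).
Proof.
move=> Xc hX Acl Fcl Fsep.
have Xn := (@normal_separatorP R X).1 (compact_normal hX Xc).
pose U (kl : nat * nat) : X -> R := Urysohn (F kl.1) (F kl.2).
pose g (n : nat) : set_type A -> R :=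
  if unpickle n is Some kl then U kl \o set_val else fun=> 0.
apply: (@sup_dist_metrizable _ g).
- move=> n; rewrite /g; case: unpickle => [kl|]; last exact: cst_continuous.
  by move=> a; apply: continuous_comp; [exact: set_val_continuous|exact: Urysohn_continuous].
- move=> n a; rewrite /g; case: unpickle => [kl|]; last by rewrite lexx ler01.
  have /= := @Urysohn_range _ R (F kl.1) (F kl.2) _ (ex_intro2 _ _ (set_val a) I erefl).
  by rewrite in_itv.
- move=> a b ab; have [|k [l [Fka Flb Fkl]]] :=
      Fsep _ _ (set_val_mem a) (set_val_mem b).
    by move=> /set_val_injective.
  have kl := Xn _ _ (Fcl k) (Fcl l) Fkl.
  exists (pickle (k, l)); rewrite /g pickleK /U /=.
  rewrite (Urysohn_sub0 kl (ex_intro2 _ _ _ Fka erefl)).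
  rewrite (Urysohn_sub1 kl (ex_intro2 _ _ _ Flb erefl)).
  by apply/eqP; rewrite eq_sym oner_eq0.
- by apply: subtype_compact; exact: subclosed_compact Acl Xc _.
Qed.

End Metrizability.

(** * Metrizability and local connectedness of a finite union of paths *)

Section FiniteUnionOfPaths.
Local Open Scope ring_scope.
Context {R : realType} {X : topologicalType}.
Implicit Types (p : nat -> R -> X) (n : nat).

Definition path_union p n : set X := \bigcup_(i in `I_n) (p i @` `[0, 1]).

Lemma path_union_closed p n : hausdorff_space X ->
  (forall i, continuous (p i)) -> closed (path_union p n).
Proof.
move=> hX pc; rewrite /path_union; elim: n => [|n IH].
  by rewrite II0 bigcup_set0; exact: closed0.
rewrite IIS bigcup_setU bigcup_set1; apply: closedU => //.
apply: compact_closed => //; apply: image_segment_compact => t _; exact: pc.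
Qed.

(** The images of segments with rational ends form a countable family of closed sets, and every
    neighbourhood of a point of the union contains a member through that point. *)
Lemma path_union_metrizable p n (A : set X) : compact [set: X] ->
  hausdorff_space X -> (forall i, continuous (p i)) -> closed A ->
  A `<=` path_union p n -> metrizable R (set_type A).
Proof.
move=> Xc hX pc Acl AY.
pose F (k : nat) : set X :=
  if unpickle k is Some (i, a, b) then p i @` `[ratr a, ratr b] else set0.
have FE i (a b : rat) : F (pickle (i, a, b)) = p i @` `[ratr a, ratr b].
  by rewrite /F pickleK.
apply: (@closed_family_metrizable R X A F Xc hX Acl).
- move=> k; rewrite /F; case: unpickle => [[[i a] b]|]; last exact: closed0.
  apply: compact_closed => //; apply: image_segment_compact => t _; exact: pc.
- move=> _ _ /AY[i _ [s _ <-]] /AY[k _ [t _ <-]] /(hausdorff_open hX).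
  move=> [U [V [Us Vt Uo Vo UV]]].
  have around q u W : open W -> W (p q u) -> exists a b : rat,
      (ratr a : R) <= u <= ratr b /\ p q @` `[ratr a, ratr b] `<=` W.
    move=> Wo Wu; have /nbhs_distP[e e0 eW] := pc q u _ (open_nbhs_nbhs (conj Wo Wu)).
    have /rat_in_itvoo[a] : u - e < u by lra.
    rewrite in_itv/= => aue.
    have /rat_in_itvoo[b] : u < u + e by lra.
    rewrite in_itv/= => bue.
    exists a, b; split; first lra.
    move=> _ [w + <-]; rewrite /= in_itv/= => abw.
    by apply: eW; rewrite ltr_norml; lra.
  have [a [b [abs abU]]] := around i s U Uo Us.
  have [a' [b' [abt abV]]] := around k t V Vo Vt.
  exists (pickle (i, a, b)), (pickle (k, a', b')); rewrite !FE; split.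
  - by exists s.
  - by exists t.
  - by apply/seteqP; split=> // x [/abU Ux /abV]; exact: UV.
Qed.

(** While a path stays in [U] it stays in one component, so the times at which path [i] is outside
    [C] form a closed set [D i]. The complement of [C] in the union is then a finite union of
    compact images. *)
Lemma path_union_component_open p n (U : set X) x : hausdorff_space X ->
  (forall i, continuous (p i)) -> open U ->
  exists O, open O /\
    connected_component (path_union p n `&` U) x = path_union p n `&` O.
Proof.
move=> hX pc Uo; set C := connected_component _ _.
have Csub : C `<=` path_union p n `&` U by exact: connected_component_sub.
pose D i := [set t : R | 0 <= t <= 1 /\ ~ C (p i t)].
have Dc i : (i < n)%N -> compact (D i).
  move=> ilt; have Dcl : closed (D i).
    move=> t Dt; have t01 : 0 <= t <= 1.
      have /(_ t) : closed `[0 : R, 1]%classic by exact: itv_closed.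
      rewrite /= in_itv/=; apply => V /Dt[s [[s01 _] Vs]].
      by exists s; split=> //; rewrite /= in_itv.
    split=> // Ct; have [_ Ut] := Csub _ Ct.
    have /nbhs_distP[e e0 eU] := pc i t _ (open_nbhs_nbhs (conj Uo Ut)).
    have [s [[s01 nCs] st]] := Dt _ (nbhsx_ballx t e e0).
    apply: nCs; apply: (connected_component_trans Ct).
    have stE : `|s - t| < e by rewrite distrC.
    pose a := Num.min s t; pose b := Num.max s t.
    apply: (@connected_component_max _ _ (p i @` `[a, b])).
    + by exists t => //=; rewrite in_itv/= /a /b ge_min le_max !lexx !orbT.
    + move=> _ [u + <-]; rewrite /= in_itv/= => abu; split.
        exists i => //; exists u => //=; rewrite in_itv/=.
        by move: abu; rewrite /a /b; case: (ltP s t) => _; lra.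
      apply: eU; move: abu stE; rewrite /a /b !ltr_norml.
      by case: (ltP s t) => _ ? /andP[? ?]; lra.
    + by apply: image_segment_connected => u _; exact: pc.
    + by exists s => //=; rewrite in_itv/= /a /b ge_min le_max !lexx.
  apply: (subclosed_compact Dcl (@segment_compact _ 0 1)) => t [t01 _].
  by rewrite /= in_itv.
exists (~` \bigcup_(i in `I_n) (p i @` D i)); split.
  apply: closed_openC.
  suff : forall m, (m <= n)%N -> closed (\bigcup_(i in `I_m) (p i @` D i)) by apply.
  elim=> [|m IH] mn; first by rewrite II0 bigcup_set0; exact: closed0.
  rewrite IIS bigcup_setU bigcup_set1; apply: closedU; first exact: IH (ltnW mn).
  apply: compact_closed => //; apply: continuous_compact; last exact: Dc.
  exact: continuous_subspaceT.
apply/seteqP; split=> y.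
  move=> Cy; split; first by have [] := Csub _ Cy.
  by move=> [i _ [t [_ nC] ty]]; apply: nC; rewrite ty.
move=> [[i ilt [t + <-]] nD]; rewrite /= in_itv/= => t01.
by apply: contrapT => nC; apply: nD; exists i => //; exists t.
Qed.

Lemma subtype_connected (Y C : set X) : C `<=` Y -> connected C ->
  connected (set_val @^-1` C : set (set_type Y)).
Proof.
move=> CY Cconn B [b Bb] [_ [U Uo <-] BU] [D Dcl BD].
have [V Vo VD] : exists2 V, open V & set_val @^-1` V = ~` D.
  by have [V Vo VE] := closed_openC Dcl; exists V.
have BE (a : set_type Y) : C (set_val a) -> (U (set_val a) <-> ~ V (set_val a)).
  move=> Ca; have -> : U (set_val a) = B a by rewrite BU; apply/propext; split=> [|[]].
  have -> : V (set_val a) = (set_val @^-1` V) a by [].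
  rewrite VD BD; split=> [[_ Da] //|/contrapT Da]; by split.
have CU : C `&` U = C.
  apply: Cconn.
  - by exists (set_val b); move: Bb; rewrite BU.
  - by exists U.
  - exists (~` V); first exact: open_closedC.
    apply/seteqP; split=> y [Cy UVy]; split=> //.
      by have [a ay] := set_type_val (CY _ Cy); rewrite -ay; apply/BE; rewrite ay.
    by have [a ay] := set_type_val (CY _ Cy); rewrite -ay; apply/BE; rewrite ay.
rewrite BU; apply/seteqP; split=> [a [] //|a /= Ca].
by split=> //; move: Ca; rewrite -CU => -[].
Qed.

Lemma path_union_locally_connected p n : hausdorff_space X ->
  (forall i, continuous (p i)) -> locally_connected (set_type (path_union p n)).
Proof.
move=> hX pc x V; rewrite nbhsE => -[_ [[U Uo <-] Ux] UV].
have [W [Wo CW]] := path_union_component_open n (set_val x) hX pc Uo.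
set C := connected_component _ _ in CW.
have Csub : C `<=` path_union p n `&` U by exact: connected_component_sub.
exists (set_val @^-1` C); split.
- exists W => //; rewrite CW; apply/seteqP; split=> a /=; last by case.
  by move=> Wa; split=> //; exact: set_val_mem.
- apply: subtype_connected; last exact: component_connected.
  by move=> y /Csub[].
- by apply: connected_component_refl; split=> //; exact: set_val_mem.
- by move=> a /Csub[_ Ua]; exact: UV.
Qed.

End FiniteUnionOfPaths.

(** * The Cantor case *)

Section CantorSpaces.
Context {R : realType}.

(** An alias carrying a base point, which provides the pointed structure before
    [homeomorphism_cantor_like] is applied. *)
Definition with_point (N : metricType R) (x : N) : Type := let _ := x in N.

HB.instance Definition _ (N : metricType R) (x : N) :=
  PseudoMetric.on (with_point x).
HB.instance Definition _ (N : metricType R) (x : N) :=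
  isPointed.Build (with_point x) x.

Lemma homeomorphic_trans (T U V : topologicalType) :
  homeomorphic T U -> homeomorphic U V -> homeomorphic T V.
Proof.
move=> [F [Fc [F' [F'c FF' F'F]]]] [G [Gc [G' [G'c GG' G'G]]]].
exists (G \o F); split.
  by move=> x; apply: continuous_comp; [exact: Fc|exact: Gc].
exists (F' \o G'); split.
- by move=> x; apply: continuous_comp; [exact: G'c|exact: F'c].
- by move=> x /=; rewrite GG' FF'.
- by move=> x /=; rewrite F'F G'G.
Qed.

Lemma cantor_like_homeomorphic (T : topologicalType) (t : T) :
  metrizable R T -> cantor_like T -> homeomorphic T cantor_space.
Proof.
move=> [N TN] [/perfectTP Tperf Tc hT Tzero].
apply: (homeomorphic_trans TN); have [F [Fc [G [Gc FG GF]]]] := TN.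
have Ncantor : cantor_like (with_point (F t)).
  split.
  - apply/perfectTP => x xo; apply: (Tperf (G x)).
    have -> : [set G x] = F @^-1` [set x].
      by apply/seteqP; split=> y /= => [->|<-].
    by apply: open_comp => // y _; exact: Fc.
  - have -> : [set: N] = F @` setT.
      by apply/seteqP; split=> // x _; exists (G x).
    by apply: continuous_compact => //; exact: continuous_subspaceT.
  - exact: metric_hausdorff.
  - move=> x y /eqP xy; have [|U [[Uo Ucl] Ux Uy]] := Tzero (G x) (G y).
      by apply/eqP => /(congr1 F); rewrite !GF.
    exists (G @^-1` U); split=> //; split.
      by apply: open_comp => // z _; exact: Gc.
    by apply: preimage_closed => // z _; exact: Gc.
have [g [gc _]] := homeomorphism_cantor_like Ncantor.
apply: homeomorphic_sym.
apply: (@compact_bijection_homeomorphic _ (with_point (F t)) g) => //.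
- exact: cantor_space_compact.
- exact: metric_hausdorff.
- by move=> u; have [x _ xu] := @surj _ _ _ _ g u I; exists x.
Qed.

Lemma subtype_hausdorff (X : topologicalType) (A : set X) :
  hausdorff_space X -> hausdorff_space (set_type A).
Proof.
move=> hX a b ab; apply: set_val_injective; apply: hX => U V aU bV.
have [c [Uc Vc]] := ab _ _ (set_val_continuous aU) (set_val_continuous bV).
by exists (set_val c).
Qed.

Lemma subtype_isolated (X : topologicalType) (A : set X) (a : set_type A) :
  open [set a] -> exists2 U, open U & U `&` A = [set set_val a].
Proof.
move=> [U Uo Ua]; exists U => //; apply/seteqP; split=> [x [Ux Ax]|x -> /=].
  have [b bx] := set_type_val Ax; rewrite -bx /=; congr set_val.
  have : (set_val @^-1` U) b by rewrite /= bx.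
  by rewrite Ua.
split; last exact: set_val_mem.
have : (set_val @^-1` U) a by rewrite Ua.
by [].
Qed.

Lemma subtype_separated (X : topologicalType) (A B1 B2 : set X)
    (a b : set_type A) : closed B1 -> closed B2 -> A `<=` B1 `|` B2 ->
  (forall x, A x -> B1 x -> ~ B2 x) -> B1 (set_val a) -> B2 (set_val b) ->
  exists U : set (set_type A), [/\ clopen U, U a & ~ U b].
Proof.
move=> B1cl B2cl AB B12 Ba Bb; exists (set_val @^-1` B1); split=> //; last first.
  by move=> B1b; exact: B12 (set_val_mem b) B1b Bb.
split; last by apply: preimage_closed => // z _; exact: set_val_continuous.
have -> : set_val @^-1` B1 = set_val @^-1` (~` B2) :> set (set_type A).
  apply/seteqP; split=> c /=; first exact: B12 (set_val_mem c).
  by case: (AB _ (set_val_mem c)).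
apply: open_comp; first by move=> z _; exact: set_val_continuous.
exact: closed_openC.
Qed.

End CantorSpaces.

Section NowhereDense.
Context {R : realType} {S : addSemigroupType} {X : topologicalType}.
Context {f : S -> X -> X} {M : set X} {J : set X} {j : R -> X} {c : X -> R}.
Local Open Scope ring_scope.

(** If [M] had an interior point, some [f s] would send a whole arc of [J] at [x] into [M], and some
    [f t] would return it to [J]. A non-constant coordinate [b] would fill an open arc with points
    of [M], by intermediate values; so the arc is collapsed to a point and [collapse_finite]
    applies. *)
Lemma minimal_nowhere_dense x : minimal_system f M -> infinite_set M ->
  chart J j c -> M x -> J x ->
  (forall U, open U -> U !=set0 -> ~ U `<=` J `&` M) -> nowhere_dense M.
Proof.
move=> A Minf Jc Mx Jx noint; have [Jo jc cj jcont ccont] := Jc.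
rewrite /nowhere_dense -((closure_id M).1 (ms_closed A)).
apply: contrapT => /eqP/set0P[u Mu].
have [s Us] := ms_dense A Mx (open_interior M)
  (ex_intro _ u (conj Mu (interior_subset Mu))).
have [t Jt] := ms_dense A (ms_invariant A s Mx) Jo (ex_intro _ x (conj Jx Mx)).
have [cx jx] := cj _ Jx.
have rc : {for c x, continuous j} by exact: jcont.
have [e e0 eP] : exists2 e : R, 0 < e & forall y : R, `|y - c x| < e ->
    [/\ M (f s (j y)), J (f t (f s (j y))) & 0 < y < 1].
  apply: nbhs_distP; near=> y; split; near: y; last exact: interval_nbhs.
    apply: (rc (f s @^-1` M)); rewrite jx.
    apply: (ms_continuous A); exact: Us.
  apply: (rc (f s @^-1` (f t @^-1` J))); rewrite jx.
  apply: (ms_continuous A); apply: (ms_continuous A).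
  exact: open_nbhs_nbhs.
have eP' (y : R) : c x - e < y < c x + e ->
    [/\ M (f s (j y)), J (f t (f s (j y))) & 0 < y < 1].
  by move=> ye; apply: eP; rewrite ltr_norml; rlra.
pose b (y : R) := c (f t (f s (j y))).
have bc (y : R) : c x - e < y < c x + e -> {for y, continuous b}.
  move=> /eP'[_ Jy y01]; apply: (@continuous_comp _ _ _ j (c \o (f t \o f s))).
    exact: jcont.
  apply: (@continuous_comp _ _ _ (f t \o f s) c); last exact: ccont.
  by apply: continuous_comp; exact: (ms_continuous A).
have cst (y z : R) : c x - e < y -> y < z -> z < c x + e -> b y = b z.
  move=> ey yz ze; apply/eqP; apply: contrapT => /negP byz.
  have [My Jy y01] := eP' y ltac:(rlra); have [Mz Jz z01] := eP' z ltac:(rlra).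
  have cby : 0 < b y < 1 := (cj _ Jy).1; have cbz : 0 < b z < 1 := (cj _ Jz).1.
  pose lo := Num.min (b y) (b z); pose hi := Num.max (b y) (b z).
  have lohi : lo < hi.
    move: byz; rewrite neq_lt /lo /hi => /orP[h|h].
      by rewrite min_l ?max_r ?(ltW h).
    by rewrite min_r ?max_l ?(ltW h).
  have [lo0 hi1] : 0 < lo /\ hi < 1 by rewrite lt_min gt_max; split; rlra.
  apply: (noint [set w | J w /\ lo < c w < hi]); first exact: chart_open Jc.
    have [|Jm cm] := jc ((lo + hi) / 2); first rlra.
    by exists (j ((lo + hi) / 2)); split; rewrite // cm; rlra.
  move=> w [Jw cw]; split=> //; have [cw01 jw] := cj _ Jw.
  have yz' : y <= z by rlra.
  have bw : {within `[y, z], continuous b}.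
    apply: continuous_in_subspaceT => v; rewrite inE/= in_itv/= => vyz.
    by apply: bc; rlra.
  have [|v] := IVT yz' bw (v := c w); first by rewrite -/lo -/hi; rlra.
  rewrite in_itv/= => vyz bv; rewrite -jw -bv.
  have [Mv Jv v01] := eP' v ltac:(rlra).
  by rewrite /b (cj _ Jv).2; exact: (ms_invariant A).
apply: Minf.
have pq : c x - e < c x < c x + e by rlra.
apply: (@collapse_finite _ _ _ _ A [set w | J w /\ c x - e < c w < c x + e] (t + s)
  (f (t + s) x)); first exact: chart_open Jc.
  by exists x; split.
move=> y [Jy cy] My; rewrite !(ms_add A).
have [cy01 jy] := cj _ Jy.
have ball_ : b (c y) = b (c x).
  have [h|h|->//] := ltgtP (c y) (c x); [|apply/esym]; apply: cst => //; rlra.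
have [_ Jby _] := eP' (c y) cy; have [_ Jbx _] := eP' (c x) pq.
transitivity (j (b (c y))); first by rewrite /b (cj _ Jby).2 jy.
by rewrite ball_ /b (cj _ Jbx).2 jx.
Unshelve. all: by end_near.
Qed.

End NowhereDense.

(** * The closed convex hull of the trace on the free interval *)

Section HullEnds.
Context {R : realType} {S : addSemigroupType} {X : topologicalType}.
Context {f : S -> X -> X} {M : set X}.
Local Open Scope ring_scope.
Implicit Types (J : set X) (j : R -> X) (c : X -> R) (m t : R) (x z : X).

(* [z] is the limit of [j] at the supremum [m] of the coordinates of [M]; it
   lies outside [J] exactly when [m = 1]. *)
Definition upper_end J j c m z : Prop :=
  [/\ 0 < m <= 1 /\ M z,
    forall t : R, 0 < t < 1 -> M (j t) -> t <= m,
    forall p : R, p < m -> exists t : R, p < t < m /\ 0 < t /\ M (j t),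
    forall V, nbhs z V -> exists2 p : R, 0 < p < m &
      forall t : R, p < t < m -> V (j t) &
    (m < 1 /\ J z /\ c z = m) \/ (m = 1 /\ ~ J z)].

(** If [M] accumulates at the end of [J], [end_convergence] supplies the limit. Otherwise the
    supremum of the coordinates is attained since [M] is closed, and it is approached from below
    since an infinite [M] has no isolated point. *)
Lemma exists_upper_end J j c x : minimal_system f M -> infinite_set M ->
  chart J j c -> J x -> M x -> exists m z, upper_end J j c m z.
Proof.
move=> A Minf Jc Jx Mx; have [Jo jc cj jcont ccont] := Jc.
have [cx jx] := cj _ Jx.
have [acc|] := pselect (forall p : R, 0 < p < 1 ->
    exists t : R, p < t < 1 /\ M (j t)).
  have [z [Mz Jz zlim]] := end_convergence A Jc acc.
  exists 1, z; split=> //; last by right.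
  - by split=> //; rewrite ltr01 lexx.
  - by move=> t /andP[_ /ltW].
  - move=> p p1; pose q := Num.max p 2^-1.
    have [pq q2 q1] : [/\ p <= q, 2^-1 <= q & q < 1].
      by rewrite /q !le_max !lexx orbT gt_max; split=> //; rlra.
    have [t [qt Mt]] := acc q ltac:(rlra).
    by exists t; split; [rlra|split=> //; rlra].
move=> /existsNP[p0 /not_implyP[p01 nacc]].
have H_le (t : R) : 0 < t < 1 -> M (j t) -> t <= p0.
  move=> t01 Mt; rewrite leNgt; apply/negP => p0t; apply: nacc.
  by exists t; split=> //; rlra.
pose H := [set t : R | 0 < t < 1 /\ M (j t)].
have Hx : H (c x) by split=> //; rewrite jx.
have Hsup : has_sup H.
  by split; [exists (c x)|exists p0 => t [t01 Mt]; exact: H_le].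
pose m := sup H.
have Hm (t : R) : H t -> t <= m by move=> Ht; apply: ub_le_sup Ht; exact: Hsup.2.
have mp0 : m <= p0 by apply: ge_sup; [exact: Hsup.1|move=> t [t01 Mt]; exact: H_le].
have xm : c x <= m by exact: Hm.
have m01 : 0 < m < 1 by rlra.
have [Jm cm] := jc _ m01.
have Mm : M (j m).
  apply: (ms_closed A) => V jV.
  have /nbhs_distP[e e0 eV] := jcont _ m01 _ jV.
  have [t [t01 Mt] tm] := sup_adherent e0 Hsup.
  exists (j t); split=> //; apply: eV.
  have := Hm _ (conj t01 Mt); rewrite ltr_norml -/m in tm *; rlra.
exists m, (j m); split.
- by split=> //; rlra.
- by move=> t t01 Mt; exact: Hm.
- move=> p pm; pose q := Num.max p 0.
  have [pq q0 qm] : [/\ p <= q, 0 <= q & q < m].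
    by rewrite /q !le_max !lexx orbT gt_max; split=> //; rlra.
  have q1m : q < c (j m) < 1 by rewrite cm; rlra.
  apply: contrapT => none; apply: Minf.
  apply: (isolated_finite A (U := [set y | J y /\ q < c y < 1]) (x := j m)).
    exact: chart_open Jc.
  apply/seteqP; split=> [y [[Jy qy] My]|y ->] //=.
  have [cy jy] := cj _ Jy; rewrite -jy; congr j.
  have ym : c y <= m by apply: Hm; split=> //; rewrite jy.
  apply/eqP; rewrite eq_le ym /= leNgt; apply/negP => ltym; apply: none.
  by exists (c y); split; [rlra|split; [rlra|rewrite jy]].
- move=> V jV; have /nbhs_distP[e e0 eV] := jcont _ m01 _ jV.
  pose p := Num.max (m / 2) (m - e).
  have [pe p2 pm] : [/\ m - e <= p, m / 2 <= p & p < m].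
    by rewrite /p !le_max !lexx orbT gt_max; split=> //; rlra.
  by exists p; [rlra|move=> t ptm; apply: eV; rewrite ltr_norml; rlra].
- by left; split; [rlra|split].
Qed.

End HullEnds.

Section Hull.
Context {R : realType} {S : addSemigroupType} {X : topologicalType}.
Context {f : S -> X -> X} {M : set X} {J : set X} {j : R -> X} {c : X -> R}.
Local Open Scope ring_scope.
Implicit Types (m t s : R) (x z : X).

(** A chart says nothing about [j] at [0] and [1], so the limits [z0] and [z1] are put in by hand
    and continued constantly outside [[m0, m1]]. *)
Definition hull_path m0 m1 z0 z1 t : X :=
  if t <= m0 then z0 else if m1 <= t then z1 else j t.

Definition lower_end (m0 : R) z0 : Prop :=
  upper_end (M := M) J (fun t => j (1 - t)) (fun x => 1 - c x) (1 - m0) z0.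

Definition chart_hull : set X :=
  [set x | J x /\ c x \in Rhull (c @` (J `&` M))].

Lemma lower_endP m0 z0 : lower_end m0 z0 ->
  [/\ 0 <= m0 < 1 /\ M z0,
    forall t : R, 0 < t < 1 -> M (j t) -> m0 <= t,
    forall p : R, m0 < p -> exists t : R, m0 < t < p /\ t < 1 /\ M (j t),
    forall V, nbhs z0 V -> exists2 p : R, m0 < p < 1 &
      forall t : R, m0 < t < p -> V (j t) &
    (0 < m0 /\ J z0 /\ c z0 = m0) \/ (m0 = 0 /\ ~ J z0)].
Proof.
move=> [[m01 Mz] low dense_ lim_ zJ]; split.
- by split=> //; rlra.
- move=> t t01 Mt; have t01' : 0 < 1 - t < 1 by rlra.
  have := low (1 - t) t01'; rewrite (_ : 1 - (1 - t) = t); last by ring.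
  by move=> /(_ Mt); rlra.
- move=> p mp; have [t [pt [t0 Mt]]] := dense_ (1 - p) ltac:(rlra).
  by exists (1 - t); split; [rlra|split=> //; rlra].
- move=> V /lim_[p p01 pV]; exists (1 - p); first rlra.
  move=> t tp; rewrite (_ : t = 1 - (1 - t)); last by ring.
  by apply: pV; rlra.
- case: zJ => [[m1 [Jz cz]]|[m1 Jz]]; [left|right].
    by split; [rlra|split=> //; rlra].
  by split=> //; rlra.
Qed.

Context {m0 m1 : R} {z0 z1 : X}.
Local Notation ga := (hull_path m0 m1 z0 z1).

Lemma hull_path_mid t : m0 < t < m1 -> ga t = j t.
Proof.
move=> /andP[m0t tm1]; rewrite /hull_path leNgt m0t /= leNgt tm1 //.
Qed.

Lemma hull_path0 : ga m0 = z0. Proof. by rewrite /hull_path lexx. Qed.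

Lemma hull_path1 : m0 < m1 -> ga m1 = z1.
Proof. by move=> m01; rewrite /hull_path leNgt m01 /= lexx. Qed.

Lemma hull_path_continuous : chart J j c -> lower_end m0 z0 ->
  upper_end (M := M) J j c m1 z1 -> m0 < m1 -> continuous ga.
Proof.
move=> Jc /lower_endP[[m00 Mz0] _ _ lim0 _] [[m11 Mz1] _ _ lim1 _] m01 t V.
have [_ _ _ jcont _] := Jc.
have [t0|t0|->] := ltgtP t m0.
- rewrite {1}/hull_path (ltW t0) => zV.
  have : m0 - (m0 - t + 1) < t < m0 by rlra.
  move=> /interval_nbhs; apply: filterS => s /andP[_ sm0].
  by rewrite /= /hull_path (ltW sm0); exact: nbhs_singleton.
- have [t1|t1|->] := ltgtP t m1.
  + rewrite hull_path_mid; last rlra.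
    move=> jV; have t01 : 0 < t < 1 by rlra.
    have tm : m0 < t < m1 by rlra.
    have : nbhs t (j @^-1` V `&` [set s | m0 < s < m1]).
      by apply: filterI; [exact: jcont|exact: interval_nbhs].
    by apply: filterS => s [/= Vs sm]; rewrite hull_path_mid.
  + rewrite {1}/hull_path leNgt t0/= (ltW t1) => zV.
    have : m1 < t < t + 1 by rlra.
    move=> /interval_nbhs; apply: filterS => s /andP[ms _].
    rewrite /= /hull_path (ltW ms) leNgt (lt_trans m01 ms) /=.
    exact: nbhs_singleton.
  + rewrite hull_path1// => zV; have [p p01 pV] := lim1 _ zV.
    pose q := Num.max p m0.
    have [pq mq qm] : [/\ p <= q, m0 <= q & q < m1].
      by rewrite /q !le_max !lexx orbT gt_max; split=> //; rlra.
    have : q < m1 < m1 + 1 by rlra.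
    move=> /interval_nbhs; apply: filterS => s /andP[qs _] /=.
    have [sm|sm] := ltP s m1; last first.
      by rewrite /hull_path sm leNgt (lt_le_trans m01 sm)/=; exact: nbhs_singleton.
    by rewrite hull_path_mid; [apply: pV|]; rlra.
rewrite hull_path0 => zV; have [p p01 pV] := lim0 _ zV.
pose q := Num.min p m1.
have [pq mq qm] : [/\ q <= p, q <= m1 & m0 < q].
  by rewrite /q !ge_min !lexx orbT lt_min; split=> //; rlra.
have : m0 - 1 < m0 < q by rlra.
move=> /interval_nbhs; apply: filterS => s /andP[_ sq] /=.
have [sm|sm] := leP s m0; first by rewrite /hull_path sm; exact: nbhs_singleton.
by rewrite hull_path_mid; [apply: pV|]; rlra.
Qed.

(** The coordinate of [x] lies between [m0] and [m1]. If these agreed, accumulation at [m1] from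
    below would give points of [M] with coordinate less than [m0]. *)
Lemma end_points_ordered x : chart J j c -> lower_end m0 z0 ->
  upper_end (M := M) J j c m1 z1 -> J x -> M x -> m0 < m1.
Proof.
move=> Jc /lower_endP[_ low _ _ _] [_ up dense_ _ _] Jx Mx.
have [_ _ cj _ _] := Jc; have [cx jx] := cj _ Jx.
have Mcx : M (j (c x)) by rewrite jx.
have m0x := low _ cx Mcx; have xm1 := up _ cx Mcx.
rewrite lt_neqAle (le_trans m0x xm1) andbT; apply/eqP => m01.
have xE : c x = m1 by rlra.
have [t [tm [t0 Mt]]] := dense_ (c x / 2) ltac:(rlra).
have t01 : 0 < t < 1 by rlra.
by have := low _ t01 Mt; rlra.
Qed.

(** The open part of the path lies in the hull because [M] accumulates at both ends, and the
    endpoints are limits of it. Conversely, the compact image of [[m0, m1]] contains the hull. *)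
Lemma closure_chart_hull : hausdorff_space X -> chart J j c ->
  lower_end m0 z0 -> upper_end (M := M) J j c m1 z1 -> m0 < m1 ->
  closure chart_hull = ga @` `[m0, m1].
Proof.
move=> hX Jc lo hi m01; have gac := hull_path_continuous Jc lo hi m01.
have [[m0b Mz0] low ldense _ z0J] := lower_endP lo.
have [[m1b Mz1] up udense _ z1J] := hi.
have [_ jc cj _ _] := Jc.
have HE : c @` (J `&` M) = [set t : R | 0 < t < 1 /\ M (j t)].
  apply/seteqP; split=> [_ [x [Jx Mx] <-]|t [t01 Mt]].
    by have [cx jx] := cj _ Jx; rewrite /= jx.
  by have [Jt ct] := jc _ t01; exists (j t).
have sub t : t \in Rhull (c @` (J `&` M)) -> m0 <= t <= m1.
  have : [set` Rhull (c @` (J `&` M))] `<=` [set t : R | m0 <= t <= m1].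
    rewrite Rhull_smallest; apply: smallest_sub.
      by move=> a b /= am bm s sab; rlra.
    rewrite HE => s [s01 Ms] /=; rewrite low// up//.
  exact.
have sup_ t : m0 < t < m1 -> t \in Rhull (c @` (J `&` M)).
  move=> tm; have [a [am [a1 Ma]]] := ldense t ltac:(rlra).
  have [b [bm [b0 Mb]]] := udense t ltac:(rlra).
  have /= := @interval_is_interval _ (Rhull (c @` (J `&` M))) a b.
  apply; [| |rlra]; apply: sub_Rhull; rewrite HE.
    by split=> //; rlra.
  by split=> //; rlra.
apply/seteqP; split.
  rewrite -(_ : closure (ga @` `[m0, m1]) = ga @` `[m0, m1]); last first.
    apply/esym/closure_id; apply: compact_closed => //.
    by apply: image_segment_compact => t _; exact: gac.
  apply: closureS => x [Jx /sub cxm]; have [cx jx] := cj _ Jx.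
  exists (c x); first by rewrite /= in_itv.
  have [cx0|cx0] := eqVneq (c x) m0.
    rewrite cx0 hull_path0; case: z0J => [[_ [Jz0 cz0]]|[m00 _]].
      have [_ <-] := cj _ Jz0; by rewrite cz0 -cx0 jx.
    by move: cx; rewrite cx0 m00 ltxx.
  have [cx1|cx1] := eqVneq (c x) m1.
    rewrite cx1 hull_path1//; case: z1J => [[_ [Jz1 cz1]]|[m10 _]].
      by have [_ <-] := cj _ Jz1; rewrite cz1 -cx1 jx.
    by move: cx; rewrite cx1 m10 ltxx andbF.
  rewrite hull_path_mid// !lt_neqAle eq_sym cx0 cx1; exact: cxm.
have gahull s : m0 < s < m1 -> chart_hull (ga s).
  move=> sm; have s01 : 0 < s < 1 by rlra.
  have [Js cs] := jc _ s01.
  by rewrite hull_path_mid//; split=> //; rewrite cs; exact: sup_.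
move=> _ [t /= /[!in_itv]/= tm <-] V /gac /nbhs_distP[e e0 eV].
have [tm1|mt1] := ltP t m1.
  pose q := Num.min (t + e) m1.
  have [qe qm tq] : [/\ q <= t + e, q <= m1 & t < q].
    by rewrite /q !ge_min !lexx orbT lt_min; split=> //; rlra.
  exists (ga ((t + q) / 2)); split; first by apply: gahull; rlra.
  by apply: eV; rewrite ltr_norml; rlra.
pose q := Num.max (t - e) m0.
have [qe qm tq] : [/\ t - e <= q, m0 <= q & q < t].
  by rewrite /q !le_max !lexx orbT gt_max; split=> //; rlra.
exists (ga ((t + q) / 2)); split; first by apply: gahull; rlra.
by apply: eV; rewrite ltr_norml; rlra.
Qed.

Definition hull_loop m0 m1 z0 z1 (u : R) := hull_path m0 m1 z0 z1 (m0 + u * (m1 - m0)).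
Local Notation gb := (hull_loop m0 m1 z0 z1).

Lemma hull_loop_range : m0 < m1 -> gb @` `[0, 1] = ga @` `[m0, m1].
Proof.
move=> m01; apply/seteqP; split=> _ [t /= /[!in_itv]/= tb <-].
  by exists (m0 + t * (m1 - m0)) => //; rewrite /= in_itv/=; nra.
exists ((t - m0) / (m1 - m0)).
  rewrite /= in_itv/= divr_ge0 ?subr_ge0 ?(ltW m01)//; last by case/andP: tb.
  by rewrite ler_pdivrMr ?subr_gt0// mul1r lerD2r; case/andP: tb.
by rewrite /hull_loop divfK ?subr_eq0 ?gt_eqF//; congr ga; ring.
Qed.

Lemma hull_loop_continuous : chart J j c -> lower_end m0 z0 ->
  upper_end (M := M) J j c m1 z1 -> m0 < m1 -> continuous gb.
Proof.
move=> Jc lo hi m01 u.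
apply: (@continuous_comp _ _ _ (fun v : R => m0 + v * (m1 - m0)) ga).
  exact: affine_continuous.
exact: hull_path_continuous Jc lo hi m01 _.
Qed.

Lemma hull_loop_mid (u : R) : m0 < m1 -> 0 < u < 1 -> gb u = j (m0 + u * (m1 - m0)).
Proof. by move=> m01 u01; rewrite /hull_loop hull_path_mid//; nra. Qed.

Lemma hull_loop0 : gb 0 = z0.
Proof. by rewrite /hull_loop mul0r addr0 hull_path0. Qed.

Lemma hull_loop1 : m0 < m1 -> gb 1 = z1.
Proof. by move=> m01; rewrite /hull_loop mul1r subrKC hull_path1. Qed.

End Hull.

Section HullTopology.
Context {R : realType} {S : addSemigroupType} {X : topologicalType}.
Context {f : S -> X -> X} {M : set X} {J : set X} {j : R -> X} {c : X -> R}.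
Context {m0 m1 : R} {z0 z1 : X}.
Local Open Scope ring_scope.
Implicit Types (s t u v : R) (x y z : X).
Local Notation gb := (hull_loop (j := j) m0 m1 z0 z1).
Local Notation lower := (lower_end (M := M) (J := J) (j := j) (c := c) m0 z0).
Local Notation upper := (upper_end (M := M) J j c m1 z1).

(** An endpoint lying in [J] has coordinate [m0] or [m1], and otherwise it is outside [J]; so the
    two endpoints can coincide only with each other. *)
Lemma hull_loop_interior_inj u v : chart J j c -> lower -> upper -> m0 < m1 ->
  0 < u < 1 -> 0 <= v <= 1 -> gb u = gb v -> u = v.
Proof.
move=> Jc /lower_endP[[m00 _] _ _ _ zJ0] [[m11 _] _ _ _ zJ1] m01 u01 v01.
have [_ jc _ _ _] := Jc.
have um : m0 < m0 + u * (m1 - m0) < m1 by nra.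
have [Ju cu] : J (gb u) /\ c (gb u) = m0 + u * (m1 - m0).
  by rewrite hull_loop_mid//; apply: jc; rlra.
have [v0|v0] := eqVneq v 0.
  rewrite v0 hull_loop0 => uz; rewrite uz in Ju cu.
  by case: zJ0 => [[_ [_ cz]]|[_ /(_ Ju)//]]; move: um; rewrite -cu cz ltxx.
have [v1|v1] := eqVneq v 1.
  rewrite v1 hull_loop1// => uz; rewrite uz in Ju cu.
  case: zJ1 => [[_ [_ cz]]|[_ /(_ Ju)//]].
  by move: um; rewrite -cu cz ltxx andbF.
have {}v01 : 0 < v < 1 by rewrite !lt_neqAle eq_sym v0 v1.
have vm : m0 < m0 + v * (m1 - m0) < m1 by nra.
rewrite !hull_loop_mid// => /(chart_inj Jc) uv.
have {}uv : m0 + u * (m1 - m0) = m0 + v * (m1 - m0) by apply: uv; rlra.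
by apply: (@mulIf _ (m1 - m0)); [rewrite subr_eq0 gt_eqF|exact: addrI uv].
Qed.

Lemma hull_loop_simple : chart J j c -> lower -> upper -> m0 < m1 ->
  z0 = z1 -> simple_loop gb.
Proof.
move=> Jc lo hi m01 z01; split.
- exact: hull_loop_continuous Jc lo hi m01.
- by rewrite hull_loop0 hull_loop1.
move=> s t s01 t01 st; have inj := hull_loop_interior_inj Jc lo hi m01.
have [s0|s0] := eqVneq s 0; last by apply: inj st; rlra.
have [t0|t0] := eqVneq t 0; first by rewrite s0 t0.
by apply/esym; apply: inj (esym st); rlra.
Qed.

Lemma hull_loop_injective s t : chart J j c -> lower -> upper -> m0 < m1 ->
  z0 <> z1 -> 0 <= s <= 1 -> 0 <= t <= 1 -> gb s = gb t -> s = t.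
Proof.
move=> Jc lo hi m01 z01 s01 t01 st; have inj := hull_loop_interior_inj Jc lo hi m01.
have [s0|s0] := eqVneq s 0; have [t0|t0] := eqVneq t 0; first by rewrite s0 t0.
- have [t1|t1] := eqVneq t 1; last by apply/esym; apply: inj (esym st); rlra.
  by move: st; rewrite s0 t1 hull_loop0 hull_loop1.
- have [s1|s1] := eqVneq s 1; last by apply: inj st; rlra.
  by move: st; rewrite s1 t0 hull_loop0 hull_loop1// => /esym.
- have [s1|s1] := eqVneq s 1; last by apply: inj st; rlra.
  have [t1|t1] := eqVneq t 1; first by rewrite s1 t1.
  by apply/esym; apply: inj (esym st); rlra.
Qed.

Lemma hull_arc_or_circle : hausdorff_space X -> chart J j c -> lower -> upper ->
  m0 < m1 -> is_arc R (gb @` `[0, 1]) \/ is_circle R (gb @` `[0, 1]).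
Proof.
move=> hX Jc lo hi m01; have [z01|z01] := pselect (z0 = z1).
  by right; apply: simple_loop_is_circle => //; exact: hull_loop_simple.
left; apply: injective_path_is_arc => //.
  exact: hull_loop_continuous Jc lo hi m01.
by move=> s t; exact: hull_loop_injective.
Qed.

Lemma hull_loop_segment_closed s t : hausdorff_space X -> chart J j c ->
  lower -> upper -> m0 < m1 -> closed (gb @` `[s, t]).
Proof.
move=> hX Jc lo hi m01; apply: compact_closed => //.
apply: image_segment_compact => u _.
exact: hull_loop_continuous Jc lo hi m01 _.
Qed.

Lemma hull_loop_gap s t : chart J j c -> lower -> upper -> m0 < m1 ->
  (forall U, open U -> U !=set0 -> ~ U `<=` J `&` M) ->
  0 <= s -> s < t -> t <= 1 -> exists2 u, s < u < t & ~ M (gb u).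
Proof.
move=> Jc /lower_endP[[m00 _] _ _ _ _] [[m11 _] _ _ _ _] m01 noint s0 st t1.
have [_ jc cj _ _] := Jc; apply: contrapT => none.
have st' : m0 + s * (m1 - m0) < m0 + t * (m1 - m0) by nra.
have sb : 0 <= s * (m1 - m0) by nra.
have tb : m0 + t * (m1 - m0) <= m1 by nra.
pose a := m0 + s * (m1 - m0); pose b := m0 + t * (m1 - m0).
have [|Jm cm] := jc ((a + b) / 2); first by rewrite /a /b; rlra.
apply: (noint [set y | J y /\ a < c y < b]).
- by apply: chart_open Jc.
- by exists (j ((a + b) / 2)); split=> //; rewrite cm /a /b; rlra.
move=> y [Jy cy]; split=> //; have [cy01 jy] := cj _ Jy.
pose u := (c y - m0) / (m1 - m0).
have uE : m0 + u * (m1 - m0) = c y.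
  by rewrite /u divfK ?subr_eq0 ?gt_eqF//; ring.
have stu : s < u < t.
  by move: cy; rewrite -uE /a /b !ltrD2l !ltr_pM2r ?subr_gt0.
apply: contrapT => nMy; apply: none; exists u => //.
by rewrite hull_loop_mid ?uE ?jy//; rlra.
Qed.

Lemma hull_loop_param t : m0 < t -> t < m1 ->
  exists2 u : R, 0 < u < 1 & gb u = j t.
Proof.
move=> mt tm; have m01 := lt_trans mt tm; pose u := (t - m0) / (m1 - m0).
have u01 : 0 < u < 1.
  by apply/andP; split; rewrite ?divr_gt0 ?ltr_pdivrMr ?subr_gt0 ?mul1r ?ltrD2r.
exists u; rewrite // hull_loop_mid// /u divfK ?subr_eq0 ?gt_eqF//.
by congr j; ring.
Qed.

(* On a loop, two gaps are needed to separate two points. *)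
Lemma hull_separated_lt (a b : set_type (M `&` gb @` `[0, 1])) s t :
  hausdorff_space X -> chart J j c -> lower -> upper -> m0 < m1 ->
  (forall U, open U -> U !=set0 -> ~ U `<=` J `&` M) ->
  0 <= s -> s < t -> t <= 1 -> (z0 = z1 -> t < 1) ->
  set_val a = gb s -> set_val b = gb t ->
  exists U : set (set_type (M `&` gb @` `[0, 1])), [/\ clopen U, U a & ~ U b].
Proof.
move=> hX Jc lo hi m01 noint s0 st t1 zt1 sa tb.
have [u ust nMu] := hull_loop_gap Jc lo hi m01 noint s0 st t1.
have cl (p q : R) : closed (gb @` `[p, q]) by exact: hull_loop_segment_closed hX Jc lo hi m01.
have inj := hull_loop_interior_inj Jc lo hi m01.
have [z01|z01] := pselect (z0 = z1).
  have t0 : 0 <= t by rlra.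
  have [v vt nMv] := hull_loop_gap Jc lo hi m01 noint t0 (zt1 z01) (lexx 1).
  apply: (@subtype_separated _ _ (gb @` `[0, u] `|` gb @` `[v, 1]) (gb @` `[u, v])).
  - by apply: closedU; exact: cl.
  - exact: cl.
  - move=> _ [_ [w /= /[!in_itv]/= w01 <-]].
    have [wu|uw] := leP w u; first by left; left; exists w; rewrite // /= in_itv/=; rlra.
    have [wv|vw] := leP w v; first by right; exists w; rewrite // /= in_itv/=; rlra.
    by left; right; exists w; rewrite // /= in_itv/=; rlra.
  - move=> x [Mx _] pB [q /= /[!in_itv]/= quv qx].
    have [p [p01 pq px]] : exists p : R, [/\ 0 <= p <= 1, p <= u \/ v <= p & gb p = x].
      case: pB => -[p /= /[!in_itv]/= pb px]; exists p; split=> //; rlra.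
    have qp : q = p by apply: inj; [rlra|rlra|rewrite qx px].
    have [qu|qv] : q = u \/ q = v by case: pq => h; [left|right]; rlra.
      by apply: nMu; rewrite -qu qx.
    by apply: nMv; rewrite -qv qx.
  - by left; exists s; rewrite // /= in_itv/=; rlra.
  - by exists t; rewrite // /= in_itv/=; rlra.
apply: (@subtype_separated _ _ (gb @` `[0, u]) (gb @` `[u, 1])).
- exact: cl.
- exact: cl.
- move=> _ [_ [w /= /[!in_itv]/= w01 <-]].
  have [wu|uw] := leP w u; first by left; exists w; rewrite // /= in_itv/=; rlra.
  by right; exists w; rewrite // /= in_itv/=; rlra.
- move=> x [Mx _] [p /= /[!in_itv]/= pu px] [q /= /[!in_itv]/= uq qx].
  have pq : p = q.
    by apply: (hull_loop_injective Jc lo hi m01 z01); rewrite ?px ?qx//; rlra.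
  by apply: nMu; rewrite (_ : u = p) ?px//; rlra.
- by exists s; rewrite // /= in_itv/=; rlra.
- by exists t; rewrite // /= in_itv/=; rlra.
Qed.

Lemma hull_zero_dimensional : hausdorff_space X -> chart J j c ->
  lower -> upper -> m0 < m1 ->
  (forall U, open U -> U !=set0 -> ~ U `<=` J `&` M) ->
  zero_dimensional (set_type (M `&` gb @` `[0, 1])).
Proof.
move=> hX Jc lo hi m01 noint a b /eqP ab.
have param (d : set_type (M `&` gb @` `[0, 1])) : exists s : R,
    [/\ 0 <= s, s <= 1, z0 = z1 -> s < 1 & set_val d = gb s].
  have [_ [s /= /[!in_itv]/= s01 sd]] := set_val_mem d.
  (* On a loop the parameter [1] is traded for [0]. *)
  have [[z01 s1]|nz] := pselect (z0 = z1 /\ s = 1).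
    exists 0; split=> //.
    by rewrite -sd s1 hull_loop0 hull_loop1.
  exists s; split=> //; [rlra|rlra|move=> z01].
  rewrite lt_neqAle; apply/andP; split; last rlra.
  by apply/eqP => s1; apply: nz.
have [s [s0 s1 zs as_]] := param a; have [t [t0 t1 zt bt]] := param b.
have [st|ts|st] := ltgtP s t.
- exact: (hull_separated_lt hX Jc lo hi m01 noint s0 st t1 zt as_ bt).
- have [U [Uc Ub Ua]] := hull_separated_lt hX Jc lo hi m01 noint t0 ts s1 zs bt as_.
  exists (~` U); split; [exact: clopenC|exact: Ua|by move=> /(_ Ub)].
- by case: ab; apply: set_val_injective; rewrite as_ bt st.
Qed.

(** At an endpoint of the path, [M] accumulates from inside by the choice of [m0] and [m1]. At any
    other parameter, a point isolated in the trace is isolated in [M], which [isolated_finite]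
    excludes. *)
Lemma hull_perfect : minimal_system f M -> infinite_set M ->
  chart J j c -> lower -> upper -> m0 < m1 ->
  perfect_set [set: set_type (M `&` gb @` `[0, 1])].
Proof.
move=> A Minf Jc lo hi m01; apply/perfectTP => a /subtype_isolated[U Uo UK].
have inj := hull_loop_interior_inj Jc lo hi m01.
have [_ _ cj _ _] := Jc.
have [Ma [s /= /[!in_itv]/= s01 sa]] := set_val_mem a.
rewrite -sa in UK Ma.
have Us : U (gb s).
  by have [] : (U `&` (M `&` gb @` `[0, 1])) (gb s) by rewrite UK.
have Uj t : m0 < t -> t < m1 -> U (j t) -> M (j t) -> exists2 u : R, 0 < u < 1 & gb u = gb s.
  move=> mt tm Ut Mt; have [u u01 uE] := hull_loop_param mt tm; exists u => //.
  have : (U `&` (M `&` gb @` `[0, 1])) (gb u).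
    split; first by rewrite uE.
    by split; [rewrite uE|exists u; rewrite // /= in_itv/=; rlra].
  by rewrite UK.
have [[m00 Mz0] low ldense llim _] := lower_endP lo.
have [[m10 Mz1] up udense ulim _] := hi.
have [s0|s0] := eqVneq s 0.
  rewrite s0 hull_loop0 in Us; have [p p01 pU] := llim _ (open_nbhs_nbhs (conj Uo Us)).
  pose q := Num.min p m1.
  have [qp qm mq] : [/\ q <= p, q <= m1 & m0 < q].
    by rewrite /q !ge_min !lexx orbT lt_min; split=> //; rlra.
  have [t [tq [t1 Mt]]] := ldense q mq.
  have [||||u u01 us] := Uj t => //; [rlra|rlra|by apply: pU; rlra|].
  by have := inj u s u01 ltac:(rlra) us; rlra.
have [s1|s1] := eqVneq s 1.
  rewrite s1 hull_loop1// in Us; have [p p01 pU] := ulim _ (open_nbhs_nbhs (conj Uo Us)).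
  pose q := Num.max p m0.
  have [pq mq qm] : [/\ p <= q, m0 <= q & q < m1].
    by rewrite /q !le_max !lexx orbT gt_max; split=> //; rlra.
  have [t [tq [t1 Mt]]] := udense q qm.
  have [||||u u01 us] := Uj t => //; [rlra|rlra|by apply: pU; rlra|].
  by have := inj u s u01 ltac:(rlra) us; rlra.
have {}s01 : 0 < s < 1 by rewrite !lt_neqAle eq_sym s0 s1.
apply: Minf; apply: (isolated_finite A (U := U `&` [set y | J y /\ m0 < c y < m1]) (x := gb s)).
  by apply: openI => //; exact: chart_open Jc.
apply/seteqP; split=> [y [[Uy [Jy cy]] My]|y ->].
  have [cy01 jy] := cj _ Jy; have /andP[mc cm] := cy.
  have [||u u01 us] := Uj _ mc cm; rewrite ?jy//.
  have [v v01 vE] := hull_loop_param mc cm; rewrite -jy -vE.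
  have : (U `&` (M `&` gb @` `[0, 1])) (gb v).
    split; first by rewrite vE jy.
    by split; [rewrite vE jy|exists v; rewrite // /= in_itv/=; rlra].
  by rewrite UK.
have [_ jc _ _ _] := Jc.
have um : m0 < m0 + s * (m1 - m0) < m1 by nra.
split=> //; split=> //.
rewrite hull_loop_mid//=; have [|Jt ->//] := jc (m0 + s * (m1 - m0)).
by rlra.
Qed.

Lemma hull_is_cantor : compact [set: X] -> minimal_system f M -> infinite_set M ->
  chart J j c -> lower -> upper -> m0 < m1 ->
  (forall U, open U -> U !=set0 -> ~ U `<=` J `&` M) ->
  is_cantor (M `&` gb @` `[0, 1]).
Proof.
move=> Xc A Minf Jc lo hi m01 noint; have hX := ms_hausdorff A.
have [[_ Mz0] _ _ _ _] := lower_endP lo.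
have Kcl : closed (M `&` gb @` `[0, 1]).
  apply: closedI; first exact: ms_closed A.
  exact: hull_loop_segment_closed hX Jc lo hi m01.
have [k _] : exists k : set_type (M `&` gb @` `[0, 1]), set_val k = z0.
  apply: set_type_val; split=> //; exists 0; rewrite ?hull_loop0//.
  by rewrite /= in_itv/= lexx ler01.
apply: (@cantor_like_homeomorphic R _ k).
  (* The trace is a closed subset of the image of a single path. *)
  apply: (@path_union_metrizable _ _ (fun=> gb) 1) => //.
    by move=> _; exact: hull_loop_continuous Jc lo hi m01.
  by move=> x [_ gx]; exists 0%N.
split.
- exact: hull_perfect A Minf Jc lo hi m01.
- by apply: subtype_compact; exact: (subclosed_compact Kcl Xc).
- exact: subtype_hausdorff.
- exact: hull_zero_dimensional hX Jc lo hi m01 noint.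
Qed.

End HullTopology.

(** * From actions to minimal systems *)

Section Extension.
Context {X Y : topologicalType} {A : set X}.

Definition extend (F : set_type A -> Y) (y0 : Y) (x : X) : Y :=
  if pselect (A x) is left Ax then F (SigSub (mem_set Ax)) else y0.

Lemma extend_val F y0 (a : set_type A) : extend F y0 (set_val a) = F a.
Proof.
rewrite /extend; case: pselect => [Aa|/(_ (set_val_mem a))//].
by congr F; exact: set_val_injective.
Qed.

Lemma extend_continuous F y0 x : open A -> A x -> continuous F ->
  {for x, continuous (extend F y0)}.
Proof.
move=> Ao /(@set_type_val _ A)[a <-] Fc; rewrite /prop_for /continuous_at extend_val.
move=> V FV; have := Fc a _ FV.
rewrite nbhsE => -[_ [[U Uo <-] Ua] UV].
have : nbhs (set_val a) (U `&` A).
  by apply: open_nbhs_nbhs; split; [exact: openI|split=> //; exact: set_val_mem].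
apply: filterS => y [Uy /(@set_type_val _ A)[b by_]].
by rewrite /= -by_ extend_val; apply: UV; rewrite /= by_.
Qed.

End Extension.

Section Assembly.
Context {R : realType} {X : topologicalType}.
Local Open Scope ring_scope.
Implicit Types (J : set X) (j : R -> X) (c : X -> R) (s t u : R) (x : X).

Lemma homeomorphism_chart J (h : set_type J -> set_type (open_unit_interval R)) x :
  open J -> homeomorphism h -> exists j, chart J j (extend (set_val \o h) 0).
Proof.
(* The point [x] is the default value of [j] outside []0, 1[]. *)
move=> Jo [hc [g [gc hg gh]]]; exists (extend (set_val \o g) x).
have Io : open (open_unit_interval R) by exact: interval_open.
have I01 t : open_unit_interval R t <-> 0 < t < 1.
  by rewrite /open_unit_interval /= in_itv.
split=> //.
- move=> t /I01 /(@set_type_val _ (open_unit_interval R))[a <-]; rewrite extend_val /=; split.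
    exact: set_val_mem.
  by rewrite extend_val /= gh.
- move=> _ /(@set_type_val _ J)[a <-]; rewrite extend_val /=; split.
    exact: (I01 _).1 (set_val_mem (h a)).
  by rewrite extend_val /= hg.
- move=> t /I01 It; apply: extend_continuous => // a.
  by apply: continuous_comp; [exact: gc|exact: set_val_continuous].
- move=> y Jy; apply: extend_continuous => // a.
  by apply: continuous_comp; [exact: hc|exact: set_val_continuous].
Qed.

Lemma conv_in_chart_hull J (h : set_type J -> set_type (open_unit_interval R))
    (M : set X) :
  conv_in h (M `&` J) =
  chart_hull (M := M) (J := J) (c := extend (set_val \o h) 0).
Proof.
rewrite /conv_in /chart_hull.
have -> : extend (set_val \o h) 0 @` (J `&` M) =
    (set_val \o h) @` (set_val @^-1` (M `&` J)).
  apply/seteqP; split=> [_ [_ [/(@set_type_val _ J)[a <-] Ma] <-]|_ [a [Ma Ja] <-]].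
    by exists a; rewrite ?extend_val//; split=> //; exact: set_val_mem.
  by exists (set_val a); rewrite ?extend_val.
apply/seteqP; split=> [_ [a ha <-]|x [/(@set_type_val _ J)[a <-] ha]].
  by split; [exact: set_val_mem|rewrite extend_val].
by rewrite extend_val in ha; exists a.
Qed.

(** The closure of the orbit of a point of [M] is closed and invariant, and nonempty because [S] is;
    so it equals [M], which is the density required by [ms_dense]. *)
Lemma action_minimal_system (S : addSemigroupType) (Phi : S * X -> X) (M : set X) :
  [set: S] !=set0 -> compact [set: X] -> hausdorff_space X ->
  is_action Phi -> minimal_set Phi M -> minimal_system (acting_map Phi) M.
Proof.
move=> [s0 _] Xc hX [Phic Phiadd] [[M0 Mcl Minv] Mmin].
have fc (s : S) : continuous (acting_map Phi s).
  move=> x; apply: (@continuous_comp _ _ _ (fun y : X => (s : discrete_topology S, y))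
    (Phi : discrete_topology S * X -> X)); last exact: Phic.
  exact: (cvg_pair (cvg_cst (s : discrete_topology S)) cvg_id).
have finv (s : S) x : M x -> M (acting_map Phi s x).
  by move=> Mx; apply: (Minv s); exists x.
split=> //; first by move=> s t x; rewrite /acting_map Phiadd.
move=> x U Mx Uo [y [Uy My]].
pose O := [set acting_map Phi s x | s in [set: S]].
have OM : closure O = M.
  apply: Mmin; last first.
    rewrite [X in _ `<=` X](closure_id M).1//; apply: closureS => _ [s _ <-].
    exact: finv.
  split.
  - by exists (acting_map Phi s0 x); apply: subset_closure; exists s0.
  - exact: closed_closure.
  move=> t _ [w Ow <-] V /fc /Ow[_ [[s _ <-] Vs]].
  exists (acting_map Phi (t + s) x); split; first by exists (t + s).
  by move: Vs; rewrite /= /acting_map Phiadd.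
have [_ [[s _ <-] Us]] : (O `&` U) !=set0.
  by rewrite -OM in My; apply: My; exact: open_nbhs_nbhs.
by exists s.
Qed.

Lemma infinite_of_injection (A : set X) (u : nat -> X) : injective u ->
  (forall n, A (u n)) -> infinite_set A.
Proof.
move=> uinj uA Afin; apply: infinite_nat.
have <- : u @^-1` A = setT by apply/seteqP; split=> // n _; exact: uA.
by apply: finite_preimage => // n m _ _; exact: uinj.
Qed.

(** Used to refute the condition on circles in the other two cases: a simple loop inside [M] makes
    [M] infinite and, if it meets [J], fills an open arc of it. *)
Lemma circle_through (A : set X) x : is_finite_union_of_circles R A -> A x ->
  exists2 g : R -> X, simple_loop g /\ g @` setT `<=` A &
    exists2 s : R, 0 <= s < 1 & g s = x.
Proof.
move=> [n [F [_ [G [Gc FG GF]]]]] /(@set_type_val _ A)[a <-].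
case E : (F a) => [i p].
pose q t : set_type (unit_circle R) := SigSub (mem_set (circle_path_mem t)).
have qc : continuous q by apply: into_subtype_continuous; exact: circle_path_continuous.
pose g t := set_val (G (existT (fun=> set_type (unit_circle R)) i (q t))).
exists g.
  split; last by move=> _ [t _ <-]; exact: set_val_mem.
  split.
  - move=> t; apply: (@continuous_comp _ _ _ (G \o existT _ i \o q) set_val).
      apply: (@continuous_comp _ _ _ q (G \o existT _ i)); first exact: qc.
      apply: (@continuous_comp _ _ _ (existT (fun=> set_type (unit_circle R)) i) G).
        exact: existT_continuous.
      exact: Gc.
    exact: set_val_continuous.
  - rewrite /g; congr (set_val (G (existT _ i _))).
    apply: set_val_injective; rewrite -[LHS]/(circle_path 0) -[RHS]/(circle_path 1).
    by rewrite circle_path0 circle_path1.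
  - move=> s t s01 t01 /set_val_injective /(can_inj GF) st.
    apply: circle_path_inj => //.
    pose pr (z : {_ : 'I_n & set_type (unit_circle R)}) := set_val (projT2 z).
    exact: (congr1 pr st : pr _ = pr _).
have [s s01 sp] := circle_path_surj (set_val_mem p); exists s => //.
rewrite /g; congr set_val; apply: (can_inj FG); rewrite GF E.
by congr existT; apply: set_val_injective.
Qed.

Lemma simple_loop_infinite (g : R -> X) (A : set X) : simple_loop g ->
  g @` setT `<=` A -> infinite_set A.
Proof.
move=> [_ _ ginj] gA.
(* The numbers [1 / (n + 2)] lie in [[0, 1[], where [g] is injective. *)
apply: (@infinite_of_injection A (fun n => g (n.+2%:R^-1))) => [n m|n]; last first.
  by apply: gA; eexists.
have b (k : nat) : 0 <= (k.+2%:R^-1 : R) < 1.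
  by rewrite invr_ge0 ler0n invf_lt1 ?ltr1n ?ltr0n.
move=> /(ginj _ _ (b n) (b m)) /invr_inj /eqP; rewrite eqr_nat => /eqP.
by case.
Qed.

Lemma cantor_infinite (A B : set X) : is_cantor A -> A `<=` B -> infinite_set B.
Proof.
move=> [F [_ [G [_ FG GF]]]] AB.
(* The points are the indicator sequences of singletons. *)
apply: (@infinite_of_injection B
  (fun n => set_val (G (fun k : nat => k == n)))) => [n m|n]; last first.
  by apply: AB; exact: set_val_mem.
move=> /set_val_injective /(can_inj GF) /(congr1 (fun v : nat -> bool => v n)) /=.
by rewrite eqxx => /esym/eqP.
Qed.

(** By injectivity the coordinates at [s] and at a slightly later time differ, and the loop takes
    all values between them. *)
Lemma simple_loop_sweeps J j c (M : set X) (g : R -> X) s : chart J j c ->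
  simple_loop g -> g @` setT `<=` M -> 0 <= s < 1 -> J (g s) ->
  exists U, [/\ open U, U !=set0 & U `<=` J `&` M].
Proof.
move=> Jc [gc _ ginj] gM s01 Jgs; have [Jo jc cj jcont ccont] := Jc.
have [e e0 eJ] : exists2 e : R, 0 < e & forall t, `|t - s| < e -> J (g t).
  by apply: nbhs_distP; apply: gc; exact: open_nbhs_nbhs.
(* The later time has to stay below [1] for injectivity and close to [s] for the loop to remain in
   [J]. *)
pose r := Num.min (s + e) 1.
have [re r1 sr] : [/\ r <= s + e, r <= 1 & s < r].
  by rewrite /r !ge_min !lexx orbT lt_min; split=> //; rlra.
pose t := (s + r) / 2.
have st : s < t < r by rewrite /t; rlra.
have Jg u : s <= u <= t -> J (g u).
  by move=> ut; apply: eJ; rewrite ltr_norml; rlra.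
have cgc : {within `[s, t], continuous (c \o g)}.
  apply: continuous_in_subspaceT => v; rewrite inE/= in_itv/= => vst.
  by apply: continuous_comp; [exact: gc|apply: ccont; exact: Jg].
have cst : c (g s) != c (g t).
  apply/eqP => E; suff : s = t by rlra.
  apply: ginj; [rlra|rlra|].
  have [_ <-] := cj _ Jgs; rewrite E.
  by have [|_ ->] := cj (g t) => //; apply: Jg; rlra.
pose lo := Num.min (c (g s)) (c (g t)); pose hi := Num.max (c (g s)) (c (g t)).
have lohi : lo < hi.
  move: cst; rewrite neq_lt /lo /hi => /orP[h|h].
    by rewrite min_l ?max_r ?(ltW h).
  by rewrite min_r ?max_l ?(ltW h).
have [lo0 hi1] : 0 < lo /\ hi < 1.
  have [cs _] := cj _ Jgs; have [|ct _] := cj (g t); first by apply: Jg; rlra.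
  by rewrite lt_min gt_max; split; rlra.
exists [set w | J w /\ lo < c w < hi]; split.
- exact: chart_open Jc.
- have [|Jm cm] := jc ((lo + hi) / 2); first rlra.
  by exists (j ((lo + hi) / 2)); split; rewrite // cm; rlra.
move=> w [Jw cw]; split=> //; have [cw01 jw] := cj _ Jw.
have st' : s <= t by rlra.
have [|v] := IVT st' cgc (v := c w); first by rewrite /= -/lo -/hi; rlra.
rewrite in_itv/= => vst cv; rewrite -jw -cv /=.
by have [|_ ->] := cj (g v); [apply: Jg|apply: gM; exists v].
Qed.

(** Each path runs through the image of one compact arc of [J] under a map of a backward cover;
    [clamp] makes it continuous on the whole line, and over [[0, 1]] it still covers that arc. *)
Lemma minimal_peano_hull (S : addSemigroupType) (f : S -> X -> X) (M : set X)
    J j c x :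
  minimal_system f M -> chart J j c -> M x -> J x ->
  exists Y : set X, [/\ closed Y, M `<=` Y, metrizable R (set_type Y) &
    locally_connected (set_type Y)].
Proof.
move=> A Jc Mx Jx; have [_ jc cj jcont _] := Jc; have [cx jx] := cj _ Jx.
pose a := c x / 2; pose b := (1 + c x) / 2.
have [a0 b1] : 0 < a < c x /\ c x < b < 1 by rewrite /a /b; rlra.
clearbody a b.
have [|l lM] := backward_cover A (chart_open a b Jc).
  by exists x; split=> //; split=> //=; rlra.
have [s0|l0] := pselect (exists s0 : S, s0 \in l); last first.
  by have [q ql] := lM _ Mx; case: l0; exists q.
case: s0 => s0 _.
pose p i t : X := f (nth s0 l i) (j (clamp a b t)).
have pc i : continuous (p i).
  move=> t; apply: (@continuous_comp _ _ _ (j \o clamp a b) (f (nth s0 l i))).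
    apply: continuous_comp; first exact: clamp_continuous.
    have /andP[at_ tb] : a <= clamp a b t <= b by apply: clamp_itv; rlra.
    by apply: jcont; rlra.
  exact: (ms_continuous A).
have hX := ms_hausdorff A.
have Ycl := path_union_closed (n := size l) hX pc.
exists (path_union p (size l)); split=> //.
- move=> z /lM[q ql [w [[Jw cw] Mw] <-]]; exists (index q l).
    by rewrite /= index_mem.
  have [cw01 jw] := cj _ Jw.
  exists (c w); first by rewrite /= in_itv/=; rlra.
  by rewrite /p nth_index// clamp_id ?jw//; rlra.
- exact: path_union_metrizable (ms_compact A) hX pc Ycl (fun=> id).
- exact: path_union_locally_connected hX pc.
Qed.

Lemma open_subset_chart J j c U : chart J j c -> open U -> U !=set0 -> U `<=` J ->
  exists J' j' c', [/\ @chart R X J' j' c', J' `<=` U & J' !=set0].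
Proof.
move=> Jc Uo [x Ux] UJ; have [Jo jc cj jcont ccont] := Jc.
have [cx jx] := cj _ (UJ _ Ux).
have [e e0 eU] : exists2 e : R, 0 < e & forall t, `|t - c x| < e -> U (j t).
  by apply: nbhs_distP; apply: jcont => //; rewrite jx; exact: open_nbhs_nbhs.
pose a := Num.max (c x - e) 0; pose b := Num.min (c x + e) 1.
have [ae a0 ax] : [/\ c x - e <= a, 0 <= a & a < c x].
  by rewrite /a !le_max !lexx orbT gt_max; split=> //; rlra.
have [be b1 xb] : [/\ b <= c x + e, b <= 1 & c x < b].
  by rewrite /b !ge_min !lexx orbT lt_min; split=> //; rlra.
exists [set y | J y /\ a < c y < b], (fun t => j (a + (b - a) * t)),
  (fun y => (c y - a) / (b - a)); split.
- by apply: chart_sub => //; rlra.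
- move=> y [Jy cy]; have [cy01 <-] := cj _ Jy.
  by apply: eU; rewrite ltr_norml; rlra.
- by exists x; split; [exact: UJ|rlra].
Qed.

End Assembly.

Section CantorCase.
Context {R : realType} {S : addSemigroupType} {X : topologicalType}.
Local Open Scope ring_scope.

Lemma chart_hull_cantor (f : S -> X -> X) (M J : set X) (j : R -> X) (c : X -> R) x :
  minimal_system f M -> infinite_set M -> chart J j c -> M x -> J x ->
  (forall U, open U -> U !=set0 -> ~ U `<=` J `&` M) ->
  let B := closure (chart_hull (M := M) (J := J) (c := c)) in
  [/\ nowhere_dense M, is_arc R B \/ is_circle R B & is_cantor (M `&` B)].
Proof.
move=> A Minf Jc Mx Jx noint B.
have hX := ms_hausdorff A.
have [m1 [z1 hi]] := exists_upper_end A Minf Jc Jx Mx.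
have [m [z0 lo]] := exists_upper_end A Minf (chart_rev Jc) Jx Mx.
have {}lo : lower_end (M := M) (J := J) (j := j) (c := c) (1 - m) z0.
  by rewrite /lower_end (_ : 1 - (1 - m) = m)//; ring.
have m01 := end_points_ordered Jc lo hi Jx Mx.
have -> : B = hull_loop (j := j) (1 - m) m1 z0 z1 @` `[0, 1].
  by rewrite /B (closure_chart_hull hX Jc lo hi m01) hull_loop_range.
split.
- exact: minimal_nowhere_dense A Minf Jc Mx Jx noint.
- exact: hull_arc_or_circle hX Jc lo hi m01.
- exact: hull_is_cantor (ms_compact A) A Minf Jc lo hi m01 noint.
Qed.

End CantorCase.

Theorem theoremD (R : realType) (X : topologicalType)
    (X_compact : compact [set: X]) (X_hausdorff : hausdorff_space X)
    (J : set X) (J_free : free_interval R J)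
    (h : set_type J -> set_type (open_unit_interval R))
    (h_homeo : homeomorphism h)
    (S : addSemigroupType) (S_nonempty : [set: S] !=set0)
    (Phi : S * X -> X) (Phi_action : is_action Phi)
    (M : set X) (M_minimal : minimal_set Phi M)
    (M_meets_J : M `&` J !=set0) :
  (exists Y : set X,
     [/\ closed Y, M `<=` Y, metrizable R (set_type Y) &
         locally_connected (set_type Y)]) /\
  exactly_one_of3
    (finite_set M)
    (is_finite_union_of_circles R M)
    (let A := closure (conv_in h (M `&` J)) in
     [/\ nowhere_dense M, is_arc R A \/ is_circle R A & is_cantor (M `&` A)]).
Proof.
have A := action_minimal_system S_nonempty X_compact X_hausdorff Phi_action M_minimal.
have [x [Mx Jx]] := M_meets_J.
have [j Jc] := homeomorphism_chart x J_free.1 h_homeo.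
split; first exact: minimal_peano_hull A Jc Mx Jx.
rewrite conv_in_chart_hull.
have [Mfin|Minf] := pselect (finite_set M).
  constructor 1; split=> //.
    move=> /circle_through/(_ Mx)[g [gloop gM] _].
    exact: simple_loop_infinite gloop gM Mfin.
  by move=> [_ _ K]; exact: cantor_infinite K (@subIsetl _ _ _) Mfin.
have [[U [Uo U0 UJM]]|noint] :=
    pselect (exists U, [/\ open U, U !=set0 & U `<=` J `&` M]).
  constructor 2; split=> //.
    have [J' [j' [c' [Jc' J'U J'0]]]] :=
      open_subset_chart Jc Uo U0 (fun y Uy => (UJM y Uy).1).
    have J'M : J' `<=` M by move=> y /J'U /UJM[].
    have [n [g [gloop -> gdisj]]] := minimal_circles A Minf Jc' J'M.
    exact: disjoint_loops_circles.
  move=> [Mnd _ _]; have [u Uu] := U0.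
  have : interior (closure M) u.
    apply: filterS (open_nbhs_nbhs (conj Uo Uu)) => y /UJM[_ My].
    exact: subset_closure.
  by rewrite Mnd.
constructor 3; split=> //.
  (* A circle through [x] would fill an open arc of [J] with points of [M]. *)
  move=> /circle_through/(_ Mx)[g [gloop gM] [s s01 gsx]].
  apply: noint; apply: (simple_loop_sweeps Jc gloop gM s01).
  by rewrite gsx.
apply: chart_hull_cantor A Minf Jc Mx Jx _ => U Uo U0 UJM.
by apply: noint; exists U.
Qed.
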